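(* Let $F$ be a PMT with $K$ regions that is structurally stable in $X_{PMT,K}$ and has no wandering regular components. Then $F$ is hyperbolic.
   Context: A piecewise Möbius transformation (PMT) is a pair $(\{R_k\}_{k=1}^K,F)$ where the $R_k$ are nonempty, open, connected, pairwise disjoint subsets of $\widehat{\mathbb C}$, each $\partial R_k$ a union of piecewise smooth simple closed curves, $\bigcup_k\overline{R_k}=\widehat{\mathbb C}$; $F|_{R_k}=f_k|_{R_k}$ with $f_k\in PSL(2,\mathbb C)$, and $F$ is undefined on the discontinuity set $B(F)=\bigcup_k\partial R_k$; the partition is minimal. $F^{-n}(A)$ is the set of $z$ with $F^j(z)\in R(F)=\bigcup_kR_k$ for $0\le j<n$ and $F^n(z)\in A$; $\mathcal B(F)=\overline{\bigcup_{n\ge0}F^{-n}(B(F))}$, $\mathcal R(F)=\widehat{\mathbb C}\setminus\mathcal B(F)$. Periodic points: $z$ periodic of period $n$ if $F^j(z)\in R(F)$ for all $j$ and $F^n(z)=z$; with $M_z$ the Möbius composition of component functions along the orbit and $m$ its multiplier at $z$: identity type if $F^n=\mathrm{id}$ on a neighborhood of $z$; otherwise attracting ($|m|<1$), repelling ($|m|>1$), elliptic ($|m|=1,m\neq1$), parabolic ($m=1$). Regular components are components of $\mathcal R(F)$; periodic of period $n$ if $F^n(U)\subset U$; wandering if the components containing $F^n(U)$, $n\ge0$, are pairwise distinct. Ghost-periodic point: $z_0\in F^{-N}(B(F))$ for some $N\ge0$, lying on $\partial U$ for a periodic regular component $U$ of period $n$ with $(F^n)^k(z)\to z_0$ for all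 $z\in U$. $F$ is hyperbolic if it has at least one attracting periodic point, no elliptic, parabolic or identity-type periodic points, no ghost-periodic points, and no wandering regular components. $X_{PMT,K}=PSL(2,\mathbb C)^K\times\mathcal P_K(\widehat{\mathbb C})$ with product topology, $\mathcal P_K(\widehat{\mathbb C})$ the space of discontinuity sets of $K$-region partitions with the Hausdorff metric. $F$ is structurally stable if there is a neighborhood $\mathcal N_F\subset X_{PMT,K}$ of $F$ such that every $G\in\mathcal N_F$ is topologically conjugate to $F$ via a homeomorphism $h$ of $\widehat{\mathbb C}$ with $h\circ F=G\circ h$. *)

(* Defs.v *)
From mathcomp Require Import all_boot all_order all_algebra.
From mathcomp Require Import all_classical all_reals all_analysis.
From mathcomp Require Import complex.
Import Order.TTheory GRing.Theory Num.Theory.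
Import numFieldNormedType.Exports.

Set Implicit Arguments.
Unset Strict Implicit.
Unset Printing Implicit Defensive.

Local Open Scope ring_scope.
Local Open Scope classical_set_scope.

Section PMT.
Variable R : realType.

Definition Cplx : numFieldType := R[i].
Definition nrm (z : Cplx) : R := @Normc.normc R z.

(** the Riemann sphere: None is the point at infinity *)
Definition sphere := option Cplx.

Definition chord (z w : sphere) : R :=
  match z, w with
  | Some a, Some b =>
      2 * nrm (a - b) / Num.sqrt ((1 + nrm a ^+ 2) * (1 + nrm b ^+ 2))
  | Some a, None => 2 / Num.sqrt (1 + nrm a ^+ 2)
  | None, Some b => 2 / Num.sqrt (1 + nrm b ^+ 2)
  | None, None => 0
  end.

Definition sball (z : sphere) (e : R) : set sphere := [set w | chord z w < e].
Definition sopen (A : set sphere) : Prop :=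
  forall z, A z -> exists2 e : R, 0 < e & sball z e `<=` A.
Definition sclosure (A : set sphere) : set sphere :=
  [set z | forall e : R, 0 < e -> exists w, A w /\ chord z w < e].
Definition sinterior (A : set sphere) : set sphere :=
  [set z | exists2 e : R, 0 < e & sball z e `<=` A].
Definition sboundary (A : set sphere) : set sphere :=
  sclosure A `\` sinterior A.
Definition sconnected (A : set sphere) : Prop :=
  forall P Q : set sphere, A = P `|` Q -> P !=set0 -> Q !=set0 ->
    sclosure P `&` Q = set0 -> P `&` sclosure Q = set0 -> False.
Definition component (A U : set sphere) : Prop :=
  [/\ U `<=` A, U !=set0, sconnected U &
      forall V, V `<=` A -> sconnected V -> U `&` V !=set0 -> V `<=` U].
Definition scont (f : sphere -> sphere) : Prop :=
  forall z (e : R), 0 < e -> exists2 d : R, 0 < d &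
    forall w, chord z w < d -> chord (f z) (f w) < e.
Definition homeo (h : sphere -> sphere) : Prop :=
  exists g : sphere -> sphere, [/\ cancel h g, cancel g h, scont h & scont g].
Definition sconv (u : nat -> sphere) (z : sphere) : Prop :=
  forall e : R, 0 < e -> exists N : nat, forall n, (N <= n)%N -> chord (u n) z < e.
Definition hclose (A B : set sphere) (e : R) : Prop :=
  (forall a, A a -> exists2 b, B b & chord a b < e) /\
  (forall b, B b -> exists2 a, A a & chord a b < e).

Definition rcont (g : R -> sphere) : Prop :=
  forall t (e : R), 0 < e -> exists2 d : R, 0 < d &
    forall s, `|t - s| < d -> chord (g t) (g s) < e.
Definition C1fun (x : R -> R) : Prop :=
  (forall t, derivable x t 1) /\ continuous (derive1 x).
Definition inv_sph (z : sphere) : sphere :=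
  match z with
  | Some a => if a == 0 then None else Some a^-1
  | None => Some 0
  end.
(* on [a,b], g is a regular C^1 arc in one of the two standard charts *)
Definition smooth_piece (g : R -> sphere) (a b : R) : Prop :=
  exists x y : R -> R,
    [/\ C1fun x, C1fun y,
        (forall t, a <= t <= b -> derive1 x t != 0 \/ derive1 y t != 0) &
        (forall t, a <= t <= b -> g t = Some (Complex (x t) (y t) : Cplx)) \/
        (forall t, a <= t <= b -> g t = inv_sph (Some (Complex (x t) (y t) : Cplx)))].
Definition psscc (S : set sphere) : Prop :=
  exists g : R -> sphere,
    [/\ rcont g, (forall t, g (t + 1) = g t),
        (forall s t, 0 <= s < 1 -> 0 <= t < 1 -> g s = g t -> s = t),
        S = range g &
        exists (m : nat) (tt : nat -> R),
          [/\ tt 0%N = 0, tt m = 1,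
              (forall i, (i < m)%N -> tt i < tt i.+1) &
              (forall i, (i < m)%N -> smooth_piece g (tt i) (tt i.+1))]].

Definition mob (A : 'M[Cplx]_2) (z : sphere) : sphere :=
  let a := A ord0 ord0 in let b := A ord0 ord_max in
  let c := A ord_max ord0 in let d := A ord_max ord_max in
  match z with
  | Some w => if c * w + d == 0 then None else Some ((a * w + b) / (c * w + d))
  | None => if c == 0 then None else Some (a / c)
  end.

(* multiplier of the Moebius map A at its fixed point z: derivative in the
   standard chart (w at finite points, 1/w at infinity) *)
Definition multiplier (A : 'M[Cplx]_2) (z : sphere) : Cplx :=
  let a := A ord0 ord0 in let b := A ord0 ord_max in
  let c := A ord_max ord0 in let d := A ord_max ord_max in
  match z with
  | Some z0 => derive1 (fun w : Cplx => (a * w + b) / (c * w + d)) z0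
  | None => derive1 (fun w : Cplx => (c + d * w) / (a + b * w)) 0
  end.

(* PSL(2,C) closeness of the classes of A and B *)
Definition mxclose (A B : 'M[Cplx]_2) (e : R) : Prop :=
  forall i j, nrm (A i j - B i j) < e.
Definition pslclose (A B : 'M[Cplx]_2) (e : R) : Prop :=
  mxclose A B e \/ mxclose A (- B) e.

Record pmt (K : nat) := PMT {
  reg : 'I_K -> set sphere;
  mat : 'I_K -> 'M[Cplx]_2 }.

Variable K : nat.
Implicit Types F G : pmt K.

Definition Rset F : set sphere := [set z | exists k, reg F k z].
Definition Bset F : set sphere := [set z | exists k, sboundary (reg F k) z].

Definition is_pmt F : Prop :=
  (forall k, reg F k !=set0) /\
  (forall k, sopen (reg F k)) /\
  (forall k, sconnected (reg F k)) /\
  (forall j k, j != k -> reg F j `&` reg F k = set0) /\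
  (forall k, exists (m : nat) (S : 'I_m -> set sphere),
      (forall i, psscc (S i)) /\
      sboundary (reg F k) = [set z | exists i, S i z]) /\
  (forall z, exists k, sclosure (reg F k) z) /\
  (forall k, \det (mat F k) = 1) /\
  (* minimality: no point of B(F) is removable, i.e. F does not agree
     with a single Moebius map near a discontinuity point *)
  ~ (exists (z : sphere) (e : R) (A : 'M[Cplx]_2),
       [/\ Bset F z, 0 < e &
           forall k w, reg F k w -> chord z w < e ->
             mob (mat F k) w = mob A w]).

(* F extended by the identity on B(F) (values there are never used) *)
Definition Ftot F (z : sphere) : sphere :=
  match pselect (exists k, reg F k z) with
  | left h => mob (mat F (sval (cid h))) z
  | right _ => z
  end.
Definition regmat F (z : sphere) : 'M[Cplx]_2 :=
  match pselect (exists k, reg F k z) with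
  | left h => mat F (sval (cid h))
  | right _ => 1%:M
  end.
Definition Fn F (n : nat) : sphere -> sphere := iter n (Ftot F).
Fixpoint omat F (n : nat) (z : sphere) : 'M[Cplx]_2 :=
  if n is n'.+1 then omat F n' (Ftot F z) *m regmat F z else 1%:M.

Definition preimg F (n : nat) (A : set sphere) : set sphere :=
  [set z | (forall j, (j < n)%N -> Rset F (Fn F j z)) /\ A (Fn F n z)].
Definition Bcal F : set sphere :=
  sclosure [set z | exists n, preimg F n (Bset F) z].
Definition Rcal F : set sphere := ~` Bcal F.
Definition reg_comp F (U : set sphere) : Prop := component (Rcal F) U.

Definition periodic_pt F (n : nat) (z : sphere) : Prop :=
  [/\ (0 < n)%N, (forall j, Rset F (Fn F j z)) & Fn F n z = z].
Definition identity_type F n z : Prop :=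
  periodic_pt F n z /\
  exists2 e : R, 0 < e & forall w, chord z w < e ->
    (forall j, (j < n)%N -> Rset F (Fn F j w)) /\ Fn F n w = w.
Definition mult F n z : Cplx := multiplier (omat F n z) z.
Definition attracting_pt F n z : Prop :=
  [/\ periodic_pt F n z, ~ identity_type F n z & `|mult F n z| < 1].
Definition repelling_pt F n z : Prop :=
  [/\ periodic_pt F n z, ~ identity_type F n z & 1 < `|mult F n z|].
Definition elliptic_pt F n z : Prop :=
  [/\ periodic_pt F n z, ~ identity_type F n z,
      `|mult F n z| = 1 & mult F n z != 1].
Definition parabolic_pt F n z : Prop :=
  [/\ periodic_pt F n z, ~ identity_type F n z & mult F n z = 1].

Definition periodic_comp F (U : set sphere) (n : nat) : Prop :=
  [/\ reg_comp F U, (0 < n)%N & Fn F n @` U `<=` U].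
Definition wandering F (U : set sphere) : Prop :=
  reg_comp F U /\
  forall (m n : nat) (V W : set sphere), m <> n -> reg_comp F V -> reg_comp F W ->
    Fn F m @` U `<=` V -> Fn F n @` U `<=` W -> V <> W.
Definition ghost_periodic F (z0 : sphere) : Prop :=
  (exists N, preimg F N (Bset F) z0) /\
  exists (U : set sphere) (n : nat),
    [/\ periodic_comp F U n, sboundary U z0 &
        forall z, U z -> sconv (fun k => Fn F (k * n) z) z0].

Definition hyperbolic F : Prop :=
  (exists n z, attracting_pt F n z) /\
  ~ (exists n z, elliptic_pt F n z) /\
  ~ (exists n z, parabolic_pt F n z) /\
  ~ (exists n z, identity_type F n z) /\
  ~ (exists z0, ghost_periodic F z0) /\
  ~ (exists U, wandering F U).

Definition top_conj F G : Prop :=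
  exists h : sphere -> sphere,
    [/\ homeo h, h @` Rset F = Rset G &
        forall z, Rset F z -> h (Ftot F z) = Ftot G (h z)].

Definition struct_stable F : Prop :=
  exists2 e : R, 0 < e &
    forall G, is_pmt G ->
      (forall k, pslclose (mat G k) (mat F k) e) ->
      hclose (Bset G) (Bset F) e ->
      (forall k, hclose (sclosure (reg G k)) (sclosure (reg F k)) e) ->
      top_conj F G.

End PMT.

(* Main.v *)
Require Import Defs.
From mathcomp Require Import all_boot all_order all_algebra.
From mathcomp Require Import all_classical all_reals all_analysis.
From mathcomp Require Import complex.
From mathcomp Require Import ring lra.
Import Order.TTheory GRing.Theory Num.Theory.
Import numFieldNormedType.Exports.

Set Implicit Arguments.
Unset Strict Implicit.
Unset Printing Implicit Defensive.

Local Open Scope ring_scope.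
Local Open Scope classical_set_scope.

(* Structural stability is exploited through two kinds of perturbation: of the matrices, and of the partition
   by a twist of the sphere about a point, both of which give maps conjugate to F.

   Neutral and identity-type cycles: a neutral fixed point of the return map has complete orbits arbitrarily near
   it, a property invariant under conjugacy; but the matrices can be perturbed so that all words of length n have
   non-real trace, hence are loxodromic. A ghost-periodic point is a fixed point of a word that later hits B(F);
   conjugating all matrices by one Moebius map near 1, with the partition kept, moves these finitely many fixed
   points off B(F). If the regular set is nonempty and nothing wanders, some regular point has a periodic itinerary
   w; after making M_w loxodromic, its attracting fixed point is an attracting cycle, or else a ghost.

   It remains to see that the regular set is nonempty. A stable F has no coincidence, that is no q in the boundary
   of R_k whose orbit, started with f_k, hits B(F): by Baire's theorem a generic conjugate of the matrices has no
   open arc of coincidences, while given one coincidence a twist along smooth arcs through q and its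
   image creates an open arc of them. Then the orbit of a boundary point q stays away from B(F), as a twist about
   a limit point in B(F) would produce a coincidence. For the same reason the itinerary of q is unchanged under conjugation
   of the matrices by Moebius maps near 1, so near q the branches along it omit two points and are
   equicontinuous; hence a ball about f_k(q) never meets B(F). *)

(** * Vectors, Moebius maps and the chordal metric *)

Section Vectors.
Variable R : realType.
Notation C := (Cplx R).
Implicit Types (a b k l : C) (s t : R).

Local Arguments nrm : simpl never.

(** The conjugacy supplied by structural stability need not be close to the identity and may permute
    the regions, so a given word or point of F cannot be followed to a nearby map. Only the length
    of a word survives. Hence every transported property (a bi-infinite orbit near a fixed point of
    a word, [wghost F n N], [coin F n], [intcoin F n]) depends on lengths alone, and every
    perturbation has to work for all words of a given length at once. This is affordable because
    such words are finite in number and conjugating all matrices by S conjugates the map of each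
    word by S as a whole. A coincidence starts at a boundary point, where F is undefined, so the
    conjugacy relation is extended by continuity from each region to its closure. The perturbed
    object must again be a PMT: twists have to preserve piecewise smooth curves in both charts, and
    minimality must survive, which it does because matrices distinct in PSL(2,C) stay distinct under
    small changes. *)

Lemma nrm_ge0 (z : C) : 0 <= nrm z.
Proof. by rewrite /nrm /Normc.normc; case: z => ? ?; rewrite sqrtr_ge0. Qed.

Lemma nrm0 : nrm (0 : C) = 0.
Proof. exact: Normc.normc0. Qed.

Lemma nrm1 : nrm (1 : C) = 1.
Proof. exact: Normc.normc1. Qed.

Lemma nrm_eq0 (z : C) : (nrm z == 0) = (z == 0).
Proof.
by apply/eqP/eqP => [/Normc.eq0_normc|->] //; exact: nrm0.
Qed.

Lemma nrm_gt0 (z : C) : (0 < nrm z) = (z != 0).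
Proof. by rewrite lt0r nrm_eq0 nrm_ge0 andbT. Qed.

Lemma nrmM (x y : C) : nrm (x * y) = nrm x * nrm y.
Proof. exact: Normc.normcM. Qed.

Lemma nrmV (x : C) : nrm x^-1 = (nrm x)^-1.
Proof. exact: Normc.normcV. Qed.

Lemma nrmN (x : C) : nrm (- x) = nrm x.
Proof. exact: (@complex.normcN R). Qed.

Lemma nrmX (x : C) n : nrm (x ^+ n) = nrm x ^+ n.
Proof. by elim: n => [|n IH]; rewrite ?expr0 ?nrm1 // !exprS nrmM IH. Qed.

Lemma nrmD (x y : C) : nrm (x + y) <= nrm x + nrm y.
Proof. exact: (@complex.le_normcD R). Qed.

Lemma nrmB (x y : C) : nrm (x - y) <= nrm x + nrm y.
Proof. by rewrite -(nrmN y) nrmD. Qed.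

Lemma nrmBC (x y : C) : nrm (x - y) = nrm (y - x).
Proof. by rewrite -nrmN opprB. Qed.

Lemma nrmBl (x y : C) : nrm x - nrm y <= nrm (x - y).
Proof. by have := nrmD (x - y) y; rewrite subrK; lra. Qed.

Lemma normE (z : C) : `|z| = (nrm z)%:C%C :> C.
Proof. by []. Qed.

Lemma nrm_real t : nrm (t%:C%C : C) = `|t|.
Proof. by rewrite /nrm /Normc.normc /= expr0n addr0 sqrtr_sqr. Qed.

Lemma nrmE (z : C) : nrm z ^+ 2 = complex.Re z ^+ 2 + complex.Im z ^+ 2.
Proof.
rewrite /nrm /Normc.normc; case: z => u v /=.
by rewrite sqr_sqrtr // addr_ge0 // sqr_ge0.
Qed.

(** Homogeneous coordinates: with the area form [wdg] and the Hermitian norm [hn] the chordal metric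
    is 2 |v ^ w| / (|v| |w|), without a separate case for infinity. *)
Definition vect := (C * C)%type.
Implicit Types (u v w : vect) (z : sphere R).

Definition wdg v w : C := v.1 * w.2 - v.2 * w.1.
Definition hn v : R := Num.sqrt (nrm v.1 ^+ 2 + nrm v.2 ^+ 2).
Definition vec (z : sphere R) : vect :=
  if z is Some a then (a, 1) else (1, 0).
Definition pt v : sphere R := if v.2 == 0 then None else Some (v.1 / v.2).
Definition scv k v : vect := (k * v.1, k * v.2).
Definition vadd v w : vect := (v.1 + w.1, v.2 + w.2).
Definition nzv v := v != (0, 0).

Lemma hn_ge0 v : 0 <= hn v. Proof. exact: sqrtr_ge0. Qed.

Lemma hnE v : hn v ^+ 2 = nrm v.1 ^+ 2 + nrm v.2 ^+ 2.
Proof. by rewrite sqr_sqrtr // addr_ge0 // sqr_ge0. Qed.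

Lemma hn_eq0 v : (hn v == 0) = (v == (0, 0)).
Proof.
have -> : (hn v == 0) = (hn v ^+ 2 == 0) by rewrite expf_eq0.
rewrite hnE; case: v => a b /=.
rewrite paddr_eq0 ?sqr_ge0 // !expf_eq0 /= !nrm_eq0.
by rewrite xpair_eqE.
Qed.

Lemma hn_gt0 v : (0 < hn v) = nzv v.
Proof. by rewrite lt0r hn_eq0 hn_ge0 andbT. Qed.

Lemma hn1 v : nrm v.1 <= hn v.
Proof.
rewrite -(@ler_pXn2r _ 2) ?nnegrE ?nrm_ge0 ?hn_ge0 // hnE.
by have := sqr_ge0 (nrm v.2); lra.
Qed.

Lemma hn2 v : nrm v.2 <= hn v.
Proof.
rewrite -(@ler_pXn2r _ 2) ?nnegrE ?nrm_ge0 ?hn_ge0 // hnE.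
by have := sqr_ge0 (nrm v.1); lra.
Qed.

Lemma hn_leD v : hn v <= nrm v.1 + nrm v.2.
Proof.
rewrite -(@ler_pXn2r _ 2) ?nnegrE ?addr_ge0 ?nrm_ge0 ?hn_ge0 // hnE.
by have := nrm_ge0 v.1; have := nrm_ge0 v.2; nra.
Qed.

Lemma hn_scv k v : hn (scv k v) = nrm k * hn v.
Proof.
apply/eqP; rewrite -(@eqrXn2 _ 2) ?mulr_ge0 ?nrm_ge0 ?hn_ge0 //.
by apply/eqP; rewrite exprMn !hnE /= !nrmM; ring.
Qed.

Lemma cauchy_hn v w : nrm v.1 * nrm w.1 + nrm v.2 * nrm w.2 <= hn v * hn w.
Proof.
rewrite -(@ler_pXn2r _ 2) ?nnegrE ?addr_ge0 ?mulr_ge0 ?nrm_ge0 ?hn_ge0 //.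
rewrite exprMn !hnE -subr_ge0.
set a := nrm v.1; set b := nrm v.2; set c := nrm w.1; set d := nrm w.2.
have -> : (a ^+ 2 + b ^+ 2) * (c ^+ 2 + d ^+ 2) - (a * c + b * d) ^+ 2 =
  (a * d - b * c) ^+ 2 by ring.
exact: sqr_ge0.
Qed.

Lemma hnD v w : hn (vadd v w) <= hn v + hn w.
Proof.
rewrite -(@ler_pXn2r _ 2) ?nnegrE ?addr_ge0 ?hn_ge0 // sqrrD !hnE /=.
have := nrmD v.1 w.1; have := nrmD v.2 w.2; have := cauchy_hn v w.
have := nrm_ge0 (v.1 + w.1); have := nrm_ge0 (v.2 + w.2).
rewrite mulr2n; nra.
Qed.

Lemma wdg_le v w : nrm (wdg v w) <= hn v * hn w.
Proof.
apply: le_trans (nrmB _ _) _; rewrite !nrmM.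
have := @cauchy_hn v (w.2, w.1); rewrite /= /hn /=.
by rewrite (addrC (nrm w.2 ^+ 2)).
Qed.

Lemma wdgC v w : wdg v w = - wdg w v.
Proof. rewrite /wdg; ring. Qed.

Lemma wdgvv v : wdg v v = 0.
Proof. rewrite /wdg; ring. Qed.

Lemma wdg_scl k v w : wdg (scv k v) w = k * wdg v w.
Proof. rewrite /wdg /=; ring. Qed.

Lemma wdg_scr k v w : wdg v (scv k w) = k * wdg v w.
Proof. rewrite /wdg /=; ring. Qed.

(** Three vectors of a plane are dependent, with the wedges as coefficients. Taking norms gives the
    triangle inequality for [chord]. *)
Lemma plucker u v w :
  scv (wdg u w) v = vadd (scv (wdg u v) w) (scv (wdg v w) u).
Proof. rewrite /scv /vadd /wdg /=; congr pair; ring. Qed.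

Lemma vec_nz z : nzv (vec z).
Proof. by rewrite /nzv; case: z => [a|] /=; rewrite xpair_eqE oner_eq0 ?andbF. Qed.

Lemma vecK z : pt (vec z) = z.
Proof. by case: z => [a|]; rewrite /pt /= ?eqxx // oner_eq0 divr1. Qed.

Lemma pt_vec v : nzv v -> exists2 k, k != 0 & v = scv k (vec (pt v)).
Proof.
case: v => a b; rewrite /nzv /pt xpair_eqE /=; case: (eqVneq b 0) => /= [->|b0].
  rewrite andbT => a0; exists a => //; rewrite /scv /=; congr pair; ring.
by move=> _; exists b => //; rewrite /scv /=; congr pair; field.
Qed.

Lemma wdg_eq0 v w : nzv v -> nzv w -> (wdg v w == 0) = (pt v == pt w).
Proof.
case: v => a b; case: w => c d; rewrite /nzv /wdg /pt !xpair_eqE /=.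
case: (eqVneq b 0) => [->|b0]; case: (eqVneq d 0) => [->|d0] /=;
  rewrite ?andbT ?andbF /= => a0 c0.
- by rewrite mulr0 mul0r subrr !eqxx.
- by rewrite mul0r subr0 mulf_eq0 (negbTE a0) (negbTE d0).
- by rewrite mulr0 sub0r oppr_eq0 mulf_eq0 (negbTE b0) (negbTE c0).
apply/eqP/eqP => [h|[h]].
  have {}h : a * d = b * c by apply/eqP; rewrite -subr_eq0; apply/eqP.
  by congr Some; apply/eqP; rewrite eqr_div //; apply/eqP; rewrite h mulrC.
have : a * d = b * c.
  have : a = c / d * b by rewrite -h; field.
  by move=> ->; field.
by move=> ->; rewrite subrr.
Qed.

Lemma pt_scv k v : k != 0 -> pt (scv k v) = pt v.
Proof.
case: v => a b k0; rewrite /pt /= mulf_eq0 (negbTE k0) /=.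
by case: (eqVneq b 0) => // b0; congr Some; rewrite -mulf_div divff ?mul1r.
Qed.

Lemma chord_vec z z' :
  chord z z' = 2 * nrm (wdg (vec z) (vec z')) / (hn (vec z) * hn (vec z')).
Proof.
case: z => [a|]; case: z' => [b|]; rewrite /chord /wdg /hn /= ?nrm1 ?nrm0.
- rewrite mulr1 mul1r !expr1n -sqrtrM ?addr_ge0 ?sqr_ge0 //.
  by congr (_ / Num.sqrt _); ring.
- rewrite mulr0 mulr1 sub0r nrmN nrm1 expr1n expr0n addr0 sqrtr1 !mulr1.
  by rewrite addrC.
- rewrite mulr1 mul0r subr0 nrm1 expr1n expr0n addr0 sqrtr1 mul1r mulr1.
  by rewrite addrC.
by rewrite mulr0 mul0r subrr nrm0 mulr0 mul0r.
Qed.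

Lemma chord_pt v w : nzv v -> nzv w ->
  chord (pt v) (pt w) = 2 * nrm (wdg v w) / (hn v * hn w).
Proof.
move=> v0 w0; rewrite chord_vec.
have [k k0 ev] := pt_vec v0; have [l l0 ew] := pt_vec w0.
move: (vec_nz (pt v)) (vec_nz (pt w)).
set v' := vec (pt v) in ev *; set w' := vec (pt w) in ew *.
move=> hv hw; rewrite ev ew wdg_scl wdg_scr !hn_scv !nrmM.
move: hv hw; rewrite -!hn_gt0 => hv hw.
have := nrm_gt0 k; rewrite k0 => kk; have := nrm_gt0 l; rewrite l0 => ll.
by field; rewrite !gt_eqF.
Qed.

(** A unit vector over z, whose phase is immaterial. It is locked so that computation does not
    unfold it. *)
Definition uv z : vect := locked (scv ((hn (vec z))^-1)%:C%C (vec z)).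

Lemma hn_vec_gt0 z : 0 < hn (vec z).
Proof. by rewrite hn_gt0 vec_nz. Qed.

Lemma nrm_realC_gt0 t : 0 < t -> nrm (t%:C%C : C) = t.
Proof. by move=> t0; rewrite nrm_real gtr0_norm. Qed.

Lemma hn_uv z : hn (uv z) = 1.
Proof.
by rewrite /uv -lock hn_scv nrm_realC_gt0 ?invr_gt0 ?hn_vec_gt0 // mulVf ?gt_eqF ?hn_vec_gt0.
Qed.

Lemma uv_nz z : nzv (uv z).
Proof. by rewrite -hn_gt0 hn_uv. Qed.

Lemma uvK z : pt (uv z) = z.
Proof.
rewrite /uv -lock pt_scv ?vecK // -nrm_eq0 nrm_realC_gt0 ?gt_eqF //;
  by rewrite invr_gt0 hn_vec_gt0.
Qed.

Lemma chordE z z' : chord z z' = 2 * nrm (wdg (uv z) (uv z')).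
Proof.
by rewrite -{1}(uvK z) -{1}(uvK z') chord_pt ?uv_nz // !hn_uv mulr1 divr1.
Qed.

Lemma chord_ge0 z z' : 0 <= chord z z'.
Proof. by rewrite chordE mulr_ge0 ?nrm_ge0. Qed.

Lemma chordC z z' : chord z z' = chord z' z.
Proof. by rewrite !chordE wdgC nrmN. Qed.

Lemma chord_eq0 z z' : (chord z z' == 0) = (z == z').
Proof.
by rewrite chordE mulf_eq0 pnatr_eq0 /= nrm_eq0 wdg_eq0 ?uv_nz // !uvK.
Qed.

Lemma chordzz z : chord z z = 0.
Proof. by apply/eqP; rewrite chord_eq0. Qed.

Lemma chord_gt0 z z' : (0 < chord z z') = (z != z').
Proof. by rewrite lt0r chord_eq0 chord_ge0 andbT. Qed.

Lemma chord_le2 z z' : chord z z' <= 2.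
Proof. by rewrite chordE; have := wdg_le (uv z) (uv z'); rewrite !hn_uv; lra. Qed.

Lemma wdg_tri u v w :
  nrm (wdg u w) * hn v <= nrm (wdg u v) * hn w + nrm (wdg v w) * hn u.
Proof. by rewrite -!hn_scv plucker; exact: hnD. Qed.

Lemma chord_tri y x z : chord x z <= chord x y + chord y z.
Proof.
rewrite !chordE; have := wdg_tri (uv x) (uv y) (uv z).
by rewrite !hn_uv !mulr1; lra.
Qed.

Notation M2 := 'M[C]_2.
Notation o0 := (ord0 : 'I_2).
Notation o1 := (ord_max : 'I_2).
Implicit Types (A B M : M2).

Definition mk2 a b (c d : C) : M2 :=
  \matrix_(i, j) (if i == o0 then if j == o0 then a else b
                  else if j == o0 then c else d).

Lemma mk2E a b (c d : C) : (mk2 a b c d o0 o0 = a) * (mk2 a b c d o0 o1 = b) *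
  (mk2 a b c d o1 o0 = c) * (mk2 a b c d o1 o1 = d).
Proof. by rewrite !mxE. Qed.

Lemma ord2P (i : 'I_2) : i = o0 \/ i = o1.
Proof.
by case: i => [[|[|]]] //= h; [left|right]; apply: val_inj.
Qed.

Lemma eq_mx2 A B : A o0 o0 = B o0 o0 -> A o0 o1 = B o0 o1 ->
  A o1 o0 = B o1 o0 -> A o1 o1 = B o1 o1 -> A = B.
Proof.
move=> h1 h2 h3 h4; apply/matrixP => i j.
by case: (ord2P i) => ->; case: (ord2P j) => ->.
Qed.

Lemma lift00 : lift ord0 ord0 = o1 :> 'I_2.
Proof. exact: val_inj. Qed.

Lemma mulmx2 A B i j :
  (A *m B) i j = A i o0 * B o0 j + A i o1 * B o1 j.
Proof. by rewrite mxE !big_ord_recl big_ord0 addr0 lift00. Qed.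

Lemma det2 A : \det A = A o0 o0 * A o1 o1 - A o0 o1 * A o1 o0.
Proof.
rewrite (expand_det_row _ o0) !big_ord_recl big_ord0 addr0 lift00 /cofactor.
rewrite !det_mx11 !mxE /= !expr0 expr1 mul1r mulN1r mulrN.
by congr (_ * A _ _ - _ * A _ _); apply: val_inj.
Qed.

Lemma det_mk2 a b (c d : C) : \det (mk2 a b c d) = a * d - b * c.
Proof. by rewrite det2 !mk2E. Qed.

Definition apm A v : vect :=
  (A o0 o0 * v.1 + A o0 o1 * v.2, A o1 o0 * v.1 + A o1 o1 * v.2).

Lemma apmM A B v : apm (A *m B) v = apm A (apm B v).
Proof. by rewrite /apm !mulmx2 /=; congr pair; ring. Qed.

Lemma apm_scv A k v : apm A (scv k v) = scv k (apm A v).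
Proof. by rewrite /apm /scv /=; congr pair; ring. Qed.

Lemma apm_vadd A v w : apm A (vadd v w) = vadd (apm A v) (apm A w).
Proof. by rewrite /apm /vadd /=; congr pair; ring. Qed.

Lemma apm1 v : apm 1%:M v = v.
Proof.
by case: v => a b; rewrite /apm !mxE /= !mul1r !mul0r addr0 add0r.
Qed.

Lemma wdg_apm A v w : wdg (apm A v) (apm A w) = \det A * wdg v w.
Proof. rewrite det2 /wdg /apm /=; ring. Qed.

Definition inv2 A : M2 := mk2 (A o1 o1) (- A o0 o1) (- A o1 o0) (A o0 o0).

Lemma det_inv2 A : \det (inv2 A) = \det A.
Proof. rewrite det_mk2 det2; ring. Qed.

Lemma mulVm A : \det A = 1 -> inv2 A *m A = 1%:M.
Proof.
rewrite det2 => h; apply: eq_mx2; rewrite mulmx2 !mk2E !mxE /= -?h ?mulr1n ?mulr0n; ring.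
Qed.

Lemma mulmV A : \det A = 1 -> A *m inv2 A = 1%:M.
Proof.
rewrite det2 => h; apply: eq_mx2; rewrite mulmx2 !mk2E !mxE /= -?h ?mulr1n ?mulr0n; ring.
Qed.

Lemma det_mul1 A B : \det A = 1 -> \det B = 1 -> \det (A *m B) = 1.
Proof. by move=> a b; rewrite det_mulmx a b mulr1. Qed.

(** The entrywise norm is submultiplicative, and since [inv2] only permutes and negates entries, one
    number bounds both the expansion and the contraction of a unimodular matrix. *)
Definition mn A : R := nrm (A o0 o0) + nrm (A o0 o1) + nrm (A o1 o0) + nrm (A o1 o1).

Lemma mn_ge0 A : 0 <= mn A.
Proof. by rewrite !addr_ge0 ?nrm_ge0. Qed.

Lemma mnD A B : mn (A + B) <= mn A + mn B.
Proof.
rewrite /mn !mxE.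
have := nrmD (A o0 o0) (B o0 o0); have := nrmD (A o0 o1) (B o0 o1).
have := nrmD (A o1 o0) (B o1 o0); have := nrmD (A o1 o1) (B o1 o1).
lra.
Qed.

Lemma mnN A : mn (- A) = mn A.
Proof. by rewrite /mn !mxE !nrmN. Qed.

Lemma mnBC A B : mn (A - B) = mn (B - A).
Proof. by rewrite -mnN opprB. Qed.

Lemma mnM A B : mn (A *m B) <= mn A * mn B.
Proof.
rewrite /mn !mulmx2.
set a := A o0 o0; set b := A o0 o1; set c := A o1 o0; set d := A o1 o1.
set a' := B o0 o0; set b' := B o0 o1; set c' := B o1 o0; set d' := B o1 o1.
have := nrmD (a * a') (b * c'); have := nrmD (a * b') (b * d').
have := nrmD (c * a') (d * c'); have := nrmD (c * b') (d * d').
rewrite !nrmM.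
have := nrm_ge0 a; have := nrm_ge0 b; have := nrm_ge0 c; have := nrm_ge0 d.
have := nrm_ge0 a'; have := nrm_ge0 b'; have := nrm_ge0 c'; have := nrm_ge0 d'.
move=> d'0 c'0 b'0 a'0 d0 c0 b0 a0.
have := mulr_ge0 a0 c'0; have := mulr_ge0 a0 d'0.
have := mulr_ge0 b0 a'0; have := mulr_ge0 b0 b'0.
have := mulr_ge0 c0 c'0; have := mulr_ge0 c0 d'0.
have := mulr_ge0 d0 a'0; have := mulr_ge0 d0 b'0.
lra.
Qed.

Lemma mn1 : mn 1%:M = 2.
Proof. by rewrite /mn !mxE /= nrm1 nrm0; ring. Qed.

Lemma mn_inv2 A : mn (inv2 A) = mn A.
Proof. by rewrite /mn !mk2E !nrmN; ring. Qed.

Lemma inv2B A B : inv2 A - inv2 B = inv2 (A - B).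
Proof. by apply: eq_mx2; rewrite !mxE /=; ring. Qed.

Lemma hn_apm A v : hn (apm A v) <= mn A * hn v.
Proof.
apply: le_trans (hn_leD _) _; rewrite /apm /=.
have := nrmD (A o0 o0 * v.1) (A o0 o1 * v.2).
have := nrmD (A o1 o0 * v.1) (A o1 o1 * v.2).
have h1 := hn1 v; have h2 := hn2 v.
rewrite !nrmM /mn !mulrDl.
have := ler_wpM2l (nrm_ge0 (A o0 o0)) h1.
have := ler_wpM2l (nrm_ge0 (A o0 o1)) h2.
have := ler_wpM2l (nrm_ge0 (A o1 o0)) h1.
have := ler_wpM2l (nrm_ge0 (A o1 o1)) h2.
lra.
Qed.

Lemma apmVK A v : \det A = 1 -> apm (inv2 A) (apm A v) = v.
Proof. by move=> h; rewrite -apmM mulVm // apm1. Qed.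

Lemma hn_apmV A v : \det A = 1 -> hn v <= mn A * hn (apm A v).
Proof. by move=> h; rewrite -{1}(apmVK v h) -(mn_inv2 A) hn_apm. Qed.

Lemma apm_nz A v : \det A = 1 -> nzv v -> nzv (apm A v).
Proof.
move=> h; rewrite -!hn_gt0 => v0; rewrite lt0r hn_ge0 andbT.
apply/eqP => e; have := hn_apmV v h; rewrite e mulr0; lra.
Qed.

Lemma mob_pt A v : \det A = 1 -> nzv v -> mob A (pt v) = pt (apm A v).
Proof.
case: v => a b; rewrite det2 /nzv /mob /pt xpair_eqE /= => h.
case: (eqVneq b 0) => [->|b0]; rewrite ?andbT ?andbF.
  move=> a0; rewrite !mulr0 !addr0 mulf_eq0 (negbTE a0) orbF.
  by case: eqVneq => // c0; congr Some; rewrite -mulf_div divff // mulr1.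
move=> _; have e (u v : C) : u * (a / b) + v = (u * a + v * b) / b by field.
rewrite !e mulf_eq0 invr_eq0 (negbTE b0) orbF.
case: eqVneq => // c0; congr Some; rewrite invf_div mulrA divfK //.
Qed.

Lemma mobE A z : \det A = 1 -> mob A z = pt (apm A (uv z)).
Proof. by move=> h; rewrite -{1}(uvK z) mob_pt // uv_nz. Qed.

Lemma mobM A B z : \det A = 1 -> \det B = 1 -> mob (A *m B) z = mob A (mob B z).
Proof.
move=> a b; rewrite (mobE _ (det_mul1 a b)) (mobE _ b) mob_pt ?apmM //.
by rewrite apm_nz // uv_nz.
Qed.

Lemma mob1 z : mob 1%:M z = z.
Proof. by rewrite mobE ?det1 // apm1 uvK. Qed.

Lemma mobK A : \det A = 1 -> cancel (mob A) (mob (inv2 A)).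
Proof. by move=> h z; rewrite -mobM ?det_inv2 // mulVm // mob1. Qed.

Lemma mobVK A : \det A = 1 -> cancel (mob (inv2 A)) (mob A).
Proof. by move=> h z; rewrite -mobM ?det_inv2 // mulmV // mob1. Qed.

Lemma mob_inj A : \det A = 1 -> injective (mob A).
Proof. by move=> /mobK /can_inj. Qed.

(** The wedge is invariant, so only the norms change. The distortion splits into one factor for each
    point, whence the invariance of cross-ratios. *)
Lemma chord_mob A x y : \det A = 1 ->
  chord (mob A x) (mob A y) =
    chord x y / (hn (apm A (uv x)) * hn (apm A (uv y))).
Proof.
move=> h; rewrite !mobE // chord_pt ?apm_nz ?uv_nz // wdg_apm h mul1r.
by rewrite chordE.
Qed.

Lemma hn_apm_ge A x : \det A = 1 -> 0 < hn (apm A (uv x)) /\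
  (hn (apm A (uv x)))^-1 <= mn A.
Proof.
move=> h; have p : 0 < hn (apm A (uv x)) by rewrite hn_gt0 apm_nz ?uv_nz.
split=> //; rewrite -div1r ler_pdivrMr // -(hn_uv x); exact: hn_apmV.
Qed.

Lemma chord_mob_le A x y : \det A = 1 ->
  chord (mob A x) (mob A y) <= mn A ^+ 2 * chord x y.
Proof.
move=> h; rewrite chord_mob // mulrC ler_wpM2r ?chord_ge0 //.
have [p1 q1] := hn_apm_ge x h; have [p2 q2] := hn_apm_ge y h.
by rewrite invfM expr2 ler_pM // invr_ge0 ltW.
Qed.

Lemma mob_near A B x : \det A = 1 -> \det B = 1 ->
  chord (mob A x) (mob B x) <= 2 * (mn (A - B) * mn A).
Proof.
move=> hA hB; rewrite !mobE // chord_pt ?apm_nz ?uv_nz //.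
have [p1 q1] := hn_apm_ge x hA; have [p2 q2] := hn_apm_ge x hB.
rewrite ler_pdivrMr ?mulr_gt0 // -mulrA ler_pM2l //.
set u := apm A _; set v := apm B _.
(* The wedge of [v] with itself vanishes, so only the difference A - B contributes. *)
have -> : wdg u v = wdg (apm (A - B) (uv x)) v.
  rewrite /u /v /wdg /apm /= !mxE; ring.
apply: le_trans (wdg_le _ _) _; rewrite mulrA ler_pM2r //.
have := hn_apm (A - B) (uv x); rewrite hn_uv mulr1 => h1.
apply: le_trans h1 _; rewrite -mulrA ler_peMr ?mn_ge0 //.
by rewrite -ler_pdivrMr // div1r.
Qed.

End Vectors.

Arguments nrm : simpl never.
Arguments uv : simpl never.
Arguments pt : simpl never.
Arguments wdg : simpl never.
Arguments hn : simpl never.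

(** * Transvections and paths of unimodular matrices *)

Section Paths.
Variable R : realType.
Notation C := (Cplx R).
Notation M2 := 'M[C]_2.
Notation o0 := (ord0 : 'I_2).
Notation o1 := (ord_max : 'I_2).
Implicit Types (z w a y x : sphere R) (t : C) (A B M : M2).
Local Arguments nrm : simpl never.

(* The transvection v |-> v + t (a ^ v) a: a unimodular map fixing a that moves
   every other point in all directions as t varies. *)
Definition tv a t : M2 :=
  let u := uv a in
  mk2 (1 - t * (u.1 * u.2)) (t * (u.1 * u.1)) (- (t * (u.2 * u.2))) (1 + t * (u.1 * u.2)).

Lemma det_tv a t : \det (tv a t) = 1.
Proof. rewrite det_mk2; ring. Qed.

Lemma apm_tv a t v :
  apm (tv a t) v = vadd v (scv (t * wdg (uv a) v) (uv a)).
Proof. rewrite /apm /tv !mk2E /vadd /scv /wdg /=; congr pair; ring. Qed.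

Lemma tv0 a : tv a 0 = 1%:M.
Proof. by apply: eq_mx2; rewrite /tv mk2E mxE /= !mul0r ?subr0 ?addr0 ?oppr0. Qed.

Lemma inv2_tv a t : inv2 (tv a t) = tv a (- t).
Proof. by rewrite /inv2 /tv !mk2E; congr mk2; ring. Qed.

Lemma tvD a t t' : tv a t *m tv a t' = tv a (t + t').
Proof. by apply: eq_mx2; rewrite mulmx2 !mk2E; ring. Qed.

Lemma mn_tvB a t t' : mn (tv a t - tv a t') <= 4 * nrm (t - t').
Proof.
rewrite /mn !mxE /=.
have -> (x : C) : 1 - t * x - (1 - t' * x) = - ((t - t') * x) by ring.
have -> (x : C) : 1 + t * x - (1 + t' * x) = (t - t') * x by ring.
have -> (x : C) : - (t * x) - - (t' * x) = - ((t - t') * x) by ring.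
rewrite -mulrBl !nrmN !nrmM.
have h1 := hn1 (uv a); have h2 := hn2 (uv a); rewrite !hn_uv in h1 h2.
have p1 := nrm_ge0 (uv a).1; have p2 := nrm_ge0 (uv a).2; have p := nrm_ge0 (t - t').
set u := nrm (uv a).1 in h1 p1 *; set v := nrm (uv a).2 in h2 p2 *.
have k1 : u * u <= 1 by nra.
have k2 : v * v <= 1 by nra.
have k3 : u * v <= 1 by nra.
have := ler_wpM2l p k1; have := ler_wpM2l p k2; have := ler_wpM2l p k3; lra.
Qed.

Lemma mob_tv_fix a t : mob (tv a t) a = a.
Proof.
rewrite mobE ?det_tv // apm_tv wdgvv mulr0 /scv /vadd /= !mul0r !addr0.
by rewrite -surjective_pairing uvK.
Qed.

(** The solution t of (y + t (a ^ y) a) ^ y' = 0. *)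
Definition tvp a y y' : C :=
  - wdg (uv y) (uv y') / (wdg (uv a) (uv y) * wdg (uv a) (uv y')).

Lemma wdg_uv0 z w : z != w -> wdg (uv z) (uv w) != 0.
Proof. by rewrite wdg_eq0 ?uv_nz // !uvK. Qed.

Lemma tv_move a y y' : a != y -> a != y' -> mob (tv a (tvp a y y')) y = y'.
Proof.
move=> /wdg_uv0 h /wdg_uv0 h'; rewrite mobE ?det_tv //; apply/eqP.
rewrite -{2}(uvK y') -wdg_eq0 ?uv_nz // ?apm_nz ?det_tv ?uv_nz //.
rewrite apm_tv /tvp; move: h h'; rewrite /wdg /vadd /scv /= => h h'.
apply/eqP; field.
by rewrite h h'.
Qed.

Lemma nrm_wdg z w : nrm (wdg (uv z) (uv w)) = chord z w / 2.
Proof. by rewrite chordE mulrC mulKf. Qed.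

Lemma nrm_tvp a y y' : nrm (tvp a y y') = 2 * chord y y' / (chord a y * chord a y').
Proof.
rewrite /tvp nrmM nrmV nrmM nrmN !nrm_wdg.
case: (eqVneq (chord a y) 0) => [->|h]; first by rewrite !mul0r invr0 !mulr0.
case: (eqVneq (chord a y') 0) => [->|h']; first by rewrite !mul0r !mulr0 invr0 !mulr0.
by field; rewrite h h'.
Qed.

Lemma tv_small a y (e : R) : a != y -> 0 < e ->
  exists2 d : R, 0 < d & forall x x', chord y x < d -> chord y x' < d ->
    exists t, nrm t < e /\ mob (tv a t) x = x'.
Proof.
move=> ay e0; have c0 : 0 < chord a y by rewrite chord_gt0.
set c := chord a y in c0.
(* Both points stay farther than c / 2 from a, so by [nrm_tvp] the parameter is below 2 (e c^2 / 16)
   / (c / 2)^2 = e / 2. *)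
exists (Num.min (c / 2) (e * c ^+ 2 / 32)).
  by rewrite lt_min !divr_gt0 ?mulr_gt0 ?exprn_gt0.
move=> x x'; rewrite !lt_min => /andP[x1 x2] /andP[x1' x2'].
have hx : c / 2 < chord a x by have := chord_tri x a y; rewrite (chordC x) -/c; lra.
have hx' : c / 2 < chord a x' by have := chord_tri x' a y; rewrite (chordC x') -/c; lra.
exists (tvp a x x'); split; last by apply: tv_move; rewrite -chord_gt0; lra.
rewrite nrm_tvp ltr_pdivrMr; last by apply: mulr_gt0; lra.
have := chord_tri y x x'; rewrite (chordC x y) => h.
have : c / 2 * (c / 2) < chord a x * chord a x' by apply: ltr_pM; lra.
rewrite -(ltr_pM2l e0); nra.
Qed.

Definition mcont (A : R -> M2) := forall (s e : R), 0 < e -> exists2 d : R, 0 < d &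
  forall s' : R, `|s - s'| < d -> mn (A s - A s') < e.

Lemma mcont_cst A : mcont (fun=> A).
Proof.
move=> s e e0; exists 1 => // s' _.
by rewrite subrr /mn !mxE nrm0 !addr0.
Qed.

Lemma mcontM (A B : R -> M2) : mcont A -> mcont B -> mcont (fun s => A s *m B s).
Proof.
move=> hA hB s e e0.
have pA := mn_ge0 (A s); have pB := mn_ge0 (B s).
have ea : 0 < e / 2 / (mn (B s) + 1) by rewrite !divr_gt0 // ltr_wpDl.
have eb : 0 < e / 2 / (mn (A s) + 1) by rewrite !divr_gt0 // ltr_wpDl.
have e1 : 0 < Num.min 1 (e / 2 / (mn (B s) + 1)) by rewrite lt_min ea ltr01.
have [d1 d10 h1] := hA s _ e1; have [d2 d20 h2] := hB s _ eb.
exists (Num.min d1 d2); first by rewrite lt_min d10.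
move=> s'; rewrite lt_min => /andP[/h1 k1 /h2 k2].
have -> : A s *m B s - A s' *m B s' = (A s - A s') *m B s + A s' *m (B s - B s').
  by rewrite mulmxBl mulmxBr addrA subrK.
apply: le_lt_trans (mnD _ _) _.
have m1 := mnM (A s - A s') (B s); have m2 := mnM (A s') (B s - B s').
move: k1; rewrite lt_min => /andP[k0 k1].
have m3 : mn (A s') <= mn (A s) + 1.
  have := mnD (A s' - A s) (A s); rewrite subrK (mnBC (A s')) => h; lra.
move: k1 k2; rewrite ltr_pdivlMr ?ltr_wpDl // => k1.
rewrite ltr_pdivlMr ?ltr_wpDl // => k2.
have := mn_ge0 (A s - A s'); have := mn_ge0 (B s - B s'); have := mn_ge0 (A s').
set u := mn (A s - A s') in k1 m1 k0 *; set v := mn (B s - B s') in k2 m2 *.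
nra.
Qed.

Lemma mcont_tv a t : mcont (fun s => tv a (s%:C%C * t)).
Proof.
move=> s e e0; exists (e / (4 * nrm t + 1)).
  by rewrite divr_gt0 // ltr_wpDl // mulr_ge0 ?nrm_ge0.
move=> s' h; apply: le_lt_trans (mn_tvB _ _ _) _.
rewrite -mulrBl nrmM.
have -> : (s%:C%C - s'%:C%C : C) = (s - s')%:C%C by rewrite rmorphB.
rewrite nrm_real; move: h; rewrite ltr_pdivlMr; last by rewrite ltr_wpDl // mulr_ge0 ?nrm_ge0.
have := nrm_ge0 t; have := normr_ge0 (s - s'); nra.
Qed.

Lemma rcont_mob (A : R -> M2) z : mcont A -> (forall s, \det (A s) = 1) ->
  rcont (fun s => mob (A s) z).
Proof.
move=> hA dA s e e0.
have p : 0 < 2 * mn (A s) + 1 by have := mn_ge0 (A s); lra.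
have [d d0 h] := hA s _ (divr_gt0 e0 p).
exists d => // s' /h; rewrite ltr_pdivlMr // => k.
apply: le_lt_trans (mob_near _ (dA s) (dA s')) _.
have := mn_ge0 (A s - A s'); nra.
Qed.

End Paths.

(** * Itineraries and conjugacies *)

Section PMTbasics.
Variables (R : realType) (K : nat).
Implicit Types (F G : pmt R K) (z w : sphere R) (k : 'I_K).

Lemma sclosure_sub (A : set (sphere R)) : A `<=` sclosure A.
Proof. by move=> z Az e e0; exists z; rewrite chordzz. Qed.

Lemma sclosureS (A B : set (sphere R)) : A `<=` B -> sclosure A `<=` sclosure B.
Proof. by move=> AB z h e /h[w [/AB ? ?]]; exists w. Qed.

Section F.
Variable F : pmt R K.
Hypothesis PF : is_pmt F.

Lemma reg_ne k : reg F k !=set0. Proof. by case: PF. Qed.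
Lemma reg_open k : sopen (reg F k). Proof. by case: PF => _ []. Qed.
Lemma reg_conn k : sconnected (reg F k). Proof. by case: PF => _ [] _ []. Qed.
Lemma reg_disj j k : j != k -> reg F j `&` reg F k = set0.
Proof. by case: PF => _ [] _ [] _ [] h _; exact: h. Qed.
Lemma reg_psscc k : exists (m : nat) (S : 'I_m -> set (sphere R)),
      (forall i, psscc (S i)) /\ sboundary (reg F k) = [set z | exists i, S i z].
Proof. by case: PF => _ [] _ [] _ [] _ [] h _; exact: h. Qed.
Lemma reg_cover z : exists k, sclosure (reg F k) z.
Proof. by case: PF => _ [] _ [] _ [] _ [] _ []. Qed.
Lemma mat_det k : \det (mat F k) = 1.
Proof. by case: PF => _ [] _ [] _ [] _ [] _ [] _ []. Qed.
Lemma pmt_min : ~ (exists (z : sphere R) (e : R) (A : 'M[Cplx R]_2),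
       [/\ Bset F z, 0 < e &
           forall k w, reg F k w -> chord z w < e ->
             mob (mat F k) w = mob A w]).
Proof. by case: PF => _ [] _ [] _ [] _ [] _ [] _ []. Qed.

Lemma reg_uniq j k z : reg F j z -> reg F k z -> j = k.
Proof.
move=> hj hk; apply/eqP; apply/negP => /negP /reg_disj h.
have : (reg F j `&` reg F k) z by [].
by rewrite h.
Qed.

Lemma bdE k z : sboundary (reg F k) z <-> sclosure (reg F k) z /\ ~ reg F k z.
Proof.
split=> [[h1 h2]|[h1 h2]]; split=> // h; apply: h2; first exact: reg_open.
by case: h => e e0; apply; rewrite /sball /= chordzz.
Qed.

Lemma BsetE z : Bset F z <-> ~ Rset F z.
Proof.
split=> [[k /bdE[h1 h2]] [j hj]|h].
  case: (reg_open hj) => e e0 he; case: (h1 e e0) => w [rw /he rj].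
  by rewrite -(reg_uniq rw rj) in hj.
have [k hk] := reg_cover z; exists k; apply/bdE; split=> // rk.
by apply: h; exists k.
Qed.

Lemma Rset_open : sopen (Rset F).
Proof.
move=> z [k /reg_open[e e0 h]]; exists e => // w /h; by exists k.
Qed.

Lemma RsetNB z : Rset F z <-> ~ Bset F z.
Proof. by rewrite BsetE; split=> [h|/contrapT]. Qed.

Lemma Rset_dense z (e : R) : 0 < e -> exists2 w, Rset F w & chord z w < e.
Proof.
move=> e0; have [k hk] := reg_cover z; have [w [rw h]] := hk e e0.
by exists w => //; exists k.
Qed.

Lemma Ftot_reg k z : reg F k z -> Ftot F z = mob (mat F k) z.
Proof.
move=> rk; rewrite /Ftot; case: pselect => [h|[]]; last by exists k.
by case: cid => j rj /=; rewrite (reg_uniq rj rk).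
Qed.

Lemma regmat_reg k z : reg F k z -> regmat F z = mat F k.
Proof.
move=> rk; rewrite /regmat; case: pselect => [h|[]]; last by exists k.
by case: cid => j rj /=; rewrite (reg_uniq rj rk).
Qed.

(** The regions are open and disjoint, so the parameters at which the path lies in region k form a
    clopen part of [0, 1]. *)
Lemma path_reg (g : R -> sphere R) k : rcont g ->
  (forall s, 0 <= s <= 1 -> Rset F (g s)) -> reg F k (g 0) ->
  forall s, 0 <= s <= 1 -> reg F k (g s).
Proof.
move=> cg hg g0.
have op j : open [set s | reg F j (g s)].
  rewrite openE => s /= /reg_open[e e0 he]; have [d d0 hd] := cg s e e0.
  by apply/nbhs_ballP; exists d => // s' /= /hd /he.
have : `[0, 1]%classic `&` [set s | reg F k (g s)] = `[0, 1]%classic.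
  have cn := @segment_connected R 0 1.
  apply: cn.
  - by exists 0; split=> //=; rewrite in_itv /= lexx ler01.
  - by exists [set s | reg F k (g s)].
  exists (~` [set s | exists2 j, j != k & reg F j (g s)]).
    apply: open_closedC.
    have -> : [set s | exists2 j, j != k & reg F j (g s)] =
      \bigcup_(j in [set j | j != k]) [set s | reg F j (g s)].
      by apply/seteqP; split=> s [j jk hj]; exists j.
    by apply: bigcup_open => j _.
  apply/seteqP; split=> s /= [hs h]; split=> //.
    by case=> j /eqP jk hj; apply: jk; exact: reg_uniq hj h.
  rewrite /= in_itv /= in hs; have [j hj] := hg s hs.
  case: (eqVneq j k) => [<-//|jk]; by case: h; exists j.
by move=> /seteqP[_ h] s hs; have [] := h s; rewrite //= in_itv.
Qed.

End F.
End PMTbasics.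

(** * Small moves on the sphere; Moebius maps that agree on an open set *)

Section Agree.
Variable R : realType.
Notation C := (Cplx R).
Notation M2 := 'M[C]_2.
Notation o0 := (ord0 : 'I_2).
Notation o1 := (ord_max : 'I_2).
Implicit Types (z w a y x : sphere R) (t : C) (A B M : M2).

Lemma fin_pos (T : finType) (P : T -> R -> Prop) :
  (forall (t : T) (e e' : R), P t e -> 0 < e' -> e' <= e -> P t e') ->
  (forall t : T, exists2 e : R, 0 < e & P t e) ->
  exists2 e : R, 0 < e & forall t : T, P t e.
Proof.
move=> mono h.
suff [e e0 he] : exists2 e : R, 0 < e & forall t : T, t \in enum T -> P t e.
  by exists e => // t; apply: he; rewrite mem_enum.
elim: (enum T) => [|t s [e e0 he]]; first by exists 1.
have [e' e'0 he'] := h t; exists (Num.min e e'); first by rewrite lt_min e0.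
move=> u; rewrite inE => /orP[/eqP ->|us].
  by apply: mono he' _ _; rewrite ?lt_min ?e0 // ge_min lexx orbT.
by apply: mono (he _ us) _ _; rewrite ?lt_min ?e0 // ge_min lexx.
Qed.

Lemma other_pt z : exists a, a != z.
Proof. by case: z => [b|]; [exists None | exists (Some 0)]. Qed.

Lemma tv_near a t z : chord z (mob (tv a t) z) <= 16 * nrm t.
Proof.
rewrite -{1}(mob1 z) -(tv0 a).
apply: le_trans (mob_near _ (det_tv _ _) (det_tv _ _)) _.
have := mn_tvB a 0 t; rewrite sub0r nrmN tv0 mn1; lra.
Qed.

Lemma tv_neq a t z : a != z -> t != 0 -> mob (tv a t) z != z.
Proof.
move=> az t0; rewrite mobE ?det_tv //; rewrite -{2}(uvK z) -wdg_eq0 ?uv_nz //; last first.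
  by rewrite apm_nz ?det_tv ?uv_nz.
have -> : wdg (apm (tv a t) (uv z)) (uv z) = t * wdg (uv a) (uv z) * wdg (uv a) (uv z).
  rewrite apm_tv /wdg /vadd /scv /=; ring.
by rewrite !mulf_neq0 // wdg_uv0.
Qed.

Lemma near_neq z (e : R) : 0 < e -> exists2 w, w != z & chord z w < e.
Proof.
move=> e0; have [a az] := other_pt z.
have e1 : 0 < e / 32 by rewrite divr_gt0.
exists (mob (tv a (e / 32)%:C%C) z).
  by apply: tv_neq => //; rewrite -nrm_eq0 nrm_realC_gt0 // gt_eqF.
apply: le_lt_trans (tv_near _ _ _) _; rewrite nrm_realC_gt0 //; lra.
Qed.

Lemma near_avoid z (s : seq (sphere R)) (e : R) : 0 < e ->
  exists2 w, w \notin s & chord z w < e.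
Proof.
move=> e0.
have [d d0 hd] : exists2 d : R, 0 < d & forall y, y \in s -> y != z -> d <= chord z y.
  elim: s => [|y s [d d0 hd]]; first by exists 1.
  case: (eqVneq y z) => [->|yz].
    by exists d => // y'; rewrite inE => /orP[/eqP ->|/hd//]; rewrite eqxx.
  exists (Num.min d (chord z y)); first by rewrite lt_min d0 chord_gt0 eq_sym.
  move=> y'; rewrite inE => /orP[/eqP ->|/hd h /h h']; first by rewrite ge_min lexx orbT.
  by rewrite ge_min h'.
case: (boolP (z \in s)) => zs; last by exists z; rewrite ?chordzz.
have [w wz h] := @near_neq z (Num.min e d) ltac:(by rewrite lt_min e0).
move: h; rewrite lt_min => /andP[h1 h2]; exists w => //.
by apply/negP => /hd /(_ wz); rewrite leNgt h2.
Qed.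

Lemma quad3 (p q r x1 x2 x3 : C) : x1 != x2 -> x1 != x3 -> x2 != x3 ->
  p * x1 ^+ 2 + q * x1 + r = 0 -> p * x2 ^+ 2 + q * x2 + r = 0 ->
  p * x3 ^+ 2 + q * x3 + r = 0 -> [/\ p = 0, q = 0 & r = 0].
Proof.
rewrite -!(subr_eq0 _ x2) -!(subr_eq0 _ x3) => h12 h13 h23 e1 e2 e3.
have f12 : p * (x1 + x2) + q = 0.
  apply: (mulfI h12); rewrite mulr0 -[RHS](subrr 0) -{1}e1 -e2; ring.
have f13 : p * (x1 + x3) + q = 0.
  apply: (mulfI h13); rewrite mulr0 -[RHS](subrr 0) -{1}e1 -e3; ring.
have p0 : p = 0.
  apply: (mulfI h23); rewrite mulr0 -[RHS](subrr 0) -{1}f12 -f13; ring.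
have q0 : q = 0 by move: f12; rewrite p0 mul0r add0r.
by split=> //; move: e1; rewrite p0 q0 !mul0r !add0r.
Qed.

(** Cross-multiplied, agreement at a finite point x is a quadratic equation in x. Three points of V
    kill its coefficients, and the relation \det M = 1 then solves for A up to the factor l. *)
Lemma mob_agree M A (V : set (sphere R)) : \det M = 1 -> sopen V -> V !=set0 ->
  (forall w, V w -> mob M w = mob A w) -> exists2 l : C, l != 0 & A = l *: M.
Proof.
move=> dM oV [z Vz] h; have [e e0 he] := oV z Vz.
have pk (s : seq (sphere R)) : exists x : C, [/\ Some x \notin s, V (Some x) & mob M (Some x) != None].
  have [[x|] hx zx] := @near_avoid z (None :: mob (inv2 M) None :: s) _ e0; last first.
    by rewrite inE eqxx in hx.
  move: hx; rewrite !inE !negb_or => /and3P[_ h1 h2]; exists x; split=> //; first exact: he.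
  by apply: contra h1 => /eqP e1; rewrite -e1 mobK.
have [x1 [_ V1 n1]] := pk [::].
have [x2 [s2 V2 n2]] := pk [:: Some x1].
have [x3 [s3 V3 n3]] := pk [:: Some x1; Some x2].
have eqn (x : C) : V (Some x) -> mob M (Some x) != None ->
  (A o1 o0 * x + A o1 o1 != 0) /\
  (A o0 o0 * M o1 o0 - M o0 o0 * A o1 o0) * x ^+ 2 +
  (A o0 o0 * M o1 o1 + A o0 o1 * M o1 o0 - M o0 o0 * A o1 o1 - M o0 o1 * A o1 o0) * x +
  (A o0 o1 * M o1 o1 - M o0 o1 * A o1 o1) = 0.
  move=> /h /=; case: eqVneq => // d1; case: eqVneq => // d2 [hh] _; split=> //.
  have : (A o0 o0 * x + A o0 o1) * (M o1 o0 * x + M o1 o1) =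
         (M o0 o0 * x + M o0 o1) * (A o1 o0 * x + A o1 o1).
    apply/eqP; rewrite -eqr_div //; exact/eqP.
  by move=> /eqP; rewrite -subr_eq0 => /eqP hx; rewrite -hx; ring.
have [nd E1] := eqn _ V1 n1; have [_ E2] := eqn _ V2 n2; have [_ E3] := eqn _ V3 n3.
have x12 : x1 != x2 by apply: contra s2 => /eqP ->; rewrite inE eqxx.
have x13 : x1 != x3 by apply: contra s3 => /eqP ->; rewrite !inE eqxx.
have x23 : x2 != x3 by apply: contra s3 => /eqP ->; rewrite !inE eqxx orbT.
have [/eqP p0 /eqP q0 /eqP r0] := quad3 x12 x13 x23 E1 E2 E3.
move: dM; rewrite det2 => dM.
move: p0 q0 r0 nd dM.
set a := A o0 o0; set b := A o0 o1; set c := A o1 o0; set d := A o1 o1.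
set a' := M o0 o0; set b' := M o0 o1; set c' := M o1 o0; set d' := M o1 o1.
rewrite !subr_eq0 => /eqP p0; rewrite subr_eq => /eqP q0 /eqP r0 nd dM.
have e2 : A = (d' * a - b' * c) *: M.
  apply: eq_mx2; rewrite !mxE -/a -/b -/c -/d -/a' -/b' -/c' -/d'.
  - transitivity ((a' * d' - b' * c') * a); first by rewrite dM mul1r.
    have -> : (d' * a - b' * c) * a' = a' * d' * a - b' * (a' * c) by ring.
    by rewrite -p0; ring.
  - transitivity ((a' * d' - b' * c') * b); first by rewrite dM mul1r.
    have -> : (d' * a - b' * c) * b' = b' * (a * d' - b' * c) by ring.
    have -> : a * d' = a' * d + b' * c - b * c' by rewrite [a' * d + _]addrC -q0; ring.
    have -> : (a' * d' - b' * c') * b = a' * (b * d') - b' * c' * b by ring.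
    rewrite r0; ring.
  - transitivity ((a' * d' - b' * c') * c); first by rewrite dM mul1r.
    have -> : (d' * a - b' * c) * c' = d' * (a * c') - b' * c * c' by ring.
    rewrite p0; ring.
  - transitivity ((a' * d' - b' * c') * d); first by rewrite dM mul1r.
    have -> : (d' * a - b' * c) * d' = (a * d' - b' * c) * d' by ring.
    have -> : a * d' = a' * d + b' * c - b * c' by rewrite [a' * d + _]addrC -q0; ring.
    have -> : (a' * d + b' * c - b * c' - b' * c) * d' = a' * d * d' - c' * (b * d') by ring.
    rewrite r0; ring.
exists (d' * a - b' * c) => //; apply: contra nd => /eqP l0.
rewrite /c /d e2 l0 !mxE; apply/eqP; ring.
Qed.

(** Equality in PSL(2,C). *)
Definition pmeq A B := A = B \/ A = - B.

Lemma mob_agree2 M M' A (V V' : set (sphere R)) : \det M = 1 -> \det M' = 1 ->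
  sopen V -> V !=set0 -> sopen V' -> V' !=set0 ->
  (forall w, V w -> mob M w = mob A w) ->
  (forall w, V' w -> mob M' w = mob A w) -> pmeq M M'.
Proof.
move=> dM dM' oV nV oV' nV' h h'.
have [l l0 e] := mob_agree dM oV nV h; have [l' l'0 e'] := mob_agree dM' oV' nV' h'.
have eM : M = (l^-1 * l') *: M' by rewrite -scalerA -e' e scalerA mulVf // scale1r.
have : (l^-1 * l') ^+ 2 = 1 by rewrite -dM eM detZ dM' mulr1.
move=> /eqP; rewrite sqrf_eq1 => /orP[] /eqP h1; rewrite h1 in eM.
  by left; rewrite eM scale1r.
by right; rewrite eM scaleN1r.
Qed.

Lemma mobN A z : mob (- A) z = mob A z.
Proof.
case: z => [w|]; rewrite /mob !mxE ?oppr_eq0; last first.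
  by case: ifP => // h; congr Some; rewrite invrN mulrNN.
rewrite !mulNr -!opprD oppr_eq0; case: ifP => // h; congr Some.
by rewrite invrN mulrNN.
Qed.

Lemma mn_gt0 A : A != 0 -> 0 < mn A.
Proof.
move=> h; rewrite lt0r mn_ge0 andbT; apply: contra h => /eqP h.
have p1 := nrm_ge0 (A o0 o0); have p2 := nrm_ge0 (A o0 o1).
have p3 := nrm_ge0 (A o1 o0); have p4 := nrm_ge0 (A o1 o1).
rewrite /mn in h.
apply/eqP; apply: eq_mx2; rewrite mxE; apply/eqP; rewrite -nrm_eq0; apply/eqP; lra.
Qed.

End Agree.

Section Words.
Variables (R : realType) (K : nat).
Notation C := (Cplx R).
Notation M2 := 'M[C]_2.
Notation mats := ('I_K -> M2).
Implicit Types (F G : pmt R K) (z q : sphere R) (k : 'I_K) (w v : seq 'I_K)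
  (A B : mats) (X Y : set (sphere R)).

(** Letters come in the order of visit, so the first one gives the rightmost factor. *)
Fixpoint Mw A w : M2 := if w is k :: w' then Mw A w' *m A k else 1%:M.

Lemma det_Mw A w : (forall k, \det (A k) = 1) -> \det (Mw A w) = 1.
Proof. by move=> h; elim: w => [|k w IH] /=; rewrite ?det1 ?det_mul1. Qed.

Lemma Mw_cat A w v : Mw A (w ++ v) = Mw A v *m Mw A w.
Proof. by elim: w => [|k w IH] /=; rewrite ?mulmx1 // IH mulmxA. Qed.

(** Itineraries replace iterates of [Ftot]: along a word the dynamics is one Moebius map, and the
    final point may lie anywhere, in particular on B(F), where [Ftot] has only a default value. *)
Fixpoint reach F X w q : Prop :=
  if w is k :: w' then reg F k q /\ reach F X w' (mob (mat F k) q) else X q.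

Lemma reachS F X Y w q : X `<=` Y -> reach F X w q -> reach F Y w q.
Proof. by move=> XY; elim: w q => [|k w IH] q /=; [exact: XY | case=> ? /IH]. Qed.

Lemma reach_cat F X w v q : reach F X (w ++ v) q <-> reach F (reach F X v) w q.
Proof. by elim: w q => [|k w IH] q //=; rewrite IH. Qed.

Section F.
Variable F : pmt R K.
Hypothesis PF : is_pmt F.
Let dF := mat_det PF.

Lemma reach_iff X w q : reach F X w q <-> reach F setT w q /\ X (mob (Mw (mat F) w) q).
Proof.
elim: w q => [|k w IH] q /=; first by rewrite mob1; split=> [|[]].
by rewrite IH mobM ?det_Mw //; split=> [[? []]|[[]]].
Qed.

Lemma reach_Fn X w q : reach F X w q ->
  [/\ Fn F (size w) q = mob (Mw (mat F) w) q,
      (forall j, (j < size w)%N -> Rset F (Fn F j q)),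
      X (Fn F (size w) q) & omat F (size w) q = Mw (mat F) w].
Proof.
elim: w q => [|k w IH] q /=; first by rewrite mob1.
case=> rk /IH[e1 e2 e3 e4]; have ek := Ftot_reg PF rk.
have eF j : Fn F j.+1 q = Fn F j (mob (mat F k) q) by rewrite /Fn iterSr ek.
have := eF (size w); rewrite /Fn /= -!/(Fn _ _ _) => ->; rewrite ek; split=> //.
- by rewrite mobM ?det_Mw.
- move=> [_|j]; first by exists k.
  by rewrite ltnS -/(Fn F j.+1 q) eF => /e2.
- by rewrite e4 (regmat_reg PF rk).
Qed.

Lemma Fn_reach n q : (forall j, (j < n)%N -> Rset F (Fn F j q)) ->
  exists2 w, size w = n & reach F setT w q.
Proof.
elim: n q => [|n IH] q h; first by exists [::].
have [k rk] := h 0%N isT.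
have [|w sw rw] := IH (mob (mat F k) q).
  by move=> j jn; have := h j.+1 jn; rewrite /Fn iterSr (Ftot_reg PF rk).
by exists (k :: w); rewrite /= ?sw.
Qed.

Lemma reach_uniq w v q : size w = size v -> reach F setT w q -> reach F setT v q -> w = v.
Proof.
elim: w v q => [|k w IH] [|j v] q //= [e] [rk rw] [rj rv].
have ejk := reg_uniq PF rk rj; rewrite -ejk in rv *.
by rewrite (IH _ _ e rw rv).
Qed.

Lemma preimg_reach n X z : preimg F n X z <-> exists2 w, size w = n & reach F X w z.
Proof.
split=> [[h Xz]|[w <- /reach_Fn[_ h Xz _]]]; last by split.
have [w sw rw] := Fn_reach h; exists w => //; apply/reach_iff; split=> //.
by have [<- _ _ _] := reach_Fn rw; rewrite sw.
Qed.

End F.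

(** One-sided nearness of partitions: points lying e-deep in a region stay in the region with the
    same index. The persistence of a finite itinerary asks no more of the regions. *)
Definition rnear F G (e : R) := forall k z,
  (forall z', chord z z' < e -> reg F k z') -> reg G k z.

Lemma reach_stable F w q : is_pmt F -> reach F setT w q ->
  exists2 e : R, 0 < e & forall G q', (forall k, \det (mat G k) = 1) ->
    (forall k, mn (mat G k - mat F k) < e) -> rnear F G e -> chord q q' < e ->
    reach G setT w q'.
Proof.
move=> PF; elim: w q => [|k w IH] q /=; first by exists 1.
case=> /(reg_open PF)[e0 e00 he0] /IH[e1 e10 he1].
have pm := mn_ge0 (mat F k); set m := mn (mat F k) in pm.
(* The tolerance e1 is shared between changing the matrix, at cost 2 m e2, and moving the point, at
   cost (m + 1)^2 e2, where m + 1 bounds the norm of the perturbed matrix. *)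
have e2p : 0 < e1 / (2 * m + (m + 1) ^+ 2 + 1).
  by rewrite divr_gt0 //; nra.
set e2 := e1 / _ in e2p.
exists (Num.min (e0 / 2) (Num.min e1 (Num.min 1 e2))).
  by rewrite !lt_min e10 e2p ltr01 divr_gt0.
move=> G q' dG mG rG; rewrite !lt_min => /and4P[c1 c2 c3 c4]; split.
  apply: rG => z; rewrite !lt_min => /andP[h _]; apply: he0; rewrite /sball /=.
  have := chord_tri q' q z; lra.
apply: he1 => //.
- by move=> j; have := mG j; rewrite !lt_min => /and4P[].
- move=> j z hz; apply: rG => z'; rewrite !lt_min => /and4P[_ h _ _]; exact: hz.
have := mG k; rewrite !lt_min => /and4P[_ _ m1 m2].
apply: le_lt_trans (chord_tri (mob (mat G k) q) _ _) _.
have h1 := mob_near q (mat_det PF k) (dG k).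
have h2 := chord_mob_le q q' (dG k).
rewrite mnBC -/m in h1.
have m3 : mn (mat G k) <= m + 1.
  have := mnD (mat G k - mat F k) (mat F k); rewrite subrK -/m; lra.
have m4 : mn (mat G k) ^+ 2 <= (m + 1) ^+ 2.
  by rewrite ler_pXn2r ?nnegrE ?mn_ge0 //; lra.
have p4 := mn_ge0 (mat G k - mat F k).
have c0 := chord_ge0 q q'.
have h3 : mn (mat G k) ^+ 2 * chord q q' <= (m + 1) ^+ 2 * e2.
  by apply: ler_pM; rewrite ?sqr_ge0 // ltW.
have h4 : mn (mat G k - mat F k) * m <= e2 * m by rewrite ler_wpM2r // ltW.
have : e2 * (2 * m + (m + 1) ^+ 2 + 1) = e1 by rewrite /e2 mulfVK // gt_eqF //; nra.
nra.
Qed.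

Lemma scont_closure (h : sphere R -> sphere R) X z :
  scont h -> sclosure X z -> sclosure (h @` X) (h z).
Proof.
move=> ch cz e e0; have [d d0 hd] := ch z e e0; have [w [Xw zw]] := cz d d0.
by exists (h w); split; [exists w | exact: hd].
Qed.

Lemma sconnected_image (h : sphere R -> sphere R) X :
  scont h -> sconnected X -> sconnected (h @` X).
Proof.
move=> ch cX P Q e [p Pp] [q Qq] hPQ hQP.
have sub1 Y : sclosure (X `&` (h @^-1` Y)) `<=` h @^-1` (sclosure Y).
  move=> z /(scont_closure ch); apply: sclosureS => _ [x [_ Yx] <-]; exact: Yx.
apply: (cX (X `&` (h @^-1` P)) (X `&` (h @^-1` Q))).
- apply/seteqP; split=> [x Xx|x [[]|[]]//].
  have : (P `|` Q) (h x) by rewrite -e; exists x.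
  by case=> ?; [left|right].
- have : (h @` X) p by rewrite e; left.
  by case=> x Xx xp; exists x; split => //=; rewrite xp.
- have : (h @` X) q by rewrite e; right.
  by case=> x Xx xp; exists x; split => //=; rewrite xp.
- apply/seteqP; split=> // x [/sub1 h1 [_ h2]].
  by have : (sclosure P `&` Q) (h x) by []; rewrite hPQ.
apply/seteqP; split=> // x [[_ h2] /sub1 h1].
by have : (P `&` sclosure Q) (h x) by []; rewrite hQP.
Qed.

Lemma connected_reg F k X z : is_pmt F -> sconnected X -> X `<=` Rset F ->
  X z -> reg F k z -> X `<=` reg F k.
Proof.
move=> PF cX XR Xz rz y Xy; apply: contrapT => nr.
have sep j Y : sclosure Y `&` reg F j !=set0 -> Y `&` reg F j !=set0.
  move=> [u [cu ru]]; have [e e0 he] := reg_open PF ru.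
  by have [v [Yv /he hv]] := cu e e0; exists v.
apply: (cX (X `&` reg F k) (X `\` reg F k)).
- by apply/seteqP; split=> [x Xx|x [[]|[]]//]; case: (pselect (reg F k x)) => ?; [left|right].
- by exists z.
- by exists y.
- apply/seteqP; split=> // u [cu [Xu nu]].
  have [j rj] := XR _ Xu; have [|v [[_ rv] rv']] := sep j (X `&` reg F k); first by exists u.
  by apply: nu; rewrite (reg_uniq PF rv rv').
apply/seteqP; split=> // u [[Xu ru] cu].
by have [|v [[_ nv] rv]] := sep k (X `\` reg F k); first by exists u.
Qed.

(** The conjugacy in terms of regions and matrices, with [kap] the permutation of the regions. The
    last clause holds on closures because coincidences apply [mat F k] at boundary points of region
    k. *)
Definition conjd F G (h : sphere R -> sphere R) (kap : 'I_K -> 'I_K) :=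
  [/\ homeo h, injective kap, (forall k z, reg F k z <-> reg G (kap k) (h z)) &
   forall k z, sclosure (reg F k) z -> h (mob (mat F k) z) = mob (mat G (kap k)) (h z)].

Lemma scont_mob (M : M2) : \det M = 1 -> scont (mob M).
Proof.
move=> dM z e e0; have p : 0 < mn M ^+ 2 + 1 by have := sqr_ge0 (mn M); lra.
exists (e / (mn M ^+ 2 + 1)); first by rewrite divr_gt0.
move=> w; rewrite ltr_pdivlMr // => h; apply: le_lt_trans (chord_mob_le _ _ dM) _.
have := chord_ge0 z w; lra.
Qed.

Lemma scont_eq_closure (f g : sphere R -> sphere R) X z : scont f -> scont g ->
  (forall x, X x -> f x = g x) -> sclosure X z -> f z = g z.
Proof.
move=> cf cg fg cz; apply/eqP; rewrite -chord_eq0; apply/eqP/le_anti.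
rewrite chord_ge0 andbT leNgt; apply/negP => h.
have h2 : 0 < chord (f z) (g z) / 2 by rewrite divr_gt0.
have [d1 d10 hd1] := cf z _ h2; have [d2 d20 hd2] := cg z _ h2.
have [|x [Xx]] := cz (Num.min d1 d2); first by rewrite lt_min d10.
rewrite lt_min => /andP[/hd1 k1 /hd2 k2]; rewrite (fg _ Xx) in k1.
have := chord_tri (g x) (f z) (g z); rewrite (chordC (g x)); lra.
Qed.

(** The image of a connected region lies in a single region, and the same holds for the inverse, so
    h induces a map of indices. The commutation relation passes to the closures by continuity. *)
Lemma conj_exists F G : is_pmt F -> is_pmt G -> top_conj F G ->
  exists h kap, conjd F G h kap.
Proof.
move=> PF PG [h [[g [hg gh ch cg]] hR hF]].
have /choice[kap hk] : forall k, exists j, forall z, reg F k z -> reg G j (h z).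
  move=> k.
  have [z rz] := reg_ne PF k.
  have hRs y : reg F k y -> Rset G (h y) by move=> ry; rewrite -hR; exists y => //; exists k.
  have [j rj] := hRs _ rz; exists j => y ry.
  apply: (connected_reg PG (sconnected_image ch (reg_conn PF (k := k))) _ _ rj).
  - by move=> _ [x rx <-]; exact: hRs.
  - by exists z.
  by exists y.
have back j y k z : reg G j y -> reg F k z -> reg G j (h z) -> reg F k (g y).
  move=> ry rz rhz.
  apply: (connected_reg PF (sconnected_image cg (reg_conn PG (k := j))) _ _ rz).
  - move=> _ [x rx <-]; have : Rset G x by exists j.
    by rewrite -hR => -[u ru <-]; rewrite hg.
  - by exists (h z) => //; rewrite hg.
  by exists y.
have hk2 k z : reg F k z <-> reg G (kap k) (h z).
  split=> [|rz]; first exact: hk.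
  have [x rx] := reg_ne PF k; rewrite -(hg z); exact: back rz rx (hk _ _ rx).
exists h, kap; split=> //.
- by exists g.
- move=> j k e; have [z rz] := reg_ne PF j; apply: (reg_uniq PF rz).
  by apply/hk2; rewrite -e; apply/hk2.
move=> k z cz.
apply: (@scont_eq_closure (h \o mob (mat F k)) (mob (mat G (kap k)) \o h)) cz.
- move=> y e e0 /=; have [d d0 hd] := ch (mob (mat F k) y) e e0.
  have [d' d'0 hd'] := scont_mob (mat_det PF k) y d0.
  by exists d' => // x /hd' /hd.
- move=> y e e0 /=; have [d d0 hd] := scont_mob (mat_det PG (kap k)) (h y) e0.
  have [d' d'0 hd'] := ch y d d0.
  by exists d' => // x /hd' /hd.
move=> x rx /=; have := hF x; rewrite (Ftot_reg PF rx) => -> //; last by exists k.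
by rewrite (Ftot_reg PG (proj1 (hk2 k x) rx)).
Qed.

Lemma conjd_sym F G h kap : is_pmt F -> is_pmt G -> conjd F G h kap ->
  exists g kap', [/\ conjd G F g kap', cancel h g & cancel g h].
Proof.
move=> PF PG [[g [hg gh ch cg]] ik hr hm].
have [kap' kK Kk] := injF_bij ik.
have hr2 k z : reg G k z <-> reg F (kap' k) (g z) by rewrite hr gh Kk.
exists g, kap'; split=> //; split=> //; first by exists h.
- exact: can_inj Kk.
move=> k z cz.
have cz2 : sclosure (reg F (kap' k)) (g z).
  apply: sclosureS (scont_closure cg cz) => _ [x rx <-]; exact/hr2.
by apply: (can_inj hg); rewrite hm // !gh Kk.
Qed.

Section Conj.
Variables (F G : pmt R K) (h : sphere R -> sphere R) (kap : 'I_K -> 'I_K).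
Hypotheses (PF : is_pmt F) (PG : is_pmt G) (cFG : conjd F G h kap).

Lemma conjd_cl k z : sclosure (reg F k) z -> sclosure (reg G (kap k)) (h z).
Proof.
case: cFG => [[g [hg gh ch cg]] ik hr hm] cz.
apply: sclosureS (scont_closure ch cz) => _ [x rx <-]; exact/hr.
Qed.

Lemma conjd_bd k z : sboundary (reg F k) z -> sboundary (reg G (kap k)) (h z).
Proof.
case: (cFG) => _ _ hr _; move=> /(bdE PF)[h1 h2]; apply/(bdE PG).
by split; [exact: conjd_cl | rewrite -hr].
Qed.

Lemma conjd_B z : Bset F z -> Bset G (h z).
Proof. by case=> k bk; exists (kap k); exact: conjd_bd. Qed.

Lemma conjd_reach X w z : reach F X w z -> reach G (h @` X) (map kap w) (h z).
Proof.
case: (cFG) => _ _ hr hm; elim: w z => [|k w IH] z /=; first by exists z.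
case=> rk rw; split; first by rewrite -hr.
by rewrite -hm; [exact: IH | exact: sclosure_sub].
Qed.

End Conj.

End Words.

(** * Perturbations of a PMT *)

Section Perturb.
Variables (R : realType) (K : nat).
Notation C := (Cplx R).
Notation M2 := 'M[C]_2.
Notation mats := ('I_K -> M2).
Implicit Types (F G : pmt R K) (z q : sphere R) (k : 'I_K) (w v : seq 'I_K)
  (A B : mats) (X Y : set (sphere R)) (f g : sphere R -> sphere R).

Definition push F f A : pmt R K := PMT (fun k => f @` reg F k) A.

(** Homeomorphisms that carry admissible boundary curves to admissible ones, so that the image
    partition is again allowed. *)
Definition goodmap f := homeo f /\ forall S, psscc S -> psscc (f @` S).

Section Homeo.
Variables (f g : sphere R -> sphere R).
Hypotheses (fK : cancel f g) (gK : cancel g f) (cf : scont f) (cg : scont g).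

Lemma image_can X z : (f @` X) z <-> X (g z).
Proof.
split=> [[x Xx <-]|h]; first by rewrite fK.
by exists (g z).
Qed.

Lemma closure_image X z : sclosure (f @` X) z <-> sclosure X (g z).
Proof.
split=> [/(scont_closure cg)|/(scont_closure cf)]; last by rewrite gK.
by apply: sclosureS => _ [_ [x Xx <-] <-]; rewrite fK.
Qed.

Lemma sopen_image X : sopen X -> sopen (f @` X).
Proof.
move=> oX z /image_can /oX[e e0 he]; have [d d0 hd] := cg z e0.
by exists d => // y /hd /he h; apply/image_can.
Qed.

Lemma interior_image X z : sinterior (f @` X) z <-> sinterior X (g z).
Proof.
split=> [[e e0 he]|[e e0 he]].
  have [d d0 hd] := cf (g z) e0; exists d => // y /hd; rewrite gK => /he /image_can.
  by rewrite fK.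
have [d d0 hd] := cg z e0; exists d => // y /hd /he h; exact/image_can.
Qed.

Lemma boundary_image X : sboundary (f @` X) = f @` sboundary X.
Proof.
apply/seteqP; split=> z; rewrite image_can.
  by move=> [/closure_image h1 h2]; split=> // /interior_image.
by move=> [h1 h2]; split; [exact/closure_image | move=> /interior_image].
Qed.

End Homeo.

(** Distinct classes in PSL(2,C) are a positive distance apart. This protects the minimality of the
    partition under perturbation. *)
Lemma pmeq_stable F : is_pmt F -> exists2 e : R, 0 < e & forall A,
  (forall k, mn (A k - mat F k) < e) -> forall j k, pmeq (A j) (A k) ->
  pmeq (mat F j) (mat F k).
Proof.
move=> PF.
have [||e e0 he] := @fin_pos R ('I_K * 'I_K)%type (fun p (e : R) => forall B1 B2 : M2,
   mn (B1 - mat F p.1) < e -> mn (B2 - mat F p.2) < e -> pmeq B1 B2 ->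
   pmeq (mat F p.1) (mat F p.2)).
- by move=> p e e' h e'0 le B1 B2 h1 h2; apply: h; apply: lt_le_trans le.
- case=> j k /=; set M := mat F j; set N := mat F k.
  case: (pselect (pmeq M N)) => [h|h]; first by exists 1.
  have p1 : 0 < mn (M - N) by apply: mn_gt0; rewrite subr_eq0; apply/eqP => e; apply: h; left.
  have p2 : 0 < mn (M + N) by apply: mn_gt0; rewrite addr_eq0; apply/eqP => e; apply: h; right.
  exists (Num.min (mn (M - N) / 2) (mn (M + N) / 2)); first by rewrite lt_min !divr_gt0.
  move=> B1 B2; rewrite !lt_min => /andP[a1 a2] /andP[b1 b2] [e|e]; exfalso.
    have := mnD (M - B1) (B2 - N).
    have -> : M - B1 + (B2 - N) = M - N by rewrite e addrA subrK.
    rewrite (mnBC M B1); lra.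
  have := mnD (M - B1) (N - B2).
  have -> : M - B1 + (N - B2) = M + N by rewrite e opprK addrACA subrr addr0.
  rewrite (mnBC M B1) (mnBC N B2); lra.
exists e => // A hA j k; exact: (he (j, k)).
Qed.

(** Only minimality needs an argument: if the new branches agree with one Moebius map near a
    boundary point, then by [mob_agree2] the matrices of the regions meeting there coincide in
    PSL(2,C), hence so did those of F, against the minimality of F. *)
Lemma push_pmt F : is_pmt F -> exists2 e : R, 0 < e & forall f A, goodmap f ->
  (forall k, \det (A k) = 1) -> (forall k, mn (A k - mat F k) < e) ->
  is_pmt (push F f A).
Proof.
move=> PF; have [e0 e00 he0] := pmeq_stable PF.
exists e0 => // f A [[g [fK gK cf cg]] gf] dA nA.
split; first by move=> k; have [z rz] := reg_ne PF k; exists (f z); exists z.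
split; first by move=> k; apply: (sopen_image fK gK cg); exact: reg_open.
split; first by move=> k; apply: (sconnected_image cf); exact: reg_conn.
split.
  move=> j k jk; apply/seteqP; split=> // z [[x rx <-] [y ry /(can_inj fK) e]].
  by case/eqP: jk; apply: (reg_uniq PF rx); rewrite -e.
split.
  move=> k; have [m [S [hS eS]]] := reg_psscc PF k.
  exists m, (fun i => f @` S i); split; first by move=> i; exact: gf.
  rewrite /= (boundary_image fK gK cf cg) eS.
  apply/seteqP; split=> z; first by move=> [x [i Si] <-]; exists i; exists x.
  by move=> [i [x Si <-]]; exists x => //; exists i.
split.
  move=> z; have [k hk] := reg_cover PF (g z); exists k.
  exact/(closure_image fK gK cf cg).
split=> // -[z [e [A0 [[k0 Bz] e0' hA]]]].
have Bb : Bset F (g z).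
  exists k0; move: Bz; rewrite /= (boundary_image fK gK cf cg).
  by move=> [x bx <-]; rewrite fK.
(* Within this radius of [g z] only regions having [g z] in their closure occur. *)
have [||e1 e10 he1] := @fin_pos R 'I_K (fun k (e : R) =>
   sclosure (reg F k) (g z) \/ forall y, reg F k y -> e <= chord (g z) y).
- move=> k e1 e2 [h|h] _ le; [by left | right=> y /h h'].
  exact: le_trans h'.
- move=> k; case: (pselect (sclosure (reg F k) (g z))) => h; first by exists 1 => //; left.
  move: h; rewrite /sclosure /= => /existsNP[e1 /not_implyP[e10 h]]; exists e1 => //; right=> y ry.
  by rewrite leNgt; apply/negP => h'; apply: h; exists y.
have [j cj] := reg_cover PF (g z).
apply: (pmt_min PF); exists (g z), e1, (mat F j); split=> // k w rw lw.
have [ck|/(_ _ rw)] := he1 k; last by rewrite leNgt lw.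
have vop i : sopen ((f @` reg F i) `&` sball z e).
  move=> y [fy yz]; have [d d0 hd] := sopen_image fK gK cg (reg_open PF (k := i)) fy.
  have yz' : 0 < e - chord z y by rewrite subr_gt0.
  exists (Num.min d (e - chord z y)); first by rewrite lt_min d0.
  move=> x; rewrite /sball /= lt_min => /andP[/hd xd xe]; split=> //.
  by have := chord_tri y z x; lra.
have vne i : sclosure (reg F i) (g z) -> ((f @` reg F i) `&` sball z e) !=set0.
  move=> /(closure_image fK gK cf cg) /(_ e e0')[y [fy h]]; by exists y.
have : pmeq (A k) (A j).
  apply: (@mob_agree2 _ (A k) (A j) A0 _ _ (dA k) (dA j) (vop k) (vne k ck) (vop j) (vne j cj)).
    by move=> x [fx xz]; apply: hA.
  by move=> x [fx xz]; apply: hA.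
by move=> /(he0 _ nA) [->|->] //; rewrite mobN.
Qed.

Lemma rnear_push F f A (e : R) : (exists2 g, cancel f g & cancel g f) ->
  (forall z, chord z (f z) < e) -> rnear F (push F f A) e.
Proof.
move=> [g fK gK] hf k z h; exists (g z); last exact: gK.
by apply: h; rewrite chordC -{2}(gK z).
Qed.

Lemma nrm_mn (M : M2) i j : nrm (M i j) <= mn M.
Proof.
have p1 := nrm_ge0 (M ord0 ord0); have p2 := nrm_ge0 (M ord0 ord_max).
have p3 := nrm_ge0 (M ord_max ord0); have p4 := nrm_ge0 (M ord_max ord_max).
by rewrite /mn; case: (ord2P i) => ->; case: (ord2P j) => ->; lra.
Qed.

Lemma hclose_image f X (e : R) : (forall z, chord z (f z) < e) -> hclose (f @` X) X e.
Proof.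
move=> hf; split=> [_ [x Xx <-]|x Xx]; first by exists x => //; rewrite chordC.
by exists (f x); [exists x | rewrite chordC].
Qed.

(* The only way in which structural stability is used. *)
Lemma stable_push F : is_pmt F -> struct_stable F -> exists2 e : R, 0 < e & forall f A,
  goodmap f -> (forall k, \det (A k) = 1) -> (forall k, mn (A k - mat F k) < e) ->
  (forall z, chord z (f z) < e) ->
  is_pmt (push F f A) /\ exists h kap, conjd F (push F f A) h kap.
Proof.
move=> PF [e0 e00 he0]; have [e1 e10 he1] := push_pmt PF.
exists (Num.min e0 e1); first by rewrite lt_min e00.
move=> f A gf dA nA hf.
have PG : is_pmt (push F f A).
  by apply: he1 => // k; have := nA k; rewrite lt_min => /andP[].
split=> //; apply: conj_exists => //.
case: (gf) => -[g [fK gK cf cg]] _.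
have hf' z : chord z (f z) < e0 by have := hf z; rewrite lt_min => /andP[].
apply: he0 => //.
- move=> k; left=> i j /=; apply: le_lt_trans (_ : mn (A k - mat F k) < _).
    by have := nrm_mn (A k - mat F k) i j; rewrite !mxE.
  by have := nA k; rewrite lt_min => /andP[].
- have -> : Bset (push F f A) = f @` Bset F.
    apply/seteqP; split=> z.
      move=> [k /=]; rewrite (boundary_image fK gK cf cg) => -[x bx <-].
      by exists x => //; exists k.
    move=> [x [k bx] <-]; exists k => /=; rewrite (boundary_image fK gK cf cg).
    by exists x.
  exact: hclose_image.
move=> k /=.
have -> : sclosure (f @` reg F k) = f @` sclosure (reg F k).
  apply/seteqP; split=> z; rewrite (closure_image fK gK cf cg) (image_can fK gK) //.
exact: hclose_image.
Qed.

Lemma goodmap_id : goodmap id.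
Proof.
split=> [|S]; last by rewrite image_id.
by exists id; split=> // z e e0; exists e.
Qed.

End Perturb.

(** * Loxodromic words and periodic points *)

Section Lox.
Variable R : realType.
Notation C := (Cplx R).
Notation M2 := 'M[C]_2.
Notation o0 := (ord0 : 'I_2).
Notation o1 := (ord_max : 'I_2).
Implicit Types (z x y : sphere R) (M : M2) (u v : vect R) (l : C).

Lemma expr_small (a c e : R) : 0 <= a < 1 -> 0 < e ->
  exists N, forall n, (N <= n)%N -> c * a ^+ n < e.
Proof.
move=> /andP[a0 a1] e0.
have p : 0 < `|c| + 1 by rewrite ltr_wpDl.
have cv : (fun n => a ^+ n) @ \oo --> (0 : R).
  by apply: cvg_expr; rewrite ger0_norm.
move/cvgrPdist_lt : cv => /(_ (e / (`|c| + 1)) (divr_gt0 e0 p)) [N _ hN].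
exists N => n /hN /=; rewrite sub0r normrN ger0_norm ?exprn_ge0 // ltr_pdivlMr // => h.
have := ler_norm c; have := exprn_ge0 n a0; nra.
Qed.

(** Loxodromic normal form: [pt u] is the attracting and [pt v] the repelling fixed point. *)
Definition eigd M l u v := [/\ wdg u v != 0, apm M u = scv l u,
  apm M v = scv l^-1 v & 1 < nrm l].

Lemma wdg_nz u v : wdg u v != 0 -> nzv u /\ nzv v.
Proof.
rewrite -nrm_gt0 => h; have := wdg_le u v; rewrite -!hn_gt0 !lt0r !hn_ge0 !andbT.
by move=> h2; split; apply/eqP => e; move: h2; rewrite e ?mul0r ?mulr0 leNgt h.
Qed.

Lemma decomp u v w : wdg u v != 0 -> exists a b : C, w = vadd (scv a u) (scv b v).
Proof.
move=> h; exists (wdg w v / wdg u v), (wdg u w / wdg u v).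
case: u v w h => u1 u2 [v1 v2] [w1 w2]; rewrite /vadd /scv /wdg /= => h.
by congr pair; field.
Qed.

Lemma sphere_decomp u v z : wdg u v != 0 -> exists a b : C,
  nzv (vadd (scv a u) (scv b v)) /\ z = pt (vadd (scv a u) (scv b v)).
Proof.
move=> h; have [a [b e]] := decomp (uv z) h; exists a, b.
by rewrite -e uvK uv_nz.
Qed.

Lemma iter_lox M l u v a b n : \det M = 1 -> eigd M l u v ->
  nzv (vadd (scv a u) (scv b v)) ->
  iter n (mob M) (pt (vadd (scv a u) (scv b v))) =
    pt (vadd (scv (l ^+ n * a) u) (scv (l ^- n * b) v)) /\
  nzv (vadd (scv (l ^+ n * a) u) (scv (l ^- n * b) v)).
Proof.
move=> dM [uv0 eu ev l1] nz.
elim: n => [|n [IHe IH]]; first by rewrite expr0 invr1 !mul1r.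
have e : apm M (vadd (scv (l ^+ n * a) u) (scv (l ^- n * b) v)) =
  vadd (scv (l ^+ n.+1 * a) u) (scv (l ^- n.+1 * b) v).
  rewrite apm_vadd !apm_scv eu ev /vadd /scv /=.
  by rewrite exprS invfM; congr pair; ring.
by rewrite iterS IHe mob_pt // e; split=> //; rewrite -e apm_nz.
Qed.

Lemma lox_conv M l u v z : \det M = 1 -> eigd M l u v -> z <> pt v ->
  sconv (fun n => iter n (mob M) z) (pt u).
Proof.
move=> dM ed zv; have [uv0 eu ev l1] := ed; have [u0 v0] := wdg_nz uv0.
have [a [b [nz ez]]] := sphere_decomp z uv0.
have a0 : a != 0.
  apply/eqP => a0; apply: zv; rewrite ez.
  have e : vadd (scv a u) (scv b v) = scv b v by rewrite a0 /vadd /scv /= !mul0r !add0r.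
  rewrite e; apply: pt_scv; apply/eqP => b0.
  by move: nz; rewrite e b0 -hn_gt0 hn_scv nrm0 mul0r ltxx.
have W : 0 < nrm (wdg u v) by rewrite nrm_gt0.
have Hu : 0 < hn u by rewrite hn_gt0.
have Hv : 0 < hn v by rewrite hn_gt0.
have Ha : 0 < nrm a by rewrite nrm_gt0.
have l0 : 0 < nrm l by apply: lt_trans l1.
move=> e e0.
have [N hN] := @expr_small (nrm l)^-1 (2 * nrm b * hn v / (nrm a * hn u)) e
  ltac:(by rewrite invr_ge0 ltW //= invf_lt1) e0.
exists N => n /hN; apply: le_lt_trans; rewrite ez.
have [-> nzn] := iter_lox n dM ed nz.
rewrite chord_pt //; set V := vadd _ _ in nzn *.
have -> : wdg V u = - (l ^- n * b * wdg u v).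
  by rewrite /V /wdg /vadd /scv /=; ring.
rewrite nrmN !nrmM nrmV nrmX.
have hV : nrm a * nrm (wdg u v) <= hn V * hn v.
  apply: le_trans (wdg_le V v).
  have -> : wdg V v = l ^+ n * a * wdg u v by rewrite /V /wdg /vadd /scv /=; ring.
  rewrite !nrmM nrmX -mulrA ler_peMl ?mulr_ge0 ?nrm_ge0 //.
  by apply: exprn_ege1; apply: ltW.
have HV : 0 < hn V by rewrite hn_gt0.
rewrite exprVn ler_pdivrMr ?mulr_gt0 //.
set L := (nrm l ^+ n)^-1.
have L0 : 0 <= L by rewrite invr_ge0 exprn_ge0 // nrm_ge0.
have -> : 2 * nrm b * hn v / (nrm a * hn u) * L * (hn V * hn u) =
  2 * (L * nrm b) * (hn V * hn v / nrm a) by field; rewrite !gt_eqF.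
rewrite -mulrA -mulrA ler_pM2l // mulrA ler_wpM2l ?mulr_ge0 ?nrm_ge0 //.
by rewrite ler_pdivlMr // mulrC.
Qed.

(** A bi-infinite orbit, f forwards and g backwards, that starts off x and stays within e of it.
    This is the conjugacy-invariant feature separating neutral fixed points from loxodromic ones. *)
Definition biorb M (x : sphere R) (e : R) := exists f g : nat -> sphere R,
  [/\ f 0%N = g 0%N, f 0%N <> x,
      forall i, f i.+1 = mob M (f i) /\ g i = mob M (g i.+1) &
      forall i, chord x (f i) < e /\ chord x (g i) < e].

Lemma eigd_inv M l u v : \det M = 1 -> eigd M l u v -> eigd (inv2 M) l v u.
Proof.
move=> dM [h eu ev l1]; have [u0 v0] := wdg_nz h.
have l0 : l != 0 by rewrite -nrm_gt0; apply: lt_trans l1.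
split=> //; first by rewrite wdgC oppr_eq0.
- rewrite -[in LHS](_ : scv l (scv l^-1 v) = v); last first.
    by rewrite /scv; case: (v) => a b /=; rewrite !mulrA divff ?mul1r.
  by rewrite apm_scv -ev apmVK.
rewrite -[in LHS](_ : scv l^-1 (scv l u) = u); last first.
  by rewrite /scv; case: (u) => a b /=; rewrite !mulrA mulVf ?mul1r.
by rewrite apm_scv -eu apmVK.
Qed.

Lemma lox_fix M l u v x : \det M = 1 -> eigd M l u v -> mob M x = x ->
  x = pt u \/ x = pt v.
Proof.
move=> dM ed ex; case: (pselect (x = pt v)) => xv; [by right | left].
have cv := lox_conv dM ed xv.
apply/eqP; rewrite -chord_eq0; apply/eqP/le_anti; rewrite chord_ge0 andbT leNgt.
apply/negP => h; have [N hN] := cv _ h.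
have := hN N (leqnn _); rewrite (_ : iter N (mob M) x = x) ?ltxx //.
by elim: N {hN} => //= n ->.
Qed.

(** Off the fixed point x, forward iteration (x repelling) or backward iteration (x attracting)
    converges to the other fixed point, so the orbit leaves the ball whose radius is half their
    distance. *)
Lemma lox_biorb M l u v x : \det M = 1 -> eigd M l u v -> mob M x = x ->
  exists2 e : R, 0 < e & ~ biorb M x e.
Proof.
move=> dM ed fx; have [h eu ev l1] := ed; have [u0 v0] := wdg_nz h.
have uv : 0 < chord (pt u) (pt v) by rewrite chord_gt0 -wdg_eq0.
exists (chord (pt u) (pt v) / 2); first by rewrite divr_gt0.
move=> [f [g [fg0 fx0 hs hc]]].
case: (lox_fix dM ed fx) => ex.
- have dI : \det (inv2 M) = 1 by rewrite det_inv2.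
  have cv : sconv (fun n => iter n (mob (inv2 M)) (g 0%N)) (pt v).
    by apply: (lox_conv dI (eigd_inv dM ed)); rewrite -fg0 -ex.
  have gi i : iter i (mob (inv2 M)) (g 0%N) = g i.
    by elim: i => //= i ->; have [_ ->] := hs i; rewrite mobK.
  have [N hN] := cv (chord (pt u) (pt v) / 2) ltac:(by rewrite divr_gt0).
  have := hN N (leqnn _); rewrite gi; have [_] := hc N; rewrite ex.
  have := chord_tri (g N) (pt u) (pt v); lra.
have cv : sconv (fun n => iter n (mob M) (f 0%N)) (pt u).
  by apply: (lox_conv dM ed); rewrite -ex.
have gi i : iter i (mob M) (f 0%N) = f i.
  by elim: i => //= i ->; have [-> _] := hs i.
have [N hN] := cv (chord (pt u) (pt v) / 2) ltac:(by rewrite divr_gt0).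
have := hN N (leqnn _); rewrite gi; have [] := hc N; rewrite ex.
have := chord_tri (f N) (pt v) (pt u); rewrite (chordC (pt v) (pt u)); lra.
Qed.

(** The hypothesis on l is the characteristic equation. Either of (b, l - a) and (l - d, c) is an
    eigenvector if nonzero; if both vanish, M is scalar. *)
Lemma eigvec M l : \det M = 1 -> l * (M o0 o0 + M o1 o1 - l) = 1 ->
  exists2 v, nzv v & apm M v = scv l v.
Proof.
rewrite det2; set a := M o0 o0; set b := M o0 o1; set c := M o1 o0; set d := M o1 o1.
move=> dM hl.
case: (eqVneq (b, l - a) (0, 0)) => [[b0 la]|h1]; last first.
  exists (b, l - a) => //; rewrite /apm /scv -/a -/b -/c -/d /=; congr pair; first ring.
  have : l * (a + d - l) = a * d - b * c by rewrite hl.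
  by move=> e; apply/eqP; rewrite -subr_eq0; apply/eqP; transitivity (l * (a + d - l) - (a * d - b * c)); [ring | rewrite e subrr].
case: (eqVneq (l - d, c) (0, 0)) => [[ld c0]|h2]; last first.
  exists (l - d, c) => //; rewrite /apm /scv -/a -/b -/c -/d /=; congr pair; last ring.
  have : l * (a + d - l) = a * d - b * c by rewrite hl.
  by move=> e; apply/eqP; rewrite -subr_eq0; apply/eqP; transitivity (l * (a + d - l) - (a * d - b * c)); [ring | rewrite e subrr].
exists (1, 0); first by rewrite /nzv xpair_eqE oner_eq0.
rewrite /apm /scv -/a -/b -/c -/d /= c0 -(subrK a l) la add0r; congr pair; ring.
Qed.

(** A non-real trace is sufficient for being loxodromic: an eigenvalue of modulus 1 gives the real
    trace l + l^-1. It is a polynomial condition that can be forced on finitely many words. *)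
Definition lox M := complex.Im (M o0 o0 + M o1 o1) != 0.

Lemma unit_conj l : nrm l = 1 -> complex.Im (l + l^-1) = 0.
Proof.
case: l => x y h; have := nrmE (x +i* y)%C; rewrite h /= expr1n => e.
by rewrite -e divr1 subrr.
Qed.

Lemma lox_eigd M : \det M = 1 -> lox M -> exists l u v, eigd M l u v.
Proof.
move=> dM lM; set t := M o0 o0 + M o1 o1.
have [l hl] : exists l : C, l * (t - l) = 1.
  exists ((t + sqrtc (t ^+ 2 - 4)) / 2).
  have := sqr_sqrtc (t ^+ 2 - 4 : R[i]); set s := sqrtc _ => hs.
  have -> : (t + s) / 2 * (t - (t + s) / 2) = (t ^+ 2 - s ^+ 2) / 4 by field.
  by rewrite hs opprB addrCA subrr addr0 divff.
have l0 : l != 0 by apply/eqP => l0; move: hl; rewrite l0 mul0r => /eqP; rewrite eq_sym oner_eq0.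
have li : l^-1 = t - l by apply: (mulfI l0); rewrite mulfV.
wlog l1 : l hl l0 li / 1 < nrm l.
  move=> hw; case: (ltrgtP (nrm l) 1) => h1; last first.
  - exfalso; move: lM; rewrite /lox -/t.
    by rewrite (_ : t = l + l^-1) ?unit_conj ?eqxx // li addrC subrK.
  - exact: (hw l).
  apply: (hw l^-1); rewrite ?invr_eq0 ?invrK //.
  - by rewrite {2}li opprB addrCA subrr addr0 mulVf.
  - by rewrite li opprB addrCA subrr addr0.
  by rewrite nrmV invf_gt1 ?nrm_gt0.
have [u u0 eu] := eigvec dM hl.
have [|v v0 ev] := @eigvec M l^-1 dM.
  by rewrite -/t {2}li opprB addrCA subrr addr0 mulVf.
exists l, u, v; split=> //.
rewrite wdg_eq0 //; apply/eqP => e.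
have [k k0 ek] := pt_vec u0; have [k' k'0 ek'] := pt_vec v0.
have uv : u = scv (k / k') v.
  by rewrite ek ek' e /scv /=; congr pair; field.
have : scv l u = scv l^-1 u.
  by rewrite -eu uv apm_scv ev /scv /=; congr pair; ring.
move/(congr1 (@hn R)); rewrite !hn_scv nrmV.
have hu : hn u != 0 by rewrite gt_eqF // hn_gt0.
move=> /(mulIf hu) h; have : (nrm l)^-1 < 1 by rewrite invf_lt1 // (lt_trans _ l1).
by rewrite -h => h'; have := lt_trans l1 h'; rewrite ltxx.
Qed.

End Lox.

(** * Making all words of a given length loxodromic *)

Section Generic.
Variables (R : realType) (K : nat).
Notation C := (Cplx R).
Notation M2 := 'M[C]_2.
Notation mats := ('I_K -> M2).
Notation o0 := (ord0 : 'I_2).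
Notation o1 := (ord_max : 'I_2).
Implicit Types (A B : mats) (w : seq 'I_K) (l t : C).

Lemma avoid_fin (T : finType) (P : T -> R -> Prop) (a b : R) : a < b ->
  (forall t : T, exists L : seq R, forall r, P t r -> r \in L) ->
  exists2 r, a < r < b & forall t : T, ~ P t r.
Proof.
move=> ab h; have [L hL] := choice h.
suff [r hr rL] : exists2 r, a < r < b & r \notin flatten [seq L u | u <- enum T].
  exists r => // t /hL h'; move/negP: rL; apply.
  by apply/flattenP; exists (L t) => //; apply: map_f; rewrite mem_enum.
move: (flatten _) => L'.
elim: L' a b ab {h hL L} => [|x s IH] a b ab.
  by exists ((a + b) / 2); rewrite ?midf_lt.
case: (ltrP x ((a + b) / 2)) => hx.
  have [r /andP[r1 r2] rs] := IH ((a + b) / 2) b ltac:(by rewrite midf_lt).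
  exists r; first by rewrite r2 andbT (lt_trans _ r1) // midf_lt.
  by rewrite inE negb_or rs andbT gt_eqF // (lt_trans hx).
have [r /andP[r1 r2] rs] := IH a ((a + b) / 2) ltac:(by rewrite midf_lt).
exists r; first by rewrite r1 (lt_trans r2) // midf_lt.
by rewrite inE negb_or rs andbT lt_eqF // (lt_le_trans r2).
Qed.

Lemma poly_roots_fin (p : {poly C}) : p != 0 -> exists L : seq C, forall x, root p x -> x \in L.
Proof.
move=> p0; apply: contrapT => h.
have h2 n : exists s : seq C, [/\ uniq s, size s = n & all (root p) s].
  elim: n => [|n [s [us ss rs]]]; first by exists [::].
  apply: contrapT => h3; apply: h; exists s => x rx; apply: contrapT => /negP xs.
  by apply: h3; exists (x :: s); split=> //=; rewrite ?xs ?us ?ss ?rx.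
have [s [us ss rs]] := h2 (size p).
by have := max_poly_roots p0 rs us; rewrite ss ltnn.
Qed.

(** The Moebius map fixing infinity and -t with eigenvalues l and l^-1. Multiplying all matrices by
    it turns the trace of each word into a Laurent polynomial in l. *)
Definition dil t l : M2 := mk2 l ((l - l^-1) * t) 0 l^-1.

Lemma det_dil t l : l != 0 -> \det (dil t l) = 1.
Proof. by move=> l0; rewrite det_mk2 mulr0 subr0 divff. Qed.

Lemma dil_near t (e : R) : 0 < e -> exists2 d : R, 0 < d & forall l,
  nrm (l - 1) < d -> l != 0 /\ mn (dil t l - 1%:M) < e.
Proof.
move=> e0; have pt : 0 < 3 + 3 * nrm t by have := nrm_ge0 t; lra.
exists (Num.min (1 / 2) (e / (3 + 3 * nrm t))); first by rewrite lt_min !divr_gt0.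
move=> l; rewrite lt_min => /andP[h1]; rewrite ltr_pdivlMr // => h2.
have hl : 1 / 2 < nrm l.
  by have := nrmBl 1 l; rewrite nrm1 (nrmBC 1); lra.
have l0 : l != 0 by rewrite -nrm_gt0; lra.
split=> //; rewrite /mn !mxE /= mulr0n mulr1n !subr0 nrm0 addr0.
have li : (nrm l)^-1 < 2 by rewrite -[2]invrK ltf_pV2 ?posrE ?invr_gt0 //; lra.
have e1 : nrm (l^-1 - 1) <= 2 * nrm (l - 1).
  have -> : l^-1 - 1 = - (l^-1 * (l - 1)) by field.
  rewrite nrmN nrmM nrmV; have := nrm_ge0 (l - 1); nra.
have e2 : nrm ((l - l^-1) * t) <= 3 * nrm (l - 1) * nrm t.
  rewrite nrmM ler_wpM2r ?nrm_ge0 //.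
  have -> : l - l^-1 = (l - 1) - (l^-1 - 1) by ring.
  by have := nrmB (l - 1) (l^-1 - 1); lra.
have := nrm_ge0 (l - 1); have := nrm_ge0 t; nra.
Qed.

(* Entries of l^n * Mw (dil t l * A) w as polynomials in l. *)
Definition dilA t A l : mats := fun k => dil t l *m A k.

Fixpoint wpoly t A w : ({poly C} * {poly C}) * ({poly C} * {poly C}) :=
  if w is k :: w' then
    let: ((p00, p01), (p10, p11)) := wpoly t A w' in
    let E j := 'X^2 * (A k o0 j + t * A k o1 j)%:P - (t * A k o1 j)%:P in
    let e j := (A k o1 j)%:P in
    ((p00 * E o0 + p01 * e o0, p00 * E o1 + p01 * e o1),
     (p10 * E o0 + p11 * e o0, p10 * E o1 + p11 * e o1))
  else ((1, 0), (0, 1)).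

Lemma wpoly_eval t A w l : l != 0 ->
  let: ((p00, p01), (p10, p11)) := wpoly t A w in
  let M := Mw (dilA t A l) w in let n := size w in
  [/\ p00.[l] = l ^+ n * M o0 o0, p01.[l] = l ^+ n * M o0 o1,
      p10.[l] = l ^+ n * M o1 o0 & p11.[l] = l ^+ n * M o1 o1].
Proof.
move=> l0; elim: w => [|k w] /=; first by rewrite !hornerE !mxE /= !mulr1n !mulr0n.
case: (wpoly t A w) => [[p00 p01] [p10 p11]] [e1 e2 e3 e4].
rewrite !hornerE e1 e2 e3 e4 !mulmx2 (exprS l (size w)).
have D := mk2E l ((l - l^-1) * t) 0 l^-1; rewrite -/(dil t l) in D.
rewrite !D; set M := Mw _ w.
by split; rewrite ?expr1; field.
Qed.

(** Degree 2n is reached on the diagonal only by the upper left entry, with an explicit product as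
    its coefficient. The condition 0 < i in the last clause is for the empty word, where the entry
    is the constant 1. *)
Lemma wpoly_deg t A w :
  let: ((p00, p01), (p10, p11)) := wpoly t A w in
  let n := size w in
  [/\ p00`_(2 * n) = \prod_(k <- w) (A k o0 o0 + t * A k o1 o0),
      (forall i, (2 * n < i)%N -> p00`_i = 0 /\ p01`_i = 0),
      (forall i, (2 * n <= i)%N -> p10`_i = 0) &
      (forall i, (2 * n <= i)%N -> (0 < i)%N -> p11`_i = 0)].
Proof.
elim: w => [|k w] /=.
  rewrite big_nil muln0; split; first by rewrite coef1.
  - by move=> i hi; split; [rewrite coef1; case: i hi | exact: coef0].
  - by move=> i _; exact: coef0.
  by move=> i _; rewrite coef1; case: i.
case: (wpoly t A w) => [[p00 p01] [p10 p11]] [e1 e2 e3 e4].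
have cf (p q : {poly C}) (a b c : C) i : (p * ('X^2 * a%:P - b%:P) + q * c%:P)`_i.+2 =
   p`_i * a - p`_i.+2 * b + q`_i.+2 * c.
  have -> : p * ('X^2 * a%:P - b%:P) + q * c%:P = (p * a%:P) * 'X^2 - p * b%:P + q * c%:P by ring.
  have cx (r : {poly C}) : (r * (polyX C) ^+ 2)`_i.+2 = r`_i by rewrite coefMXn !subSS subn0.
  by rewrite coefD coefB cx !coefMC.
have n2 : (2 * (size w).+1)%N = (2 * size w).+2 by rewrite mulnS.
rewrite n2; split.
- rewrite cf big_cons e1 mulrC.
  have [-> _] := e2 (2 * size w).+2 ltac:(by rewrite ltnS leqnSn).
  by have [_ ->] := e2 (2 * size w).+2 ltac:(by rewrite ltnS leqnSn);
     rewrite !mul0r subr0 addr0.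
- move=> [|[|i]] // hi; rewrite !cf; rewrite !ltnS in hi.
  have [-> ->] := e2 i.+2 ltac:(by rewrite (leq_trans hi) // leqW).
  by have [-> _] := e2 i hi; rewrite !mul0r subr0 addr0.
- move=> [|[|i]] // hi; rewrite !cf; rewrite !ltnS in hi.
  have hi2 : (2 * size w <= i.+2)%N by rewrite (leq_trans hi) // -addn2 leq_addr.
  by rewrite (e3 i hi) (e3 _ hi2) (e4 _ hi2 isT) !mul0r subr0 addr0.
move=> [|[|i]] // hi _; rewrite !cf; rewrite !ltnS in hi.
have hi2 : (2 * size w <= i.+2)%N by rewrite (leq_trans hi) // -addn2 leq_addr.
by rewrite (e3 i hi) (e3 _ hi2) (e4 _ hi2 isT) !mul0r subr0 addr0.
Qed.

Definition wtr t A w : {poly C} := (wpoly t A w).1.1 + (wpoly t A w).2.2.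

Lemma wtr_eval t A w l : l != 0 ->
  (wtr t A w).[l] = l ^+ size w * (Mw (dilA t A l) w o0 o0 + Mw (dilA t A l) w o1 o1).
Proof.
move=> l0; have := wpoly_eval t A w l0; rewrite /wtr.
case: (wpoly t A w) => [[p00 p01] [p10 p11]] /= [e1 _ _ e2].
by rewrite hornerD e1 e2 mulrDr.
Qed.

Lemma wtr_deg t A w : (0 < size w)%N ->
  (wtr t A w)`_(2 * size w) = \prod_(k <- w) (A k o0 o0 + t * A k o1 o0) /\
  (size (wtr t A w) <= (2 * size w).+1)%N.
Proof.
move=> w0; have := wpoly_deg t A w; rewrite /wtr.
case: (wpoly t A w) => [[p00 p01] [p10 p11]] /= [e1 e2 e3 e4]; split.
  by rewrite coefD e1 e4 ?addr0 // muln_gt0.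
apply/leq_sizeP => i hi; rewrite coefD (e2 i hi).1 e4 ?addr0 //.
  exact: ltnW.
exact: leq_ltn_trans hi.
Qed.

(* On the circle |l| = r one has conj l = r^2 / l; so reality of l^-n Q(l) becomes
   the polynomial equation r^2n Q(l) = crev n r Q (l). *)
Definition crev (n : nat) (r : R) (Q : {poly C}) : {poly C} :=
  \poly_(j < (2 * n).+1) ((Q`_(2 * n - j))^*%C * (r ^+ (2 * (2 * n - j)))%:C%C).

Lemma conjM (x y : C) : ((x * y)^*%C : C) = x^*%C * y^*%C.
Proof. by case: x y => [a b] [c d]; apply/eqP; rewrite eq_complex /=; apply/andP; split; apply/eqP; ring. Qed.

Lemma conjX (x : C) n : ((x ^+ n)^*%C : C) = (x^*%C : C) ^+ n.
Proof.
elim: n => [|n IH]; last by rewrite !exprS conjM IH.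
by apply/eqP; rewrite eq_complex /= oppr0 !eqxx.
Qed.

Lemma conj_sum (I : Type) (s : seq I) (f : I -> C) :
  ((\sum_(i <- s) f i)^*%C : C) = \sum_(i <- s) ((f i)^*%C : C).
Proof.
elim: s => [|i s IH]; first by rewrite !big_nil; apply/eqP; rewrite eq_complex /= oppr0 !eqxx.
rewrite !big_cons -IH; case: (f i) => a b; case: (\sum_(j <- s) f j) => c d.
by apply/eqP; rewrite eq_complex /= opprD !eqxx.
Qed.

Lemma conj_norm l : l * (l^*%C : C) = (nrm l ^+ 2)%:C%C.
Proof.
rewrite nrmE; case: l => a b; apply/eqP; rewrite eq_complex /=.
by apply/andP; split; apply/eqP; ring.
Qed.

Lemma crev_eq n r (Q : {poly C}) l (x : C) : (size Q <= (2 * n).+1)%N -> nrm l = r -> 0 < r ->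
  Q.[l] = l ^+ n * x -> complex.Im x = 0 -> root ((r ^+ (2 * n))%:C%C *: Q - crev n r Q) l.
Proof.
move=> sQ lr r0 eQ xr; have l0 : l != 0 by rewrite -nrm_gt0 lr.
have cx : (x^*%C : C) = x by case: x xr {eQ} => a b /= ->; rewrite oppr0.
have cl : (l^*%C : C) = (r ^+ 2)%:C%C / l.
  by apply: (mulfI l0); rewrite conj_norm lr mulrCA divff // mulr1.
have e : (crev n r Q).[l] = l ^+ (2 * n) * ((Q.[l])^*%C : C).
  rewrite horner_poly (horner_coef_wide _ sQ) conj_sum mulr_sumr.
  rewrite (reindex_inj rev_ord_inj) /=; apply: eq_bigr => i _.
  rewrite conjM conjX cl subSS subKn -1?ltnS //.
  have hi : (i <= 2 * n)%N by rewrite -ltnS.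
  rewrite expr_div_n -!rmorphXn /= -exprM.
  have -> : l ^+ (2 * n) = l ^+ (2 * n - i) * l ^+ i by rewrite -exprD subnK.
  by field; rewrite expf_neq0.
rewrite /root hornerD hornerN hornerZ e eQ conjM cx conjX cl.
rewrite expr_div_n -rmorphXn /= -exprM mulnC mulnC exprM.
have -> : l ^+ (2 * n) = l ^+ n * l ^+ n by rewrite mul2n -addnn exprD.
by apply/eqP; field; rewrite expf_neq0.
Qed.

Lemma wtr_lead t A w : (0 < size w)%N -> (forall k, A k o0 o0 + t * A k o1 o0 != 0) ->
  (wtr t A w)`_(2 * size w) != 0.
Proof.
move=> w0 h; have [-> _] := wtr_deg t A w0.
by rewrite prodf_seq_neq0; apply/allP => k _; exact: h.
Qed.

(** Comparing coefficients of degree 2n, the polynomial can vanish identically only if r^(2n) is the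
    conjugate of Q_0 divided by Q_2n, which determines r. *)
Lemma bad_radius t A w : (0 < size w)%N -> (forall k, A k o0 o0 + t * A k o1 o0 != 0) ->
  exists L : seq R, forall r, 0 < r /\
    (r ^+ (2 * size w))%:C%C *: wtr t A w - crev (size w) r (wtr t A w) = 0 -> r \in L.
Proof.
move=> w0 h; have lc := wtr_lead w0 h; set Q := wtr t A w in lc *.
set n := size w in w0 lc *.
have e r : (r ^+ (2 * n))%:C%C *: Q - crev n r Q = 0 ->
  (r ^+ (2 * n))%:C%C = (Q`_0)^*%C / Q`_(2 * n).
  move=> /(congr1 (fun p : {poly C} => p`_(2 * n))).
  rewrite coefB coefZ coef_poly ltnS leqnn subnn muln0 expr0 mulr1 coef0.
  by move=> /eqP; rewrite subr_eq0 => /eqP <-; rewrite mulfK.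
case: (pselect (exists r, 0 < r /\ (r ^+ (2 * n))%:C%C *: Q - crev n r Q = 0)); last first.
  by move=> hn; exists [::] => r hr; case: hn; exists r.
move=> [r0 [r00 /e e0]]; exists [:: r0] => r [rp /e er].
rewrite inE -(@eqrXn2 _ (2 * n)) ?ltW // ?muln_gt0 //.
by apply/eqP; move: er; rewrite -e0; apply: complexI.
Qed.

(** The fixed point -t of [dil] must differ from the image of infinity under each matrix. Each
    matrix excludes at most one t, since its first column is nonzero. *)
Lemma good_slope A : (forall k, \det (A k) = 1) ->
  exists t : C, forall k, A k o0 o0 + t * A k o1 o0 != 0.
Proof.
move=> dA.
have [||r _ hr] := @avoid_fin 'I_K (fun k (r : R) => A k o0 o0 + r%:C%C * A k o1 o0 = 0) 0 1.
- exact: ltr01.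
- move=> k; case: (eqVneq (A k o1 o0) 0) => [c0|c0].
    exists [::] => r; rewrite c0 mulr0 addr0 => a0; move: (dA k).
    by rewrite det2 a0 c0 mul0r mulr0 subrr => /eqP; rewrite eq_sym oner_eq0.
  exists [:: complex.Re (- A k o0 o0 / A k o1 o0)] => r /eqP.
  rewrite addrC addr_eq0 => /eqP h; rewrite inE -h mulfK //.
by exists r%:C%C => k; apply/eqP; exact: hr.
Qed.

(** The Cayley parametrisation r (1 + i s) / (1 - i s) of the circle is injective and tends to r as
    s tends to 0, so small s give infinitely many candidates. *)
Lemma circle_pt (r : R) (L : seq C) (e : R) : 0 < r -> 0 < e ->
  exists l : C, [/\ nrm l = r, nrm (l - r%:C%C) < e & l \notin L].
Proof.
move=> r0 e0.
pose f (s : R) : C := r%:C%C * ((1 +i* s)%C / (1 -i* s)%C).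
have nz (s : R) : ((1 +i* s)%C : C) != 0 /\ ((1 -i* s)%C : C) != 0.
  by split; apply/eqP => -[/eqP]; rewrite oner_eq0.
have nf s : nrm (f s) = r.
  rewrite /f !nrmM nrmV nrm_real gtr0_norm //.
  have -> : nrm ((1 -i* s)%C : C) = nrm ((1 +i* s)%C : C).
    by rewrite /nrm /Normc.normc sqrrN.
  by rewrite divff ?mulr1 // nrm_eq0; case: (nz s).
have fI s s' : f s = f s' -> s = s'.
  move=> /mulfI; rewrite -nrm_eq0 nrm_real normr_eq0 (gt_eqF r0) => /(_ isT) /eqP.
  rewrite eqr_div ?(nz s).2 ?(nz s').2 // => /eqP [_]; lra.
have d0 : 0 < e / (2 * r) by rewrite divr_gt0 // mulr_gt0.
have [|s /andP[s0 s1] hs] := @avoid_fin 'I_1 (fun _ s => f s \in L) 0 (e / (2 * r)) d0.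
  move=> _; elim: L => [|x L [L' hL]]; first by exists [::].
  case: (pselect (exists s, f s = x)) => [[s0 hs0]|hx].
    exists (s0 :: L') => s; rewrite !inE => /orP[/eqP h|/hL ->]; last by rewrite orbT.
    by rewrite (fI s s0) ?eqxx // hs0.
  by exists L' => s; rewrite inE => /orP[/eqP h|/hL //]; case: hx; exists s.
exists (f s); split=> //; last by apply/negP; exact: (hs ord0).
have -> : f s - r%:C%C = r%:C%C * ((0 +i* (2 * s))%C / (1 -i* s)%C).
  rewrite /f -[X in _ - X]mulr1 -mulrBr; congr (_ * _).
  rewrite -[X in _ - X](divff (nz s).2) -mulrBl; congr (_ / _).
  by apply/eqP; rewrite eq_complex /=; apply/andP; split; apply/eqP; ring.
rewrite !nrmM nrmV nrm_real gtr0_norm //.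
have -> : nrm ((0 +i* (2 * s))%C : C) = 2 * s.
  by rewrite /nrm /Normc.normc expr0n add0r sqrtr_sqr gtr0_norm ?mulr_gt0.
have n1 : 1 <= nrm ((1 -i* s)%C : C).
  rewrite /nrm /Normc.normc -{1}sqrtr1 ler_sqrt; last by rewrite addr_ge0 ?sqr_ge0.
  by rewrite expr1n lerDl sqr_ge0.
move: s1; rewrite ltr_pdivlMr ?mulr_gt0 // => s1.
apply: le_lt_trans (_ : r * (2 * s) < e); last by rewrite mulrCA mulrA mulrC.
by rewrite ler_pM2l // ler_pdivrMr ?(lt_le_trans ltr01) // ler_peMr // mulr_ge0 // ltW.
Qed.

(** The radius r avoids the finitely many bad radii, after which l on the circle |l| = r avoids the
    finitely many roots that a real trace would force. The number m converts the relative error of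
    [dil] into the absolute one. *)
Lemma generic_words A n (e : R) : (forall k, \det (A k) = 1) -> (0 < n)%N -> 0 < e ->
  exists B, [/\ forall k, \det (B k) = 1, forall k, mn (B k - A k) < e &
    forall w, size w = n -> lox (Mw B w)].
Proof.
move=> dA n0 e0; have [t ht] := good_slope dA.
have [||m m0 hm] := @fin_pos R 'I_K (fun k (m : R) => mn (A k) < m^-1).
- move=> k m m' h m0 le; apply: lt_le_trans h _; rewrite lef_pV2 ?posrE //.
  exact: lt_le_trans le.
- move=> k; exists (mn (A k) + 1)^-1; rewrite ?invrK ?invr_gt0 ?ltrDl //.
  by rewrite ltr_wpDl // mn_ge0.
have [d d0 hd] := dil_near t (mulr_gt0 e0 m0).
have d2 : 1 < 1 + d / 2 by rewrite ltrDl divr_gt0.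
have [|r /andP[r1 r2] hr] := @avoid_fin (n.-tuple 'I_K) (fun u r => 0 < r /\
   (r ^+ (2 * size u))%:C%C *: wtr t A u - crev (size u) r (wtr t A u) = 0) 1 (1 + d / 2) d2.
  by move=> u; apply: bad_radius; rewrite ?size_tuple.
have r0 : 0 < r by apply: lt_trans r1.
have [L hL] : exists L : seq C, forall (u : n.-tuple 'I_K) l,
   root ((r ^+ (2 * size u))%:C%C *: wtr t A u - crev (size u) r (wtr t A u)) l -> l \in L.
  have /choice[L hL] : forall u : n.-tuple 'I_K, exists L : seq C, forall l,
    root ((r ^+ (2 * size u))%:C%C *: wtr t A u - crev (size u) r (wtr t A u)) l -> l \in L.
    move=> u; apply: poly_roots_fin; apply/eqP => h; exact: (hr u).
  exists (flatten [seq L u | u <- enum {: n.-tuple 'I_K}]) => u l /hL h.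
  by apply/flattenP; exists (L u) => //; apply: map_f; rewrite mem_enum.
have [l [l1 l2 l3]] := circle_pt L r0 (divr_gt0 d0 (ltr0n _ 2)).
have [|l0 lm] := hd l.
  have -> : l - 1 = (l - r%:C%C) + (r - 1)%:C%C by rewrite rmorphB rmorph1 addrA subrK.
  apply: le_lt_trans (nrmD _ _) _; rewrite nrm_real gtr0_norm ?subr_gt0 //; lra.
exists (dilA t A l); split.
- by move=> k; rewrite det_mul1 // det_dil.
- move=> k; have -> : dilA t A l k - A k = (dil t l - 1%:M) *m A k.
    by rewrite mulmxBl mul1mx.
  apply: le_lt_trans (mnM _ _) _.
  have h : mn (A k) * m < 1 by have := hm k; rewrite -[m^-1]div1r ltr_pdivlMr.
  have := mn_ge0 (A k); have := mn_ge0 (dil t l - 1%:M) => p1 p2.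
  have : mn (dil t l - 1%:M) * mn (A k) * m < e * m.
    by apply: le_lt_trans lm; rewrite -mulrA ler_piMr //; apply: ltW.
  by rewrite ltr_pM2r.
move=> w sw; apply/eqP => h; move/negP: l3; apply.
have szt : size w == n by rewrite sw.
apply: (hL (Tuple szt)) => /=.
apply: (@crev_eq (size w) r _ l (Mw (dilA t A l) w o0 o0 + Mw (dilA t A l) w o1 o1)) => //.
- by have [_] := @wtr_deg t A w ltac:(by rewrite sw).
- exact: wtr_eval.
Qed.

End Generic.

(** * Multipliers and neutral fixed points *)

Lemma derive1_mob (C : numFieldType) (a b c d z0 : C) : c * z0 + d != 0 ->
  derive1 (fun w : C => (a * w + b) / (c * w + d)) z0 = (a * d - b * c) / (c * z0 + d) ^+ 2.
Proof.
move=> nz; set D := a * d - b * c; set e := c * z0 + d in nz *.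
have ct : continuous (fun h : C => c * (h + z0) + d).
  move=> h; apply: (@continuousD C C C (fun h => c * (h + z0)) (fun=> d)); last exact: cst_continuous.
  apply: (@continuousM C C (fun=> c) (fun h => h + z0)); first exact: cst_continuous.
  by apply: (@continuousD C C C id (fun=> z0)); [exact: cvg_id | exact: cst_continuous].
have e0 : c * (0 + z0) + d = e by rewrite add0r.
(* For h distinct from 0 the difference quotient simplifies to this expression, which is continuous
   at 0. *)
have cg : {for (0 : C), continuous (fun h : C => D / ((c * (h + z0) + d) * e))}.
  apply: (@continuousM C C (fun=> D) (fun h => ((c * (h + z0) + d) * e)^-1)); first exact: cst_continuous.
  apply: (@continuousV C C (fun h => (c * (h + z0) + d) * e)); first by rewrite e0 mulf_neq0.
  apply: (@continuousM C C (fun h => c * (h + z0) + d) (fun=> e)); [exact: ct | exact: cst_continuous].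
have {}cg : (fun h : C => D / ((c * (h + z0) + d) * e)) @ (0 : C)^' --> D / e ^+ 2.
  have -> : D / e ^+ 2 = D / ((c * (0 + z0) + d) * e) by rewrite e0 expr2.
  exact: cvg_within_filter cg.
have cde := ct 0; rewrite /continuous_at e0 in cde.
rewrite /derive1; apply: cvg_lim => //.
apply: cvg_trans cg; apply: near_eq_cvg.
have ne : \forall h \near (0 : C), c * (h + z0) + d != 0.
  by apply: cvgr_neq0 cde nz.
near=> h.
have h0 : h != 0 by near: h; exact: nbhs_dnbhs_neq.
have hd : c * (h + z0) + d != 0 by near: h; apply: nbhs_dnbhs; exact: ne.
rewrite /GRing.scale /= /D -/e.
by move: nz hd; rewrite /e => nz hd; field; rewrite h0 nz hd.
Unshelve. all: by end_near.
Qed.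

Section Neutral.
Variable R : realType.
Notation C := (Cplx R).
Notation M2 := 'M[C]_2.
Notation o0 := (ord0 : 'I_2).
Notation o1 := (ord_max : 'I_2).
Implicit Types (z x y : sphere R) (M : M2) (u v : vect R) (l : C).

Lemma scvA k l v : scv k (scv l v) = scv (k * l) v.
Proof. by rewrite /scv /= !mulrA. Qed.

Lemma scv_inj k v w : k != 0 -> scv k v = scv k w -> v = w.
Proof. by case: v w => a b [c d] k0 [/(mulfI k0) -> /(mulfI k0) ->]. Qed.

(** At a finite fixed point z0 the derivative is (c z0 + d)^-2, and c z0 + d is the eigenvalue. At
    infinity the chart 1 / w exchanges the roles of the coordinates. *)
Lemma multiplier_eig M l v z : \det M = 1 -> nzv v -> apm M v = scv l v -> pt v = z ->
  multiplier M z = l^-1 ^+ 2.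
Proof.
move=> dM v0 ev ez; have [k k0 ek] := pt_vec v0; rewrite ez in ek.
have {v v0 ev ez ek} ev : apm M (vec z) = scv l (vec z).
  by apply: (scv_inj k0); rewrite -apm_scv -ek ev ek !scvA mulrC.
move: dM; rewrite det2 => dM.
case: z ev => [z0|] /=; rewrite /apm /scv /= => -[e1 e2].
  rewrite mulr1 in e2; rewrite mulr1 in e2.
  have l0 : l != 0.
    apply/eqP => l0; rewrite l0 mul0r mulr1 in e1; rewrite l0 in e2.
    have : M o0 o0 * M o1 o1 - M o0 o1 * M o1 o0 = 0.
      have -> : M o1 o1 = - (M o1 o0 * z0) by apply/eqP; rewrite -addr_eq0 addrC e2.
      have -> : M o0 o1 = - (M o0 o0 * z0) by apply/eqP; rewrite -addr_eq0 addrC e1.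
      ring.
    by rewrite dM => /eqP; rewrite oner_eq0.
  by rewrite /multiplier derive1_mob ?e2 // dM div1r exprVn.
rewrite !mulr1 !mulr0 !addr0 in e1 e2.
have l0 : l != 0.
  by apply/eqP => l0; move: dM; rewrite e1 e2 l0 mul0r mulr0 subrr => /eqP; rewrite eq_sym oner_eq0.
rewrite /multiplier.
have -> : (fun w : C => (M o1 o0 + M o1 o1 * w) / (M o0 o0 + M o0 o1 * w)) =
  (fun w : C => (M o1 o1 * w + M o1 o0) / (M o0 o1 * w + M o0 o0)).
  by apply/funext => w; congr (_ / _); rewrite addrC.
rewrite derive1_mob mulr0 add0r e1 // -e1 [M o1 o1 * _]mulrC [M o1 o0 * _]mulrC dM div1r.
by rewrite e1 exprVn.
Qed.

Lemma fix_eig M z : \det M = 1 -> mob M z = z ->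
  exists2 l, l != 0 & apm M (uv z) = scv l (uv z).
Proof.
move=> dM; rewrite mobE // => h.
have nz := apm_nz dM (uv_nz z).
have [k k0 ek] := pt_vec nz; have [k' k'0 ek'] := pt_vec (uv_nz z).
rewrite h in ek; rewrite uvK in ek'.
exists (k / k'); first by rewrite mulf_neq0 ?invr_eq0.
by rewrite ek [in RHS]ek' scvA divfK.
Qed.

Lemma nrm_ge_Im l : `|complex.Im l| <= nrm l.
Proof.
rewrite -(@ler_pXn2r _ 2) ?nnegrE ?nrm_ge0 // nrmE real_normK ?num_real //.
by rewrite lerDr sqr_ge0.
Qed.

Lemma scv_vadd k u v : scv k (vadd u v) = vadd (scv k u) (scv k v).
Proof. by rewrite /scv /vadd /= !mulrDr. Qed.

(** The map x -> m x + s with |m| = 1 is a rigid motion. For m distinct from 1 it rotates large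
    circles about its fixed point; for m = 1 it translates along lines parallel to s, which can be
    taken far from 0. *)
Lemma neutral_far (m s : C) (L : R) : 0 <= L -> nrm m = 1 -> exists f g : nat -> C,
  [/\ f 0%N = g 0%N, forall i, f i.+1 = m * f i + s /\ g i = m * g i.+1 + s &
   forall i, L <= nrm (f i) /\ L <= nrm (g i)].
Proof.
move=> L0 m1; have m0 : m != 0 by rewrite -nrm_eq0 m1 oner_eq0.
case: (eqVneq m 1) => [em|nm]; last first.
  have n1 : 1 - m != 0 by rewrite subr_eq0 eq_sym.
  pose c := s / (1 - m); pose r : C := (L + nrm c)%:C%C.
  have far (x : C) : nrm x = 1 -> L <= nrm (c + x * r).
    move=> x1; have := nrmBl (x * r) (- c); rewrite opprK nrmN addrC => h.
    have : nrm (x * r) = L + nrm c.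
      by rewrite nrmM x1 mul1r nrm_real ger0_norm // addr_ge0 ?nrm_ge0.
    move: h; rewrite (addrC (x * r)) => h h'; lra.
  exists (fun i => c + m ^+ i * r), (fun i => c + m ^- i * r); split.
  - by rewrite expr0 invr1.
  - move=> i; rewrite !exprS /c; split; first by field.
    by field; rewrite m0 n1 expf_neq0.
  by move=> i; split; apply: far; rewrite ?nrmV nrmX m1 expr1n ?invr1.
rewrite em; case: (eqVneq s 0) => [->|s0].
  exists (fun=> L%:C%C), (fun=> L%:C%C); split=> // i.
    by rewrite !mul1r addr0.
  by rewrite nrm_real ger0_norm.
have p : 0 < nrm s by rewrite nrm_gt0.
have far (t : R) : L <= nrm ((t +i* (L / nrm s))%C * s).
  rewrite nrmM -ler_pdivrMr //; apply: le_trans (nrm_ge_Im _) => /=.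
  by rewrite ger0_norm // divr_ge0 // ltW.
exists (fun i => (i%:R +i* (L / nrm s))%C * s), (fun i => (- i%:R +i* (L / nrm s))%C * s).
split; first by rewrite oppr0.
- move=> i; rewrite !mul1r; split.
    rewrite -[X in _ = _ + X]mul1r -mulrDl; congr (_ * _).
    by apply/eqP; rewrite eq_complex /= addr0 -natr1 !eqxx.
  rewrite -[X in _ = _ + X]mul1r -mulrDl; congr (_ * _).
  by apply/eqP; rewrite eq_complex /= addr0 -natr1 opprD addrNK !eqxx.
by move=> i; split; exact: far.
Qed.

(** In the coordinate x of the vector x v + n the fixed point lies at infinity and M acts as x ->
    l^2 x + l a, so the orbits of [neutral_far] stay close to z. *)
Lemma neutral_biorb M l z (e : R) : \det M = 1 -> apm M (uv z) = scv l (uv z) ->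
  nrm l = 1 -> 0 < e -> biorb M z e.
Proof.
move=> dM ev l1 e0; set v := uv z in ev.
have l0 : l != 0 by rewrite -nrm_eq0 l1 oner_eq0.
(* The unit vector Hermitian orthogonal to v, normalised by v ^ n = 1. *)
pose n : vect R := (- (v.2)^*%C, (v.1)^*%C).
have vn : wdg v n = 1.
  rewrite /wdg /n /= mulrN opprK !conj_norm -rmorphD -hnE hn_uv expr1n.
  by apply/eqP; rewrite eq_complex /= !eqxx.
have [a [b eMn]] : exists a b : C, apm M n = vadd (scv a v) (scv b n).
  by apply: decomp; rewrite vn oner_eq0.
have lb : l * b = 1.
  have := wdg_apm M v n; rewrite dM vn ev eMn mulr1 => <-.
  transitivity (l * b * wdg v n); first by rewrite vn mulr1.
  rewrite /wdg /scv /vadd /=; ring.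
pose P (x : C) := vadd (scv x v) n.
have wP (y : C) : wdg v (P y) = 1.
  by rewrite -vn /P /wdg /vadd /scv /=; ring.
have Pn (y : C) : nzv (P y) by have [_] := @wdg_nz _ v (P y) ltac:(by rewrite wP oner_eq0).
have MP (x : C) : mob M (pt (P x)) = pt (P (l ^+ 2 * x + l * a)).
  rewrite mob_pt // -(pt_scv (k := l) (apm M (P x)) l0); congr pt.
  rewrite /P apm_vadd apm_scv ev eMn !scv_vadd !scvA lb /vadd /scv /=.
  congr pair; ring.
have cP (x : C) : 2 / e + hn n + 1 <= nrm x -> chord z (pt (P x)) < e.
  move=> hx; rewrite -(uvK z) chord_pt ?uv_nz // -/v wP nrm1 hn_uv mul1r mulr1.
  have h : nrm x <= hn (P x) + hn n.
    have -> : nrm x = hn (scv x v) by rewrite hn_scv hn_uv mulr1.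
    have -> : scv x v = vadd (P x) (scv (-1) n).
      by rewrite /P /vadd /scv /=; congr pair; ring.
    by apply: le_trans (hnD _ _) _; rewrite hn_scv nrmN nrm1 mul1r.
  have p : 0 < hn (P x) by rewrite hn_gt0.
  rewrite ltr_pdivrMr // mulrC -ltr_pdivrMr //; lra.
have L0 : 0 <= 2 / e + hn n + 1.
  by rewrite !addr_ge0 ?hn_ge0 // divr_ge0 // ltW.
have [|f [g [fg hs hL]]] := @neutral_far (l ^+ 2) (l * a) _ L0.
  by rewrite nrmX l1 expr1n.
exists (fun i => pt (P (f i))), (fun i => pt (P (g i))); split.
- by rewrite fg.
- move=> h; have : wdg v (P (f 0%N)) == 0 by rewrite wdg_eq0 ?uv_nz // h uvK.
  by rewrite wP oner_eq0.
- by move=> i; rewrite !MP; have [-> ->] := hs i.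
by move=> i; have [h1 h2] := hL i; split; apply: cP.
Qed.

End Neutral.

(** * Excluding neutral and identity-type cycles *)

Section NoNeutral.
Variables (R : realType) (K : nat).
Notation C := (Cplx R).
Implicit Types (F G : pmt R K) (z q : sphere R) (k : 'I_K) (w v : seq 'I_K).

Lemma goodpush_id F : is_pmt F -> struct_stable F -> exists2 e : R, 0 < e &
  forall B : 'I_K -> 'M[C]_2, (forall k, \det (B k) = 1) ->
   (forall k, mn (B k - mat F k) < e) ->
   is_pmt (push F id B) /\ exists h kap, conjd F (push F id B) h kap.
Proof.
move=> PF SF; have [e e0 he] := stable_push PF SF; exists e => // B dB nB.
by apply: he => //; [exact: goodmap_id | move=> z; rewrite chordzz].
Qed.

Section Conj.
Variables (F G : pmt R K) (h : sphere R -> sphere R) (kap : 'I_K -> 'I_K).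
Hypotheses (PF : is_pmt F) (PG : is_pmt G) (cFG : conjd F G h kap).

Lemma conjd_mob w q : reach F setT w q ->
  reach G setT (map kap w) (h q) /\
  h (mob (Mw (mat F) w) q) = mob (Mw (mat G) (map kap w)) (h q).
Proof.
move=> rq; have : reach F [set mob (Mw (mat F) w) q] w q by apply/(reach_iff PF).
move=> /(conjd_reach cFG) /(reach_iff PG) [h1 [x /= -> ->]]; split=> //.
Qed.

End Conj.

(** Modulus 1 covers elliptic, parabolic and identity-type cycles together. The conjugacy sends x to
    a fixed point of some word of length n, and all of these have been made loxodromic; small
    complete orbits are carried along, against [lox_biorb]. *)
Lemma no_neutral F n w x l : is_pmt F -> struct_stable F -> (0 < n)%N -> size w = n ->
  reach F setT w x -> mob (Mw (mat F) w) x = x ->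
  apm (Mw (mat F) w) (uv x) = scv l (uv x) -> nrm l = 1 -> False.
Proof.
move=> PF SF n0 sw rx fx el l1.
have [e e0 he] := goodpush_id PF SF.
have [B [dB nB lB]] := generic_words (mat_det PF) n0 e0.
have [PG [h [kap cFG]]] := he B dB nB.
set G := push F id B in PG cFG.
have [rG eG] := conjd_mob PF PG cFG rx.
set M' := Mw (mat G) (map kap w) in eG.
have dM' : \det M' = 1 by apply: det_Mw.
have lM' : lox M' by apply: lB; rewrite size_map.
have [l' [u [v ed]]] := lox_eigd dM' lM'.
have fM' : mob M' (h x) = h x by rewrite -eG fx.
have [e1 e10 he1] := lox_biorb dM' ed fM'; apply: he1.
case: (cFG) => -[g [hg gh ch cg]] _ _ _.
have [d d0 hd] := ch x e1 e10.
have [d2 d20 hd2] := reach_stable PF rx.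
have d3 : 0 < Num.min d d2 by rewrite lt_min d0.
have dM : \det (Mw (mat F) w) = 1 by apply: det_Mw; exact: mat_det.
have [f [g' [fg0 nf hs hc]]] := neutral_biorb dM el l1 d3.
have near q : chord x q < Num.min d d2 ->
  chord (h x) (h q) < e1 /\ h (mob (Mw (mat F) w) q) = mob M' (h q).
  rewrite lt_min => /andP[/hd h1 h2]; split=> //.
  have rq : reach F setT w q.
    apply: hd2 => //; first exact: mat_det.
      by move=> k; rewrite subrr /mn !mxE nrm0 !addr0.
    by move=> k z; apply; rewrite chordzz.
  by have [] := conjd_mob PF PG cFG rq.
exists (h \o f), (h \o g'); split=> /=.
- by rewrite fg0.
- by move=> /(can_inj hg).
- move=> i; have [-> e2] := hs i; have [c1 c2] := hc i; have [_ c4] := hc i.+1.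
  by have [_ ->] := near _ c1; rewrite {1}e2; have [_ ->] := near _ c4.
by move=> i; have [c1 c2] := hc i; have [? _] := near _ c1; have [? _] := near _ c2.
Qed.

Lemma periodic_word F n z : is_pmt F -> periodic_pt F n z -> exists w,
  [/\ size w = n, reach F setT w z, mob (Mw (mat F) w) z = z &
   mult F n z = multiplier (Mw (mat F) w) z].
Proof.
move=> PF [n0 hR fz].
have [w sw rw] := Fn_reach PF (n := n) (q := z) (fun j _ => hR j).
have [e1 _ _ e4] := reach_Fn PF rw; exists w.
have e2 : mob (Mw (mat F) w) z = z by rewrite -e1 sw.
have e3 : mult F n z = multiplier (Mw (mat F) w) z by rewrite /mult -e4 sw.
exact: (And4 sw rw e2 e3).
Qed.

Lemma mult_eig F n z : is_pmt F -> periodic_pt F n z -> exists w l,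
  [/\ size w = n, reach F setT w z, mob (Mw (mat F) w) z = z,
   apm (Mw (mat F) w) (uv z) = scv l (uv z) & mult F n z = l^-1 ^+ 2 /\ l != 0].
Proof.
move=> PF pz; have [w [sw rw fw ew]] := periodic_word PF pz.
have dM : \det (Mw (mat F) w) = 1 by apply: det_Mw; exact: mat_det.
have [l l0 el] := fix_eig dM fw; exists w, l.
have e : mult F n z = l^-1 ^+ 2 by rewrite ew; apply: (multiplier_eig dM (uv_nz z) el); rewrite uvK.
exact: (And5 sw rw fw el (conj e l0)).
Qed.

Lemma nrm_sqr1 (l : C) : nrm (l ^+ 2) = 1 -> nrm l = 1.
Proof. by rewrite nrmX => /eqP; rewrite pexpr_eq1 ?nrm_ge0 // => /eqP. Qed.

Lemma nrm_inv1 (l : C) : nrm l^-1 = 1 -> nrm l = 1.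
Proof. by rewrite nrmV => /eqP; rewrite invr_eq1 => /eqP. Qed.

Lemma stable_mult_neq1 F n z : is_pmt F -> struct_stable F -> periodic_pt F n z ->
  nrm (mult F n z) <> 1.
Proof.
move=> PF SF pz h; have [n0 _ _] := pz.
have [w [l [sw rw fw el [em l0]]]] := mult_eig PF pz.
by apply: (no_neutral PF SF n0 sw rw fw el); apply: nrm_inv1; apply: nrm_sqr1; rewrite -em.
Qed.

(** If the return map is the identity on a ball, the matrix of the word is plus or minus the
    identity, so its eigenvalue has modulus 1. *)
Lemma stable_no_identity F n z : is_pmt F -> struct_stable F -> ~ identity_type F n z.
Proof.
move=> PF SF [pz [e e0 he]]; have [n0 _ _] := pz.
have [w [l [sw rw fw el [em l0]]]] := mult_eig PF pz.
have dM : \det (Mw (mat F) w) = 1 by apply: det_Mw; exact: mat_det.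
have [d2 d20 hd2] := reach_stable PF rw.
have [||w' hw'|l' l'0 eM] := @mob_agree R 1%:M (Mw (mat F) w) (sball z (Num.min e d2)) (det1 _ _).
- move=> y; rewrite /sball /= => hy.
  have p : 0 < Num.min e d2 - chord z y by rewrite subr_gt0.
  exists (Num.min e d2 - chord z y) => // x; rewrite /sball /= => hx.
  have := chord_tri y z x; lra.
- by exists z; rewrite /sball /= chordzz lt_min e0.
- move: hw'; rewrite /sball /= lt_min => /andP[/he[_ h1] h2].
  rewrite mob1; have rq : reach F setT w w'.
    apply: hd2 => //; first exact: mat_det.
      by move=> k; rewrite subrr /mn !mxE nrm0 !addr0.
    by move=> k y; apply; rewrite chordzz.
  by have [<- _ _ _] := reach_Fn PF rq; rewrite sw h1.
have ll : l' ^+ 2 = 1 by rewrite -dM eM detZ det1 mulr1.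
apply: (no_neutral PF SF n0 sw rw fw (l := l')).
  rewrite eM /apm !mxE /= !mulr1n !mulr0n !mulr1 !mulr0 !mul0r addr0 add0r //.
by apply: nrm_sqr1; rewrite ll nrm1.
Qed.

End NoNeutral.

(** * Ghost-periodic points *)

Section Conjugate.
Variables (R : realType) (K : nat).
Notation C := (Cplx R).
Notation M2 := 'M[C]_2.
Notation mats := ('I_K -> M2).
Notation o0 := (ord0 : 'I_2).
Notation o1 := (ord_max : 'I_2).
Implicit Types (F G : pmt R K) (z q : sphere R) (k : 'I_K) (w v : seq 'I_K) (S M : M2).

(** Up to the change of coordinates S, keeping the regions and conjugating the matrices is keeping
    the matrices and moving all regions by S. *)
Definition cj S M := inv2 S *m M *m S.

Lemma det_cj S M : \det S = 1 -> \det M = 1 -> \det (cj S M) = 1.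
Proof. by move=> dS dM; rewrite !det_mul1 // det_inv2. Qed.

Lemma mob_cj S M z : \det S = 1 -> \det M = 1 ->
  mob (cj S M) z = mob (inv2 S) (mob M (mob S z)).
Proof. by move=> dS dM; rewrite /cj !mobM ?det_mul1 ?det_inv2. Qed.

Lemma Mw_cj S (A : mats) w : \det S = 1 -> Mw (fun k => cj S (A k)) w = cj S (Mw A w).
Proof.
move=> dS; elim: w => [|k w IH] /=; first by rewrite /cj mulmx1 mulVm.
by rewrite IH /cj !mulmxA -(mulmxA _ S) mulmV // mulmx1.
Qed.

Lemma cj_near (A : mats) (e : R) : 0 < e -> exists2 d : R, 0 < d & forall S,
  mn (S - 1%:M) < d -> forall k, mn (cj S (A k) - A k) < e.
Proof.
move=> e0; have [||d d0 hd] := @fin_pos R 'I_K (fun k (d : R) => forall S,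
  mn (S - 1%:M) < d -> mn (cj S (A k) - A k) < e).
- by move=> k d d' h _ le S hS; apply: h; apply: lt_le_trans le.
- move=> k; set m := mn (A k); have m0 : 0 <= m by exact: mn_ge0.
  exists (Num.min 1 (e / (4 * m + 1))).
    by rewrite lt_min ltr01 divr_gt0 //; lra.
  move=> S; rewrite lt_min ltr_pdivlMr; last by lra.
  move=> /andP[h1 h2].
  have -> : cj S (A k) - A k = (inv2 S - inv2 1%:M) *m A k *m S + A k *m (S - 1%:M).
    have -> : inv2 (1%:M : M2) = 1%:M.
      by apply: eq_mx2; rewrite mk2E !mxE /= ?oppr0.
    by rewrite /cj !mulmxBl !mulmxBr !mulmx1 mul1mx addrA subrK.
  have hS : mn S <= 3.
    have := mnD (S - 1%:M) 1%:M; rewrite subrK mn1; lra.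
  have n1 := mnM ((inv2 S - inv2 1%:M) *m A k) S.
  have n2 := mnM (inv2 S - inv2 1%:M) (A k).
  have n3 := mnM (A k) (S - 1%:M).
  rewrite inv2B mn_inv2 -/m in n1 n2 n3.
  apply: le_lt_trans (mnD _ _) _; rewrite inv2B.
  have p := mn_ge0 (S - 1%:M); have p2 := mn_ge0 (inv2 (S - 1%:M) *m A k).
  have : mn (inv2 (S - 1%:M) *m A k) * mn S <= mn (S - 1%:M) * m * 3.
    by apply: ler_pM => //; rewrite mn_ge0.
  lra.
by exists d => // S hS k; exact: hd.
Qed.

Lemma fix_fin M : (exists z, mob M z <> z) -> exists L : seq (sphere R),
  forall z, mob M z = z -> z \in L.
Proof.
move=> [z0 hz0]; apply: contrapT => h.
have pk (s : seq (sphere R)) : exists x : C, Some x \notin s /\ mob M (Some x) = Some x.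
  apply: contrapT => h2; apply: h; exists (None :: s) => z fz.
  rewrite inE; case: z fz => [x|] // fx; apply/orP; right; apply: contrapT => /negP xs.
  by apply: h2; exists x.
have [x1 [_ f1]] := pk [::].
have [x2 [s2 f2]] := pk [:: Some x1].
have [x3 [s3 f3]] := pk [:: Some x1; Some x2].
have eqn (x : C) : mob M (Some x) = Some x ->
  M o1 o0 * x ^+ 2 + (M o1 o1 - M o0 o0) * x + - M o0 o1 = 0 /\ M o1 o0 * x + M o1 o1 != 0.
  rewrite /=; case: eqVneq => // nz [e]; split=> //.
  have {}e : M o0 o0 * x + M o0 o1 = x * (M o1 o0 * x + M o1 o1) by rewrite -{2}e divfK.
  transitivity (x * (M o1 o0 * x + M o1 o1) - (M o0 o0 * x + M o0 o1)); first ring.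
  by rewrite e subrr.
have [E1 nz] := eqn _ f1; have [E2 _] := eqn _ f2; have [E3 _] := eqn _ f3.
have x12 : x1 != x2 by apply: contra s2 => /eqP ->; rewrite inE eqxx.
have x13 : x1 != x3 by apply: contra s3 => /eqP ->; rewrite !inE eqxx.
have x23 : x2 != x3 by apply: contra s3 => /eqP ->; rewrite !inE eqxx orbT.
have [c0 da b0] := quad3 x12 x13 x23 E1 E2 E3.
have {}b0 : M o0 o1 = 0 by apply/eqP; rewrite -oppr_eq0 b0.
have {}da : M o1 o1 = M o0 o0 by apply/eqP; rewrite -subr_eq0 da.
apply: hz0; move: nz; case: z0 => [y|] /=; rewrite c0 ?eqxx // b0 da !mul0r !add0r addr0.
by move=> nz; rewrite (negbTE nz) mulrAC divff // mul1r.
Qed.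

(** Points are treated one at a time. Since R(F) is open, the parameters that are good for the
    earlier points survive a small correction, and corrections add up because all transvections
    share the fixed point a. *)
Lemma tv_avoid F a (Y : seq (sphere R)) (e : R) : is_pmt F -> a \notin Y -> 0 < e ->
  exists t : C, nrm t < e /\ forall y, y \in Y -> Rset F (mob (tv a t) y).
Proof.
move=> PF aY e0.
suff [t [ht [d d0 hd]]] : exists t : C, nrm t < e /\ exists2 d : R, 0 < d &
  forall t', nrm (t' - t) < d -> forall y, y \in Y -> Rset F (mob (tv a t') y).
  by exists t; split=> //; apply: hd; rewrite subrr nrm0.
elim: Y aY => [|y Y IH] aY; first by exists 0; rewrite nrm0; split=> //; exists 1.
move: aY; rewrite inE negb_or => /andP[ay /IH[t1 [ht1 [d1 d10 hd1]]]].
have ay1 : a != mob (tv a t1) y.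
  apply/eqP => h; case/eqP: ay; apply: (mob_inj (det_tv a t1)).
  by rewrite -h mob_tv_fix.
have e1 : 0 < Num.min (e - nrm t1) (d1 / 2) by rewrite lt_min subr_gt0 ht1 divr_gt0.
have [d2 d20 hd2] := tv_small ay1 e1.
have [y' Ry' cy'] := Rset_dense PF (mob (tv a t1) y) d20.
have [t [ht et]] := hd2 _ y' (eq_ind_r (fun r => r < d2) d20 (chordzz (mob (tv a t1) y))) cy'.
rewrite -mobM ?det_tv // tvD in et.
move: ht; rewrite lt_min => /andP[h1 h2].
have [e3 e30 he3] := Rset_open PF Ry'.
exists (t + t1); split; first by apply: le_lt_trans (nrmD _ _) _; lra.
have p : 0 < mn (tv a (t + t1)) + 1 by rewrite ltr_wpDl // mn_ge0.
exists (Num.min (d1 / 2) (e3 / (8 * (mn (tv a (t + t1)) + 1)))).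
  by rewrite lt_min !divr_gt0 // mulr_gt0.
move=> t'; rewrite lt_min => /andP[k1 k2] x.
rewrite ltr_pdivlMr ?mulr_gt0 // in k2.
rewrite inE => /orP[/eqP ->|xY]; last first.
  apply: hd1 => //; have -> : t' - t1 = (t' - (t + t1)) + t by ring.
  apply: le_lt_trans (nrmD _ _) _; lra.
apply: he3; rewrite /sball /= -et.
apply: le_lt_trans (mob_near _ (det_tv _ _) (det_tv _ _)) _.
have := mn_tvB a (t + t1) t'; rewrite nrmBC.
have := nrm_ge0 (t' - (t + t1)); have := mn_ge0 (tv a (t + t1)).
have := mn_ge0 (tv a (t + t1) - tv a t').
set m := mn (tv a (t + t1)) in p k2 *; set m2 := mn _; set x' := nrm _ in k2 *.
move=> a1 a2 a3 a4; have : m2 * m <= 4 * x' * m by apply: ler_wpM2r.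
nra.
Qed.

Lemma mn_tv1 a (t : C) : mn (tv a t - 1%:M) <= 4 * nrm t.
Proof. by have := mn_tvB a t 0; rewrite tv0 subr0. Qed.

Lemma notin_ex (s : seq (sphere R)) : exists a, a \notin s.
Proof. by have [a ? _] := @near_avoid R None s 1 ltr01; exists a. Qed.

Lemma reach_conflict F v u z : is_pmt F -> reach F (Bset F) v z -> reach F setT u z ->
  (size u <= size v)%N.
Proof.
move=> PF; elim: v u z => [|k v IH] [|j u] z //=.
  by move=> /(BsetE PF) nR [rj _]; case: nR; exists j.
by move=> [rk rv] [rj ru]; rewrite ltnS; apply: IH rv _; rewrite (reg_uniq PF rk rj).
Qed.

Lemma lim_fix M z z0 : \det M = 1 -> sconv (fun n => iter n (mob M) z) z0 -> mob M z0 = z0.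
Proof.
move=> dM cv; apply/eqP; rewrite -chord_eq0; apply/eqP/le_anti; rewrite chord_ge0 andbT leNgt.
apply/negP => h; have h2 : 0 < chord (mob M z0) z0 / 2 by rewrite divr_gt0.
have [d d0 hd] := scont_mob dM z0 h2.
have [N1 hN1] := cv d d0; have [N2 hN2] := cv _ h2.
have := hN1 (maxn N1 N2) (leq_maxl _ _); rewrite chordC => /hd h3.
have := hN2 (maxn N1 N2).+1 (leqW (leq_maxr _ _)) => /= h4.
have := chord_tri (mob M (iter (maxn N1 N2) (mob M) z)) (mob M z0) z0; lra.
Qed.

(* A ghost-periodic point without reference to regular components; unlike the latter, it can be followed under perturbation. *)
Definition wghost F (n N : nat) := exists w v z z0,
  [/\ size w = n, size v = N, forall m, reach F setT (flatten (nseq m w)) z,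
      sconv (fun m => iter m (mob (Mw (mat F) w)) z) z0 & reach F (Bset F) v z0].

Lemma Mw_nseq (A : mats) w m z : (forall k, \det (A k) = 1) ->
  mob (Mw A (flatten (nseq m w))) z = iter m (mob (Mw A w)) z.
Proof.
move=> dA; elim: m z => [|m IH] z; first by rewrite /= mob1.
by rewrite /= Mw_cat mobM ?det_Mw // IH -iterSr.
Qed.

Lemma map_nseq_flat (f : 'I_K -> 'I_K) m w :
  map f (flatten (nseq m w)) = flatten (nseq m (map f w)).
Proof. by elim: m => //= m IH; rewrite map_cat IH. Qed.

Lemma wghost_conj F G h kap n N : is_pmt F -> is_pmt G -> conjd F G h kap ->
  wghost F n N -> wghost G n N.
Proof.
move=> PF PG cFG [w [v [z [z0 [sw sv rw cv rv]]]]].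
have [[g [hg gh ch cg]] _ _ _] := cFG.
exists (map kap w), (map kap v), (h z), (h z0); rewrite !size_map; split=> //.
- by move=> m; rewrite -map_nseq_flat; have [] := conjd_mob PF PG cFG (rw m).
- move=> e e0; have [d d0 hd] := ch z0 e e0; have [n0 hn0] := cv d d0.
  exists n0 => m /hn0; rewrite chordC => /hd; rewrite chordC.
  rewrite -!Mw_nseq; [|exact: mat_det|exact: mat_det].
  by rewrite -map_nseq_flat; have [_ ->] := conjd_mob PF PG cFG (rw m).
have := conjd_reach cFG rv; apply: reachS => _ [x Bx <-]; exact: (conjd_B PF PG cFG).
Qed.

Lemma Rset_push_id F (A : mats) : Rset (push F id A) = Rset F.
Proof.
apply/seteqP; split=> z [k]; first by move=> [x rx <-]; exists k.
by move=> rk; exists k; exists z.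
Qed.

(** The words of the conjugate ghost are unknown apart from their lengths, so the images of fixed
    points are moved into R(F) for all pairs of words of lengths n and N. *)
Lemma no_wghost F n N : is_pmt F -> struct_stable F -> (0 < n)%N -> ~ wghost F n N.
Proof.
move=> PF SF n0 gF.
have [e e0 he] := goodpush_id PF SF.
have [d d0 hd] := cj_near (mat F) e0.
have dF := mat_det PF.
have /choice[L hL] : forall p : n.-tuple 'I_K * N.-tuple 'I_K, exists L : seq (sphere R),
    (exists z, mob (Mw (mat F) p.1) z <> z) ->
    forall z, mob (Mw (mat F) p.1) z = z -> mob (Mw (mat F) p.2) z \in L.
  move=> [w v] /=; case: (pselect (exists z, mob (Mw (mat F) w) z <> z)) => h; last by exists [::].
  have [L hL] := fix_fin h; exists (map (mob (Mw (mat F) v)) L) => _ z /hL; exact: map_f.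
(* All landing points: images under words of length N of the fixed points of non-identity words of
   length n. *)
pose Y := flatten [seq L p | p <- enum {: n.-tuple 'I_K * N.-tuple 'I_K}].
have [a aY] := notin_ex Y.
have [t [ht hY]] := tv_avoid PF aY (divr_gt0 d0 (ltr0n _ 4)).
set S := tv a (- t).
have dS : \det S = 1 by exact: det_tv.
have [||PG [h [kap cFG]]] := he (fun k => cj S (mat F k)).
- by move=> k; apply: det_cj.
- apply: hd; apply: le_lt_trans (mn_tv1 _ _) _; rewrite nrmN; lra.
have [w [v [z [z0 [sw sv rw cv rv]]]]] := wghost_conj PF PG cFG gF.
set G := push _ _ _ in PG rw rv cv cFG.
have dG := mat_det PG.
have fz0 := lim_fix (det_Mw w dG) cv.
have eM u : Mw (mat G) u = cj S (Mw (mat F) u) by rewrite /G /= Mw_cj.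
(* If w acted as the identity, then z0 = z, which has arbitrarily long itineraries and cannot reach
   B(G). *)
have nid : exists y, mob (Mw (mat F) w) y <> y.
  apply: contrapT => hn.
  have zz : z0 = z.
    apply/eqP; rewrite -chord_eq0; apply/eqP/le_anti; rewrite chord_ge0 andbT leNgt.
    apply/negP => /cv[n1 /(_ n1 (leqnn _))]; rewrite chordC.
    suff -> : iter n1 (mob (Mw (mat G) w)) z = z by rewrite ltxx.
    elim: n1 => //= n1 ->; rewrite eM mob_cj ?det_Mw //.
    have -> : mob (Mw (mat F) w) (mob S z) = mob S z.
      by apply: contrapT => h'; apply: hn; exists (mob S z).
    by rewrite mobK.
  have := reach_conflict PG rv; rewrite zz => /(_ _ (rw N.+1)).
  rewrite size_flatten /shape map_nseq sumn_nseq sw sv leqNgt => /negP; apply.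
  by rewrite -{1}(mul1n N.+1) leq_mul2r n0 orbT.
have szw : size w == n by rewrite sw.
have szv : size v == N by rewrite sv.
have fS : mob (Mw (mat F) w) (mob S z0) = mob S z0.
  rewrite -{2}fz0 eM mob_cj ?det_Mw // mobVK //.
(* [mob S z0] is fixed by the unperturbed word, so its image under v lies in Y and [inv2 S] carries
   it into R(F), although the orbit of z0 has to end on B(G). *)
have inY : mob (Mw (mat F) v) (mob S z0) \in Y.
  apply/flattenP; exists (L (Tuple szw, Tuple szv)); first by apply: map_f; rewrite mem_enum.
  exact: (hL (Tuple szw, Tuple szv)).
have := hY _ inY; rewrite -(Rset_push_id F (mat G)).
have [_ rB] := proj1 (reach_iff PG _ _ _) rv.
move: rB; rewrite eM mob_cj ?det_Mw // inv2_tv opprK => /(BsetE PG).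
by [].
Qed.

End Conjugate.

(** * Hyperbolicity when the regular set is nonempty *)

Section Regular.
Variables (R : realType) (K : nat).
Notation C := (Cplx R).
Notation M2 := 'M[C]_2.
Notation mats := ('I_K -> M2).
Notation o0 := (ord0 : 'I_2).
Notation o1 := (ord_max : 'I_2).
Implicit Types (F G : pmt R K) (z q x y : sphere R) (k : 'I_K) (w v s : seq 'I_K) (S M : M2).

Lemma eigd_of_eig M (l : C) (v : vect R) : \det M = 1 -> nzv v -> apm M v = scv l v -> nrm l < 1 -> l != 0 ->
  exists u, eigd M l^-1 u v.
Proof.
move=> dM v0 ev l1 l0; set t := M o0 o0 + M o1 o1.
have hl : l * (t - l) = 1.
  have D : (M o0 o0 - l) * (M o1 o1 - l) - M o0 o1 * M o1 o0 = 0.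
    move: ev v0; case: v => v1 v2; rewrite /apm /scv /nzv xpair_eqE /= => -[e1 e2].
    have {}e1 : (M o0 o0 - l) * v1 + M o0 o1 * v2 = 0 by rewrite mulrBl -e1; ring.
    have {}e2 : M o1 o0 * v1 + (M o1 o1 - l) * v2 = 0 by rewrite mulrBl -e2; ring.
    case: (eqVneq v1 0) => [v10|v10] /=.
      move=> v20; apply: (mulIf v20); rewrite mul0r.
      transitivity ((M o0 o0 - l) * (M o1 o0 * v1 + (M o1 o1 - l) * v2) -
         M o1 o0 * ((M o0 o0 - l) * v1 + M o0 o1 * v2)); first ring.
      by rewrite e1 e2 !mulr0 subrr.
    move=> _; apply: (mulIf v10); rewrite mul0r.
    transitivity ((M o1 o1 - l) * ((M o0 o0 - l) * v1 + M o0 o1 * v2) -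
       M o0 o1 * (M o1 o0 * v1 + (M o1 o1 - l) * v2)); first ring.
    by rewrite e1 e2 !mulr0 subrr.
  have := det2 M; rewrite dM => dM'; rewrite dM' -[LHS]addr0 -D /t; ring.
have li : l^-1 = t - l by apply: (mulfI l0); rewrite mulfV.
have [|u u0 eu] := @eigvec _ M l^-1 dM.
  by rewrite -/t {2}li opprB addrCA subrr addr0 mulVf.
exists u; split; rewrite ?invrK //.
  rewrite wdg_eq0 //; apply/eqP => e.
  have [k k0 ek] := pt_vec u0; have [k' k'0 ek'] := pt_vec v0.
  have uv : u = scv (k / k') v by rewrite ek ek' e /scv /=; congr pair; field.
  have : scv l^-1 u = scv l u.
    by rewrite -eu uv apm_scv ev !scvA mulrC.
  move/(congr1 (@hn R)); rewrite !hn_scv nrmV.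
  have hu : hn u != 0 by rewrite gt_eqF // hn_gt0.
  move=> /(mulIf hu) h; have : 1 < (nrm l)^-1 by rewrite invf_gt1 // nrm_gt0.
  by rewrite h => h'; have := lt_trans l1 h'; rewrite ltxx.
by rewrite nrmV invf_gt1 // nrm_gt0.
Qed.

Lemma sconv_unique (u : nat -> sphere R) x y : sconv u x -> sconv u y -> x = y.
Proof.
move=> cx cy; apply/eqP; rewrite -chord_eq0; apply/eqP/le_anti; rewrite chord_ge0 andbT leNgt.
apply/negP => h; have h2 : 0 < chord x y / 2 by rewrite divr_gt0.
have [n1 h1] := cx _ h2; have [n2 h3] := cy _ h2.
have := h1 (maxn n1 n2) (leq_maxl _ _); have := h3 (maxn n1 n2) (leq_maxr _ _).
have := chord_tri (u (maxn n1 n2)) x y; rewrite (chordC x (u _)); lra.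
Qed.

Lemma Rcal_ball F z : is_pmt F -> Rcal F z -> exists2 r : R, 0 < r & forall y, chord z y < r ->
  forall n, exists2 s, size s = n & reach F setT s y.
Proof.
move=> PF; rewrite /Rcal /Bcal /setC /sclosure /= => /existsNP[r /not_implyP[r0 h]].
exists r => // y hy n; apply: Fn_reach => // j _.
elim/ltn_ind: j => j IH; apply: contrapT => /(BsetE PF) hB; apply: h; exists y; split=> //.
by exists j; split=> // i /IH.
Qed.

Lemma ball_Rcal F z (r : R) : is_pmt F -> 0 < r ->
  (forall y, chord z y < r -> forall n, exists2 s, size s = n & reach F setT s y) -> Rcal F z.
Proof.
move=> PF r0 h cz; have [y [[n hn] zy]] := cz r r0.
have [v sv rv] := proj1 (preimg_reach PF _ _ _) hn.
have [s ss rs] := h y zy n.+1.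
by have := reach_conflict PF rv rs; rewrite ss sv ltnn.
Qed.

Lemma reach_take F X (v s : seq 'I_K) z : reach F X (v ++ s) z -> reach F setT v z.
Proof. by move=> /reach_cat; apply: reachS. Qed.

Lemma reach_split F v s z : is_pmt F -> reach F setT (v ++ s) z ->
  reach F setT v z /\ reach F setT s (mob (Mw (mat F) v) z).
Proof. by move=> PF /reach_cat /(reach_iff PF). Qed.

Lemma reach_join F v s z : is_pmt F -> reach F setT v z ->
  reach F setT s (mob (Mw (mat F) v) z) -> reach F setT (v ++ s) z.
Proof. by move=> PF h1 h2; apply/reach_cat/(reach_iff PF). Qed.

Lemma reach_rcons F v k z : is_pmt F -> reach F setT v z ->
  reg F k (mob (Mw (mat F) v) z) -> reach F setT (rcons v k) z.
Proof. by move=> PF h1 h2; rewrite -cats1; apply: reach_join. Qed.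

Lemma reach_last F n z v : is_pmt F -> size v = n ->
  (exists2 s, size s = n.+1 & reach F setT s z) -> reach F setT v z ->
  Rset F (mob (Mw (mat F) v) z).
Proof.
move=> PF sv [s ss rs] rv; case/lastP: s ss rs => [|s k] //.
rewrite size_rcons => -[ss]; rewrite -cats1 => /(reach_split PF)[rs [rk _]].
by exists k; rewrite (reach_uniq PF _ rv rs) // sv.
Qed.

Lemma conn_itin F (V : set (sphere R)) z n : is_pmt F -> sconnected V -> V z ->
  (forall y, V y -> forall n, exists2 s, size s = n & reach F setT s y) ->
  exists2 s, size s = n & forall y, V y -> reach F setT s y.
Proof.
move=> PF cV Vz hV; elim: n => [|n [s ss hs]]; first by exists [::].
have [k rk] := reach_last PF ss (hV z Vz n.+1) (hs z Vz).
exists (rcons s k); first by rewrite size_rcons ss.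
move=> y Vy; apply: (reach_rcons PF (hs y Vy)).
have dM : \det (Mw (mat F) s) = 1 by apply: det_Mw; exact: mat_det.
apply: (connected_reg PF (sconnected_image (scont_mob dM) cV) _ _ rk).
- by move=> _ [x Vx <-]; apply: (reach_last PF ss (hV x Vx n.+1) (hs x Vx)).
- by exists z.
by exists y.
Qed.

Lemma path_itin F (g : R -> sphere R) s : is_pmt F -> rcont g ->
  (forall t, 0 <= t <= 1 -> forall n, exists2 s, size s = n & reach F setT s (g t)) ->
  reach F setT s (g 0) -> forall t, 0 <= t <= 1 -> reach F setT s (g t).
Proof.
move=> PF; elim: s g => [|k s IH] g cg hg //= [rk rs] t ht; split.
  apply: (path_reg PF cg) rk _ ht => t' /hg /(_ 1%N)[[|j [|? ?]] //= _ [rj _]]; by exists j.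
have rk' : forall t, 0 <= t <= 1 -> reg F k (g t).
  by apply: (path_reg PF cg) rk => t' /hg /(_ 1%N)[[|j [|? ?]] //= _ [rj _]]; exists j.
apply: (IH (fun t => mob (mat F k) (g t))) => //.
  move=> t' e e0; have [d d0 hd] := scont_mob (mat_det PF k) (g t') e0.
  by have [d' d'0 hd'] := cg t' d d0; exists d' => // t'' /hd' /hd.
move=> t' ht' n; have [[|j s'] //= [ss] [rj rs']] := hg t' ht' n.+1.
by exists s' => //; rewrite (reg_uniq PF (rk' t' ht') rj).
Qed.

(** Points near z are joined to z by a transvection path inside the ball, along which no itinerary
    can change. *)
Lemma ball_itin F z (r : R) : is_pmt F -> 0 < r ->
  (forall y, chord z y < r -> forall n, exists2 s, size s = n & reach F setT s y) ->
  exists2 d : R, 0 < d & forall y s, chord z y < d -> reach F setT s z -> reach F setT s y.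
Proof.
move=> PF r0 hr; have [a az] := other_pt z.
have [d d0 hd] := tv_small az (divr_gt0 r0 (ltr0n _ 16)).
exists d => // y s zy rs.
have [t [ht ety]] := hd z y (eq_ind_r (fun u => u < d) d0 (chordzz z)) zy.
have pc : rcont (fun u => mob (tv a (u%:C%C * t)) z).
  by apply: rcont_mob; [exact: mcont_tv | move=> u; exact: det_tv].
have := @path_itin F _ s PF pc; rewrite mul0r tv0 mob1 => /(_ _ rs 1).
rewrite rmorph1 mul1r ety; apply; last by rewrite ler01 lexx.
move=> u /andP[u0 u1] n; apply: hr; apply: le_lt_trans (tv_near _ _ _) _.
rewrite nrmM nrm_real ger0_norm //; have := nrm_ge0 t; nra.
Qed.

(** The component is the union of all connected subsets of A containing z. Connectedness of such
    unions and maximality both come from sets that share a point. *)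
Lemma comp_exists (A : set (sphere R)) z : A z -> exists2 U, component A U & U z.
Proof.
move=> Az; pose U : set (sphere R) := [set y | exists V, [/\ V `<=` A, sconnected V, V z & V y]].
have Uz : U z.
  exists [set z]; split=> //; first by move=> _ ->.
  move=> P Q e [p Pp] [q Qq] PQ _.
  have pz : p = z by have : (P `|` Q) p by [left]; rewrite -e.
  have qz : q = z by have : (P `|` Q) q by [right]; rewrite -e.
  have : (sclosure P `&` Q) z by split; [apply: sclosure_sub; rewrite -pz | rewrite -qz].
  by rewrite PQ.
have cU (W : set (sphere R)) : (forall y, W y -> exists V, [/\ V `<=` W, sconnected V, V z & V y]) ->
    sconnected W.
  move=> hW.
  have key P Q : W = P `|` Q -> sclosure P `&` Q = set0 -> P `&` sclosure Q = set0 ->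
      P z -> Q !=set0 -> False.
    move=> e PQ QP Pz [q Qq].
    have Wq : W q by rewrite e; right.
    have [V [VW cV Vz Vq]] := hW q Wq.
    apply: (cV (V `&` P) (V `&` Q)).
    - apply/seteqP; split=> [y Vy|y [[]|[]]//].
      by have := VW y Vy; rewrite e => -[?|?]; [left|right].
    - by exists z.
    - by exists q.
    - apply/seteqP; split=> // y [cy [_ Qy]].
      have : (sclosure P `&` Q) y by split=> //; apply: sclosureS cy => ? [].
      by rewrite PQ.
    apply/seteqP; split=> // y [[_ Py] cy].
    have : (P `&` sclosure Q) y by split=> //; apply: sclosureS cy => ? [].
    by rewrite QP.
  move=> P Q e [p Pp] [q Qq] PQ QP.
  have Wp : W p by rewrite e; left.
  have [V [VW _ Vz _]] := hW p Wp; have := VW z Vz; rewrite e => -[Pz|Qz].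
    by apply: (key P Q e PQ QP Pz); exists q.
  apply: (key Q P _ _ _ Qz); first by rewrite setUC.
  - by rewrite setIC.
  - by rewrite setIC.
  by exists p.
exists U => //; split.
- by move=> y [V [VA _ _ /VA]].
- by exists z.
- apply: cU => y [V [VA cV Vz Vy]]; exists V; split=> // x Vx; by exists V.
move=> V VA cV [u [[W [WA cW Wz Wu]] Vu]] y Vy.
exists (W `|` V); split; last by right.
- by move=> x [/WA|/VA].
- have key (X : set (sphere R)) : sconnected X -> forall P Q, X `<=` P `|` Q ->
      sclosure P `&` Q = set0 -> P `&` sclosure Q = set0 -> forall x x', X x -> P x -> X x' -> Q x' -> False.
    move=> cX P Q XPQ PQ QP x x' Xx Px Xx' Qx'.
    apply: (cX (X `&` P) (X `&` Q)).
    + apply/seteqP; split=> [t Xt|t [[]|[]]//].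
      by have := XPQ t Xt => -[?|?]; [left|right].
    + by exists x.
    + by exists x'.
    + apply/seteqP; split=> // t [ct [_ Qt]].
      have : (sclosure P `&` Q) t by split=> //; apply: sclosureS ct => ? [].
      by rewrite PQ.
    apply/seteqP; split=> // t [[_ Pt] ct].
    have : (P `&` sclosure Q) t by split=> //; apply: sclosureS ct => ? [].
    by rewrite QP.
  move=> P Q e [p Pp] [q Qq] PQ QP.
  have sW : W `<=` P `|` Q by rewrite -e; left.
  have sV : V `<=` P `|` Q by rewrite -e; right.
  have kW := key W cW P Q sW PQ QP; have kV := key V cV P Q sV PQ QP.
  have hp : (W `|` V) p by rewrite e; left.
  have hq : (W `|` V) q by rewrite e; right.
  have [Pu|Qu] := sW u Wu.
    by case: hq => ?; [apply: (kW u q) | apply: (kV u q)].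
  by case: hp => ?; [apply: (kW p u) | apply: (kV p u)].
by left.
Qed.

(** All points of V share their itineraries. Since x and its p-th iterate both lie in V, this common
    itinerary equals its own shift by p, that is, it has period p. *)
Lemma conn_periodic F (V : set (sphere R)) x p : is_pmt F -> sconnected V ->
  (forall y, V y -> forall n, exists2 s, size s = n & reach F setT s y) ->
  V x -> V (Fn F p x) ->
  exists2 w, size w = p & forall y, V y -> forall m, reach F setT (flatten (nseq m w)) y.
Proof.
move=> PF cV real Vx Vy.
have itin j : exists2 s, size s = j & forall y, V y -> reach F setT s y.
  exact: (conn_itin _ PF cV Vx).
have [w sw hw] := itin p; exists w => // y Vy' j; elim: j y Vy' => [|j IH] y Vy' //=.
have [s ss hs] := itin (size w + size (flatten (nseq j w)))%N.
suff <- : s = w ++ flatten (nseq j w) by apply: hs.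
apply: (reach_uniq PF _ (hs x Vx)); first by rewrite ss size_cat.
apply: (reach_join PF (hw x Vx)); apply: IH.
by have [<- _ _ _] := reach_Fn PF (hw x Vx); rewrite sw.
Qed.

(** A component that does not wander is mapped into one component V by two different iterates, and
    the two images of a single point supply the x and the return time for [conn_periodic]. The
    itinerary then persists on a ball about x. *)
Lemma periodic_itinerary F : is_pmt F -> ~ (exists U, wandering F U) -> Rcal F !=set0 ->
  exists x w (d : R), [/\ (0 < size w)%N, 0 < d &
    forall y, chord x y < d -> forall m, reach F setT (flatten (nseq m w)) y].
Proof.
move=> PF nw [z0 Rz0].
have [U cU Uz0] := comp_exists Rz0.
have : ~ wandering F U by move=> h; apply: nw; exists U.
move=> /not_andP[//|/existsNP[m /existsNP[n /existsNP[V /existsNP[W]]]]].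
move=> /not_implyP[mn /not_implyP[cV /not_implyP[cW /not_implyP[mV /not_implyP[nW]]]]].
move=> /contrapT VW; rewrite -VW {W VW cW} in nW.
wlog lt_mn : m n mn mV nW / (m < n)%N.
  move=> hw; case: (ltngtP m n) => h; [exact: (hw m n) | | by case: mn].
  by apply: (hw n m) => // e; apply: mn.
case: cV => VR _ cV _.
have real y : Rcal F y -> forall n, exists2 s, size s = n & reach F setT s y.
  by move=> /(Rcal_ball PF)[r r0 hr]; apply: hr; rewrite chordzz.
have Rz : Rcal F z0 by [].
set x := Fn F m z0.
have Vx : V x by apply: mV; exists z0.
have Vy : V (Fn F (n - m) x).
  have -> : Fn F (n - m) x = Fn F n z0 by rewrite /x /Fn -iterD subnK // ltnW.
  by apply: nW; exists z0.
have [|w sw per] := conn_periodic PF cV _ Vx Vy.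
  by move=> y /VR /real.
have [r r0 hr] := Rcal_ball PF (VR x Vx).
have [d d0 hd] := ball_itin PF r0 hr.
exists x, w, d; split=> //; first by rewrite sw subn_gt0.
by move=> y xy j; apply: hd xy _; exact: (per x Vx).
Qed.

Lemma periodic_from_word F w y : is_pmt F -> (0 < size w)%N -> reach F setT w y ->
  mob (Mw (mat F) w) y = y -> periodic_pt F (size w) y.
Proof.
move=> PF w0 rw fw; have [e hj _ _] := reach_Fn PF rw; rewrite fw in e.
split=> // j; elim/ltn_ind: j => j IH; case: (ltnP j (size w)) => h; first exact: hj.
have -> : Fn F j y = Fn F (j - size w) y.
  by rewrite -{1}(subnK h) /Fn iterD -/(Fn F (size w) y) e.
by apply: IH; rewrite ltn_subrL w0 (leq_trans w0).
Qed.

Lemma conjd_reach_back F G h kap w y : conjd F G h kap -> reach G setT (map kap w) (h y) ->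
  reach F setT w y.
Proof.
move=> [_ _ hr hm]; elim: w y => [|k w IH] y //= [/hr rk rw]; split=> //.
by apply: IH; rewrite hm //; exact: sclosure_sub.
Qed.

(** The attracting fixed point p of the perturbed word is a limit of an orbit with periodic
    itinerary. Unless p is a ghost it is periodic, and its preimage y under the conjugacy is a
    periodic point of F whose multiplier is excluded from modulus 1 and from modulus above 1. *)
Lemma stable_attracting F : is_pmt F -> struct_stable F -> ~ (exists U, wandering F U) ->
  Rcal F !=set0 -> exists n z, attracting_pt F n z.
Proof.
move=> PF SF nw nR.
have [x [w [d [w0 d0 hx]]]] := periodic_itinerary PF nw nR.
have [e e0 he] := goodpush_id PF SF.
have [B [dB nB lB]] := generic_words (mat_det PF) w0 e0.
have [PG [h [kap cFG]]] := he B dB nB.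
set G := push F id B in PG cFG.
set w' := map kap w; set M' := Mw (mat G) w'.
have dM' : \det M' = 1 by apply: det_Mw.
have lM' : lox M' by apply: lB; rewrite size_map.
have [l' [u [v ed]]] := lox_eigd dM' lM'.
have [[g [hg gh ch cg]] _ hr _] := cFG.
(* Avoiding the preimages of both fixed points makes the orbit of [h x1] converge to [pt u] without
   starting there. *)
have [x1 x1n xx1] := near_avoid x [:: g (pt u); g (pt v)] d0.
have nu : h x1 <> pt u by move=> h'; move: x1n; rewrite -h' hg !inE eqxx.
have nv : h x1 <> pt v by move=> h'; move: x1n; rewrite -h' hg !inE eqxx orbT.
have rx1 := hx x1 xx1.
have cv := lox_conv dM' ed nv; set p := pt u in cv nu *.
have fp := lim_fix dM' cv.
set M := Mw (mat F) w; have dM : \det M = 1 by apply: det_Mw; exact: mat_det.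
have hit m : h (iter m (mob M) x1) = iter m (mob M') (h x1).
  rewrite -!Mw_nseq; [|exact: mat_det|exact: mat_det].
  by rewrite -map_nseq_flat; have [_ ->] := conjd_mob PF PG cFG (rx1 m).
have rx1G m : reach G setT w' (iter m (mob M') (h x1)).
  rewrite -Mw_nseq; last exact: mat_det.
  have [rr _] := conjd_mob PF PG cFG (rx1 m.+1).
  rewrite map_nseq_flat in rr.
  have e2 : flatten (nseq m.+1 w') = flatten (nseq m w') ++ w'.
    elim: m {rr} => [|m IH]; first by rewrite /= cats0.
    by move: IH => /= IH; rewrite -catA -IH.
  by rewrite e2 in rr; have [] := reach_split PG rr.
case: (pselect (forall j, Rset G (Fn G j p))) => [hp|/existsNP hp]; last first.
  exfalso.
  have [N hN hmin] : exists2 N, ~ Rset G (Fn G N p) & forall j, (j < N)%N -> Rset G (Fn G j p).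
    case: hp => N hN; elim/ltn_ind: N hN => N IH hN.
    case: (pselect (forall j, (j < N)%N -> Rset G (Fn G j p))) => h1; first by exists N.
    move/existsNP : h1 => [j /not_implyP[jN hj]]; exact: IH jN hj.
  have hB : Bset G (Fn G N p) by apply/(BsetE PG).
  have [s ss rs] := proj1 (preimg_reach PG N _ p) (conj hmin hB).
  (* If p reaches B(G), it is a ghost attracting the orbit of [h x1]; conjugating back to F
     contradicts [no_wghost]. *)
  have gG : wghost G (size w) N.
    exists w', s, (h x1), p; split=> //; first by rewrite size_map.
    by move=> m; rewrite -map_nseq_flat; have [] := conjd_mob PF PG cFG (rx1 m).
  have [g' [kap' [cGF _ _]]] := conjd_sym PF PG cFG.
  exact: (no_wghost PF SF w0 (wghost_conj PG PF cGF gG)).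
(* The finite itinerary of p is shared by nearby points, in particular by late points of the orbit
   converging to p, which follow [w']. *)
have rp : reach G setT w' p.
  have [s ss rs] := Fn_reach PG (n := size w) (q := p) (fun j _ => hp j).
  have [d2 d20 hd2] := reach_stable PG rs.
  have [N hN] := cv d2 d20.
  have rs2 : reach G setT s (iter N (mob M') (h x1)).
    apply: hd2; first exact: mat_det.
    - by move=> k; rewrite subrr /mn !mxE nrm0 !addr0.
    - by move=> k y; apply; rewrite chordzz.
    by rewrite chordC; apply: hN.
  by rewrite (reach_uniq PG _ (rx1G N) rs2) // ss size_map.
set y := g p; have hy : h y = p by rewrite /y gh.
have ry : reach F setT w y by apply: (conjd_reach_back cFG); rewrite hy.
have fy : mob M y = y.
  apply: (can_inj hg); have [_ ->] := conjd_mob PF PG cFG ry; by rewrite hy.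
have py := periodic_from_word PF w0 ry fy.
exists (size w), y; split=> //; first exact: stable_no_identity.
have n1 := stable_mult_neq1 PF SF py.
have [l l0 el] := fix_eig dM fy.
have em : mult F (size w) y = l^-1 ^+ 2.
  have [_ _ _ e4] := reach_Fn PF ry.
  by rewrite /mult e4 -/M (multiplier_eig dM (uv_nz y) el) // uvK.
have cvF : sconv (fun m => iter m (mob M) x1) y.
  move=> e1 e10; have [d1 d10 hd1] := cg p e1 e10; have [N hN] := cv d1 d10.
  exists N => m /hN; rewrite chordC -hit => /hd1; by rewrite hg chordC.
(* The multiplier is l^-2. With |l| < 1 the point y would be repelling, and the orbit of x1, which
   starts off y and converges to y, would converge to the other fixed point. *)
have l1 : ~ (nrm l < 1).
  move=> l1; have [u' ed'] := eigd_of_eig dM (uv_nz y) el l1 l0.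
  have yu : y = pt u'.
    apply: sconv_unique cvF _; apply: (lox_conv dM ed'); rewrite uvK => h1.
    by apply: nu; rewrite h1 hy.
  have [wd _ _ _] := ed'; have [un _] := wdg_nz wd.
  by move: wd; rewrite wdg_eq0 ?uv_nz // uvK -yu eqxx.
rewrite em normE; rewrite em nrmX nrmV in n1.
have l2 : nrm l != 1 by apply/eqP => h1; apply: n1; rewrite h1 invr1 expr1n.
have {l1 l2} l3 : 1 < nrm l by rewrite lt_neqAle eq_sym l2 leNgt; apply/negP.
have : nrm (l^-1 ^+ 2) < 1.
  rewrite nrmX nrmV exprn_ilt1 // ?invr_ge0 ?nrm_ge0 //.
  by rewrite invf_lt1 // (lt_trans _ l3).
by rewrite -ltcR.
Qed.

Lemma ghost_wghost F z0 : is_pmt F -> ghost_periodic F z0 ->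
  exists n N, (0 < n)%N /\ wghost F n N.
Proof.
move=> PF [[N hN] [U [n [[[UR [z Uz] cU _] n0 nU] _ cv]]]].
have [v sv rv] := proj1 (preimg_reach PF N _ z0) hN.
have real y : U y -> forall n, exists2 s, size s = n & reach F setT s y.
  by move=> /UR /(Rcal_ball PF)[r r0 hr]; apply: hr; rewrite chordzz.
have [|w sw per] := conn_periodic PF cU real Uz (p := n); first by apply: nU; exists z.
exists n, N; split=> //; exists w, v, z, z0; split=> //; first exact: per.
have e m : iter m (mob (Mw (mat F) w)) z = Fn F (m * n) z.
  rewrite -Mw_nseq; last exact: mat_det.
  have [<- _ _ _] := reach_Fn PF (per z Uz m).
  by rewrite size_flatten /shape map_nseq sumn_nseq sw mulnC.
by move=> e0 /(cv z Uz)[M hM]; exists M => m; rewrite e; exact: hM.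
Qed.

Lemma stable_hyperbolic F : is_pmt F -> struct_stable F -> ~ (exists U, wandering F U) ->
  Rcal F !=set0 -> hyperbolic F.
Proof.
move=> PF SF nw nR; split; first exact: stable_attracting.
split.
  move=> [n [z [pz _ h _]]]; apply: (stable_mult_neq1 PF SF pz).
  by move: h; rewrite normE => /complexI.
split.
  move=> [n [z [pz _ h]]]; apply: (stable_mult_neq1 PF SF pz).
  by rewrite h nrm1.
split; first by move=> [n [z]]; exact: stable_no_identity.
split=> // -[z0 /(ghost_wghost PF)[n [N [n0]]]]; exact: no_wghost.
Qed.

End Regular.

(** * Twists of the sphere *)

Section C1.
Variable R : realType.
Notation C := (Cplx R).
Implicit Types (f g : R -> R) (t s : R) (z w : R -> C).

Lemma near_ltr (a t : R) : t < a -> \forall s \near t, s < a.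
Proof. by move=> h; apply: open_nbhs_nbhs; split; [exact: open_lt | exact: h]. Qed.

Lemma near_gtr (a t : R) : a < t -> \forall s \near t, a < s.
Proof. by move=> h; apply: open_nbhs_nbhs; split; [exact: open_gt | exact: h]. Qed.

(** A local form of [C1fun], needed for curves that are smooth only on part of the line. *)
Definition C1at f t := exists2 g : R -> R, (\forall s \near t, is_derive (s : R) (1 : R) f (g s)) &
  {for t, continuous g}.

Lemma is_derive_cont f t (d : R) : is_derive t 1 f d -> {for t, continuous f}.
Proof.
by move=> [h _]; apply/differentiable_continuous/derivable1_diffP.
Qed.

Lemma C1at_cont f t : C1at f t -> {for t, continuous f}.
Proof. by move=> [g /nbhs_singleton h _]; exact: is_derive_cont h. Qed.

Lemma C1at_is f t : C1at f t -> is_derive t 1 f (f^`() t).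
Proof.
move=> [g /nbhs_singleton h _]; rewrite derive1E; apply: derivableP; by case: h.
Qed.

Lemma is_derive1E f t (d : R) : is_derive t 1 f d -> f^`() t = d.
Proof. by move=> h; rewrite derive1E; case: h. Qed.

Lemma C1at_cst (a : R) t : C1at (fun=> a) t.
Proof.
exists (fun=> 0); last exact: cst_continuous.
by near=> s; exact: is_derive_cst.
Unshelve. all: by end_near. Qed.

Lemma C1at_id t : C1at id t.
Proof.
exists (fun=> 1); last exact: cst_continuous.
by near=> s; exact: is_derive_id.
Unshelve. all: by end_near. Qed.

Lemma C1at_D f g t : C1at f t -> C1at g t -> C1at (fun s => f s + g s) t.
Proof.
move=> [f' hf cf] [g' hg cg]; exists (fun s => f' s + g' s); last exact: continuousD.
near=> s.
have h1 : is_derive s 1 f (f' s) by near: s; exact: hf.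
have h2 : is_derive s 1 g (g' s) by near: s; exact: hg.
exact: is_deriveD.
Unshelve. all: by end_near. Qed.

Lemma C1at_N f t : C1at f t -> C1at (fun s => - f s) t.
Proof.
move=> [f' hf cf]; exists (fun s => - f' s); last exact: continuousN.
near=> s.
have h1 : is_derive s 1 f (f' s) by near: s; exact: hf.
exact: is_deriveN.
Unshelve. all: by end_near. Qed.

Lemma C1at_M f g t : C1at f t -> C1at g t -> C1at (fun s => f s * g s) t.
Proof.
move=> hf hg; have cf := C1at_cont hf; have cg := C1at_cont hg.
case: hf hg => f' hf cf' [g' hg cg'].
exists (fun s => f s * g' s + g s * f' s); last by apply: continuousD; apply: continuousM.
near=> s.
have h1 : is_derive s 1 f (f' s) by near: s; exact: hf.
have h2 : is_derive s 1 g (g' s) by near: s; exact: hg.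
exact: is_deriveM.
Unshelve. all: by end_near. Qed.

Lemma C1at_V f t : f t != 0 -> C1at f t -> C1at (fun s => (f s)^-1) t.
Proof.
move=> f0 hf; have cf := C1at_cont hf; case: hf => f' hf cf'.
exists (fun s => - (f s ^+ 2)^-1 * f' s); last first.
  apply: continuousM => //; apply: continuousN; apply: continuousV; first by rewrite expf_neq0.
  by apply: continuousM.
near=> s.
have h1 : is_derive s 1 f (f' s) by near: s; exact: hf.
have h2 : f s != 0 by near: s; exact: cvgr_neq0 cf f0.
exact: is_deriveV.
Unshelve. all: by end_near. Qed.

Lemma C1at_comp f g t : C1at g t -> C1at f (g t) -> C1at (fun s => f (g s)) t.
Proof.
move=> hg; have cg := C1at_cont hg; case: hg => g' hg cg' [f' hf cf'].
exists (fun s => f' (g s) * g' s); last first.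
  by apply: continuousM => //; apply: continuous_comp.
near=> s.
have h1 : is_derive s 1 g (g' s) by near: s; exact: hg.
have h2 : is_derive (g s) 1 f (f' (g s)) by near: s; exact: (cg _ hf).
exact: is_derive1_comp.
Unshelve. all: by end_near. Qed.

Lemma C1at_near f g t : (\forall s \near t, f s = g s) -> C1at f t -> C1at g t.
Proof.
move=> h [f' hf cf]; exists f' => //.
have h2 : \forall s \near t, \forall u \near s, f u = g u by exact: near_join.
near=> s.
have h1 : is_derive s 1 f (f' s) by near: s; exact: hf.
by apply: near_eq_is_derive h1; near: s; exact: h2.
Unshelve. all: by end_near. Qed.

Lemma C1funP f : C1fun f <-> forall t, C1at f t.
Proof.
split=> [[df cf] t|h].
  exists (f^`()); last exact: cf.
  by near=> s; rewrite derive1E; apply: derivableP; exact: df.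
split=> t; first by have := C1at_is (h t) => -[].
have [f' hf cf] := h t.
have e : \forall s \near t, f' s = f^`() s.
  by near=> s; apply/esym/is_derive1E; near: s; exact: hf.
have et := nbhs_singleton e; rewrite /continuous_at -et.
by apply: cvg_trans cf; apply: near_eq_cvg; apply: filterS e => s ->.
Unshelve. all: by end_near. Qed.

(* The C^1 truncated square, from which the bumps are built. *)
Definition psq (x : R) : R := if 0 <= x then x ^+ 2 else 0.

Lemma max0_cont t : {for t, continuous (fun x : R => Num.max 0 x)}.
Proof. by apply: continuous_max; [exact: cst_continuous | exact: cvg_id]. Qed.

Lemma psq_derive t : is_derive t 1 psq (2 * Num.max 0 t).
Proof.
case: (ltrgtP 0 t) => h.
- apply: (near_eq_is_derive (f := fun x : R => x ^+ 2)).
    by near=> s; rewrite /psq ltW //; near: s; exact: near_gtr.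
  have := @is_deriveX _ _ (id : R -> R) 2 t 1 1 (is_derive_id _ _).
  by rewrite /= expr1 /GRing.scale /= mulr1.
- apply: (near_eq_is_derive (f := fun=> 0)).
    by near=> s; rewrite /psq leNgt; have -> : s < 0 by near: s; exact: near_ltr.
  by rewrite mulr0; exact: is_derive_cst.
rewrite -h mulr0; apply/is_derive1_caratheodory.
exists (fun x => Num.max 0 x); split.
- move=> x; rewrite /psq lexx expr0n subr0 subr0; case: lerP => x0; first by rewrite expr2.
  by rewrite mul0r.
- exact: max0_cont.
- by rewrite maxxx.
Unshelve. all: by end_near. Qed.

Lemma C1at_psq t : C1at psq t.
Proof.
exists (fun x => 2 * Num.max 0 x); first by near=> s; exact: psq_derive.
by apply: continuousM; [exact: cst_continuous | exact: max0_cont].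
Unshelve. all: by end_near. Qed.

Lemma C1at_affine (a b : R) t : C1at (fun x => a * x + b) t.
Proof.
by apply: C1at_D (C1at_cst _ _); apply: C1at_M (C1at_id _); exact: C1at_cst.
Qed.

(** Twice the second difference of [psq] with spacing 1/2: a C^1 quadratic spline equal to 0 up to 0
    and to 1 from 1 on. The arguments are written in the shape of [C1at_affine]. *)
Definition step (x : R) : R := 2 * (psq x + (-2) * psq (1 * x + - 2^-1) + psq (1 * x + -1)).

Lemma C1at_step t : C1at step t.
Proof.
apply: C1at_M; first exact: C1at_cst.
apply: C1at_D; last by apply: C1at_comp; [exact: C1at_affine | exact: C1at_psq].
apply: C1at_D; first exact: C1at_psq.
apply: C1at_M; first exact: C1at_cst.
by apply: C1at_comp; [exact: C1at_affine | exact: C1at_psq].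
Qed.

Lemma step0 x : x <= 0 -> step x = 0.
Proof.
move=> h; rewrite /step /psq !mul1r.
have -> : 0 <= x - 1 = false by apply/negbTE; rewrite -ltNge; lra.
have -> : 0 <= x - 2^-1 = false by apply/negbTE; rewrite -ltNge; lra.
case: ifP => h1; last by rewrite mulr0 !addr0 mulr0.
have -> : x = 0 by lra.
by rewrite expr0n mulr0 !addr0 mulr0.
Qed.

Lemma step1 x : 1 <= x -> step x = 1.
Proof.
move=> h; rewrite /step /psq !mul1r.
have -> : 0 <= x - 1 by lra.
have -> : 0 <= x - 2^-1 by lra.
have -> : 0 <= x by lra.
by field.
Qed.

Lemma step01 x : 0 <= step x <= 1.
Proof.
case: (lerP x 0) => h0; first by rewrite step0 // lexx ler01.
case: (lerP 1 x) => h1; first by rewrite step1 // lexx ler01.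
rewrite /step /psq !mul1r (ltW h0).
have -> : 0 <= x - 1 = false by apply/negbTE; rewrite -ltNge; lra.
have h4 : 2^-1 + 2^-1 = 1 :> R by field.
case: ifP => h2; first by rewrite addr0; apply/andP; split; nra.
have h3 : x < 2^-1 by move/negbT: h2; rewrite -ltNge; lra.
by rewrite mulr0 !addr0; apply/andP; split; nra.
Qed.

Definition C1c z t := C1at (fun s => complex.Re (z s)) t /\ C1at (fun s => complex.Im (z s)) t.

Definition is_dc z t (d : C) :=
  is_derive t (1 : R) (fun s => complex.Re (z s)) (complex.Re d) /\
  is_derive t (1 : R) (fun s => complex.Im (z s)) (complex.Im d).

Definition dc z t : C := ((fun s => complex.Re (z s))^`() t +i* (fun s => complex.Im (z s))^`() t)%C.

Lemma C1c_dc z t : C1c z t -> is_dc z t (dc z t).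
Proof. by move=> [h1 h2]; split; exact: C1at_is. Qed.

Lemma is_dcE z t d : is_dc z t d -> dc z t = d.
Proof. by case: d => a b [/is_derive1E h1 /is_derive1E h2]; rewrite /dc h1 h2. Qed.

Lemma C1c_near z w t : (\forall s \near t, z s = w s) -> C1c z t -> C1c w t.
Proof.
by move=> h [h1 h2]; split; [apply: C1at_near h1 | apply: C1at_near h2];
  apply: filterS h => s ->.
Qed.

Lemma is_dc_near z w t d : (\forall s \near t, z s = w s) -> is_dc z t d -> is_dc w t d.
Proof.
by move=> h [h1 h2]; split; [apply: near_eq_is_derive h1 | apply: near_eq_is_derive h2];
  apply: filterS h => s ->.
Qed.

Lemma cReD (x y : C) : complex.Re (x + y) = complex.Re x + complex.Re y.
Proof. by case: x y => a b [c d]. Qed.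
Lemma cImD (x y : C) : complex.Im (x + y) = complex.Im x + complex.Im y.
Proof. by case: x y => a b [c d]. Qed.
Lemma cReM (x y : C) : complex.Re (x * y) = complex.Re x * complex.Re y - complex.Im x * complex.Im y.
Proof. by case: x y => a b [c d]. Qed.
Lemma cImM (x y : C) : complex.Im (x * y) = complex.Re x * complex.Im y + complex.Im x * complex.Re y.
Proof. by case: x y => a b [c d]. Qed.
Lemma cReV (x : C) : complex.Re x^-1 = complex.Re x / (complex.Re x ^+ 2 + complex.Im x ^+ 2).
Proof. by case: x => a b. Qed.
Lemma cImV (x : C) : complex.Im x^-1 = - complex.Im x / (complex.Re x ^+ 2 + complex.Im x ^+ 2).
Proof. by case: x => a b; rewrite /= mulNr. Qed.
Lemma ReIm (x y : C) : complex.Re x = complex.Re y -> complex.Im x = complex.Im y -> x = y.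
Proof. by case: x y => a b [c d] /= -> ->. Qed.

Lemma C1c_cst (a : C) t : C1c (fun=> a) t.
Proof. by split; exact: C1at_cst. Qed.

Lemma is_dc_cst (a : C) t : is_dc (fun=> a) t 0.
Proof. by split; exact: is_derive_cst. Qed.

Lemma C1c_D z w t : C1c z t -> C1c w t -> C1c (fun s => z s + w s) t.
Proof.
move=> [h1 h2] [h3 h4]; split.
  by apply: C1at_near (C1at_D h1 h3); near=> s; rewrite cReD.
by apply: C1at_near (C1at_D h2 h4); near=> s; rewrite cImD.
Unshelve. all: by end_near. Qed.

Lemma is_dc_D z w t d e : is_dc z t d -> is_dc w t e -> is_dc (fun s => z s + w s) t (d + e).
Proof.
move=> [h1 h2] [h3 h4]; rewrite /is_dc cReD cImD; split.
  by apply: near_eq_is_derive (is_deriveD h1 h3); near=> s; rewrite cReD.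
by apply: near_eq_is_derive (is_deriveD h2 h4); near=> s; rewrite cImD.
Unshelve. all: by end_near. Qed.

Lemma C1c_M z w t : C1c z t -> C1c w t -> C1c (fun s => z s * w s) t.
Proof.
move=> [h1 h2] [h3 h4]; split.
  by apply: C1at_near (C1at_D (C1at_M h1 h3) (C1at_N (C1at_M h2 h4))); near=> s; rewrite cReM.
by apply: C1at_near (C1at_D (C1at_M h1 h4) (C1at_M h2 h3)); near=> s; rewrite cImM.
Unshelve. all: by end_near. Qed.

Lemma is_dc_M z w t d e : is_dc z t d -> is_dc w t e ->
  is_dc (fun s => z s * w s) t (d * w t + z t * e).
Proof.
move=> [h1 h2] [h3 h4]; rewrite /is_dc; split.
  apply: (near_eq_is_derive (f := fun s => complex.Re (z s) * complex.Re (w s) - complex.Im (z s) * complex.Im (w s))).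
    by near=> s; rewrite cReM.
  have := is_deriveB (is_deriveM h1 h3) (is_deriveM h2 h4).
  rewrite /GRing.scale /=; set a := (X in is_derive _ _ _ X -> _).
  have -> : complex.Re (d * w t + z t * e) = a by rewrite /a cReD !cReM; ring.
  by [].
apply: (near_eq_is_derive (f := fun s => complex.Re (z s) * complex.Im (w s) + complex.Im (z s) * complex.Re (w s))).
  by near=> s; rewrite cImM.
have := is_deriveD (is_deriveM h1 h4) (is_deriveM h2 h3).
rewrite /GRing.scale /=; set a := (X in is_derive _ _ _ X -> _).
have -> : complex.Im (d * w t + z t * e) = a by rewrite /a cImD !cImM; ring.
by [].
Unshelve. all: by end_near. Qed.

(** The squared modulus is C^1 even where z vanishes; for this reason radii enter the twists
    squared. *)
Definition nsq z (t : R) : R := complex.Re (z t) * complex.Re (z t) + complex.Im (z t) * complex.Im (z t).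

Lemma nsqE z t : nsq z t = nrm (z t) ^+ 2.
Proof. by rewrite nrmE /nsq !expr2. Qed.

Lemma C1at_nsq z t : C1c z t -> C1at (nsq z) t.
Proof. by move=> [h1 h2]; apply: C1at_D; apply: C1at_M. Qed.

Lemma is_derive_nsq z t d : is_dc z t d ->
  is_derive t 1 (nsq z) (2 * (complex.Re d * complex.Re (z t) + complex.Im d * complex.Im (z t))).
Proof.
move=> [h1 h2]; have := is_deriveD (is_deriveM h1 h1) (is_deriveM h2 h2).
rewrite /GRing.scale /=; set a := (X in is_derive _ _ _ X -> _).
by have -> : 2 * (complex.Re d * complex.Re (z t) + complex.Im d * complex.Im (z t)) = a by rewrite /a; ring.
Qed.

Lemma C1c_V z t : z t != 0 -> C1c z t -> C1c (fun s => (z s)^-1) t.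
Proof.
move=> z0 hz; have hn := C1at_nsq hz; case: hz => h1 h2.
have n0 : nsq z t != 0 by rewrite nsqE expf_eq0 /= nrm_eq0.
have hV := C1at_V n0 hn; split.
  by apply: C1at_near (C1at_M h1 hV); near=> s; rewrite cReV /nsq !expr2.
by apply: C1at_near (C1at_M (C1at_N h2) hV); near=> s; rewrite cImV /nsq !expr2.
Unshelve. all: by end_near. Qed.

Lemma C1c_cont z t (e : R) : C1c z t -> 0 < e -> \forall s \near t, nrm (z s - z t) < e.
Proof.
move=> [/C1at_cont h1 /C1at_cont h2] e0.
have e2 : 0 < e / 2 by rewrite divr_gt0.
near=> s.
have k1 : `|complex.Re (z t) - complex.Re (z s)| < e / 2 by near: s; move/cvgrPdist_lt : h1; apply.
have k2 : `|complex.Im (z t) - complex.Im (z s)| < e / 2 by near: s; move/cvgrPdist_lt : h2; apply.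
rewrite nrmBC -(@ltr_pXn2r _ 2) ?nnegrE ?nrm_ge0 ?ltW // nrmE.
have -> : complex.Re (z t - z s) = complex.Re (z t) - complex.Re (z s) by case: (z t) (z s) => ? ? [].
have -> : complex.Im (z t - z s) = complex.Im (z t) - complex.Im (z s) by case: (z t) (z s) => ? ? [].
have E1 := real_normK (num_real (complex.Re (z t) - complex.Re (z s))).
have E2 := real_normK (num_real (complex.Im (z t) - complex.Im (z s))).
rewrite -E1 -E2.
have := normr_ge0 (complex.Re (z t) - complex.Re (z s)).
have := normr_ge0 (complex.Im (z t) - complex.Im (z s)).
nra.
Unshelve. all: by end_near. Qed.

(* Differentiating z * z^-1 = 1. *)
Lemma dc_V z t : z t != 0 -> C1c z t -> dc (fun s => (z s)^-1) t = - (z t)^-1 ^+ 2 * dc z t.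
Proof.
move=> z0 hz; have hV := C1c_V z0 hz.
have h := is_dc_M (C1c_dc hz) (C1c_dc hV).
have h2 : is_dc (fun s => z s * (z s)^-1) t 0.
  apply: (is_dc_near (z := fun=> 1)); last exact: is_dc_cst.
  near=> s; rewrite mulfV // -nrm_gt0.
  have : nrm (z s - z t) < nrm (z t) by near: s; apply: C1c_cont => //; rewrite nrm_gt0.
  by have := nrmBl (z t) (z s); rewrite nrmBC; lra.
have := is_dcE h; rewrite (is_dcE h2) => e.
apply: (mulfI z0); move: e; set x := dc z t; set y := dc _ t => e.
have -> : z t * y = - (x / z t) by apply/eqP; rewrite -addr_eq0 addrC -e.
by field.
Unshelve. all: by end_near. Qed.

Lemma C1c_comp z (f : R -> R) t : C1at f t -> C1c z (f t) -> C1c (fun s => z (f s)) t.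
Proof. by move=> hf [h1 h2]; split; [apply: (C1at_comp hf h1) | apply: (C1at_comp hf h2)]. Qed.

Lemma is_dc_comp z (f : R -> R) t (a : R) d : is_derive t (1 : R) f a -> is_dc z (f t) d ->
  is_dc (fun s => z (f s)) t (a%:C%C * d).
Proof.
move=> hf [h1 h2]; rewrite /is_dc cReM cImM /= !mul0r subr0 addr0.
by split; rewrite mulrC; [exact: (is_derive1_comp h1 hf) | exact: (is_derive1_comp h2 hf)].
Qed.

End C1.

(** * The inverse function theorem on the line *)

Section LocalInverse.
Variable R : realType.
Implicit Types (f g : R -> R) (t s : R).

Lemma C1at_derive1_cont f t : C1at f t -> {for t, continuous f^`()}.
Proof.
move=> [f' hf cf].
have e : \forall s \near t, f' s = f^`() s.
  by near=> s; apply/esym/is_derive1E; near: s; exact: hf.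
have et : f' t = f^`() t := nbhs_singleton e.
move: cf; rewrite /prop_for /continuous_at et => cf.
by apply: cvg_trans cf; apply: near_eq_cvg; apply: filterS e => s ->.
Unshelve. all: by end_near. Qed.

Lemma near_dist (P : R -> Prop) t : (\forall s \near t, P s) ->
  exists2 d : R, 0 < d & forall s, `|s - t| < d -> P s.
Proof.
move=> /nbhs_ballP[d d0 hd]; exists d => // s hs; apply: hd.
by rewrite /ball /= distrC.
Qed.

Lemma dist_near (P : R -> Prop) t (d : R) : 0 < d -> (forall s, `|s - t| < d -> P s) ->
  \forall s \near t, P s.
Proof.
by move=> d0 h; apply/nbhs_ballP; exists d => // s; rewrite /ball /= distrC => /h.
Qed.

(** A positive derivative near t0 makes f increasing by the mean value theorem, the intermediate
    value theorem gives the inverse [tau], and its derivative 1 / f' is continuous. *)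
Lemma loc_inv_pos f t0 (h : R) : 0 < h -> (forall t, `|t - t0| < h -> C1at f t) ->
  0 < f^`() t0 -> exists (r : R) (tau : R -> R), [/\ 0 < r,
    forall x : R, `|x - f t0| < r -> [/\ C1at tau x, f (tau x) = x & `|tau x - t0| < h] &
    exists2 k : R, 0 < k & forall t, `|t - t0| < k -> `|f t - f t0| < r /\ tau (f t) = t].
Proof.
move=> h0 hC df0.
have C0 : C1at f t0 by apply: hC; rewrite subrr normr0.
have [k1 k10 hk1] : exists2 d : R, 0 < d & forall s, `|s - t0| < d -> 0 < f^`() s.
  apply: near_dist; apply: (cvgr_gt _ (C1at_derive1_cont C0)); exact: df0.
pose k : R := Num.min h k1 / 2.
have kp : 0 < k by rewrite divr_gt0 // lt_min h0.
have kh : k < h.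
  by have : Num.min h k1 <= h := ltac:(by rewrite ge_min lexx); rewrite /k; lra.
have kk : k < k1.
  by have : Num.min h k1 <= k1 := ltac:(by rewrite ge_min lexx orbT); rewrite /k; lra.
set a := t0 - k; set b := t0 + k.
have inC t : a <= t <= b -> C1at f t /\ 0 < f^`() t.
  move=> /andP[t1 t2]; have hh : `|t - t0| <= k by rewrite ler_norml; apply/andP; split; rewrite /a /b in t1 t2; lra.
  by split; [apply: hC | apply: hk1]; exact: le_lt_trans hh _.
have cont x y : a <= x -> y <= b -> {within `[x, y], continuous f}.
  move=> ax yb; apply: continuous_in_subspaceT => t.
  rewrite inE /= in_itv /= => /andP[t1 t2]; apply: C1at_cont.
  by have [] := inC t ltac:(by rewrite (le_trans ax t1) (le_trans t2 yb)).
have incr x y : a <= x -> x < y -> y <= b -> f x < f y.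
  move=> ax xy yb; have [||c] := @MVT _ f (f^`()) x y xy.
  - move=> t; rewrite in_itv /= => /andP[/ltW t1 /ltW t2]; apply: C1at_is.
    by have [] := inC t ltac:(by rewrite (le_trans ax t1) (le_trans t2 yb)).
  - exact: cont.
  rewrite in_itv /= => /andP[/ltW t1 /ltW t2] e.
  have [_ dp] := inC c ltac:(by rewrite (le_trans ax t1) (le_trans t2 yb)).
  by rewrite -subr_gt0 e mulr_gt0 // subr_gt0.
have inj x y : a <= x <= b -> a <= y <= b -> f x = f y -> x = y.
  move=> /andP[x1 x2] /andP[y1 y2] e; case: (ltrgtP x y) => // hxy.
    by have := incr _ _ x1 hxy y2; rewrite e ltxx.
  by have := incr _ _ y1 hxy x2; rewrite e ltxx.
have ab : a < b by rewrite /a /b; lra.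
have at0 : a < t0 by rewrite /a; lra.
have bt0 : t0 < b by rewrite /b; lra.
have fa := incr _ _ (lexx a) at0 (ltW bt0).
have fb := incr _ _ (ltW at0) bt0 (lexx b).
(* Outside the range of f on [a, b] the value is the default t0. *)
pose tau x := xget t0 [set t | a <= t <= b /\ f t = x].
have tauP (y : R) : f a < y < f b -> a < tau y < b /\ f (tau y) = y.
  move=> /andP[x1 x2]; have : [set t | a <= t <= b /\ f t = y] (tau y).
    apply: xgetPex; have [|t] := @IVT _ f a b y (ltW ab) (cont _ _ (lexx a) (lexx b)).
      by rewrite (min_idPl (ltW (lt_trans fa fb))) (max_idPr (ltW (lt_trans fa fb))) !ltW.
    by rewrite in_itv /= => t1 t2; exists t.
  move=> /= [/andP[t1 t2] e]; split=> //; rewrite !lt_neqAle t1 t2 !andbT.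
  by apply/andP; split; apply/eqP => e2; [move: x1 | move: x2]; rewrite -e -e2 ltxx.
have tauK t : a <= t <= b -> tau (f t) = t.
  move=> ht; have : [set t' | a <= t' <= b /\ f t' = f t] (tau (f t)).
    by apply: xgetPex; exists t.
  by move=> /= [h1 h2]; exact: inj.
have tauD (x : R) : f a < x < f b -> is_derive (x : R) (1 : R) tau (derive1 f (tau x))^-1.
  move=> hx; have [/andP[t1 t2] e] := tauP x hx.
  have tin : a <= tau x <= b by rewrite !ltW.
  rewrite -{1}e; have [Ct dp] := inC _ tin; apply: is_derive_inverse.
  - near=> s; apply: tauK; apply/andP; split; apply: ltW; near: s; [exact: near_gtr | exact: near_ltr].
  - near=> s; apply: C1at_cont; apply: (proj1 (inC s _)).
    by apply/andP; split; apply: ltW; near: s; [exact: near_gtr | exact: near_ltr].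
  - exact: C1at_is.
  - by rewrite gt_eqF.
exists (Num.min (f t0 - f a) (f b - f t0)), tau; split.
- by rewrite lt_min !subr_gt0 fa fb.
- move=> x; rewrite lt_min => /andP[h1 h2].
  have hx : f a < x < f b.
    move: h1 h2; rewrite !ltr_norml => /andP[h1 h2] /andP[h3 h4].
    by apply/andP; split; lra.
  have [/andP[t1 t2] e] := tauP x hx.
  split=> //; last by rewrite ltr_norml; apply/andP; rewrite /a /b in t1 t2; split; lra.
  exists (fun y => (derive1 f (tau y))^-1).
    have /andP[x1 x2] := hx; near=> s; apply: tauD.
    by apply/andP; split; near: s; [exact: near_gtr | exact: near_ltr].
  have [Ct dp] := inC (tau x) ltac:(by rewrite !ltW).
  apply: continuousV; first by rewrite gt_eqF.
  apply: continuous_comp; first exact: is_derive_cont (tauD x hx).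
  exact: C1at_derive1_cont.
have : \forall s \near t0, `|f s - f t0| < Num.min (f t0 - f a) (f b - f t0).
  have p : 0 < Num.min (f t0 - f a) (f b - f t0) by rewrite lt_min !subr_gt0 fa fb.
  have /cvgrPdist_lt /(_ _ p) := C1at_cont C0.
  by apply: filterS => s; rewrite distrC.
move=> /near_dist[d d0 hd]; exists (Num.min d k); first by rewrite lt_min d0.
move=> t; rewrite lt_min => /andP[/hd h1 h2]; split=> //; apply: tauK.
by move: h2; rewrite ltr_norml /a /b => /andP[h3 h4]; apply/andP; split; lra.
Unshelve. all: by end_near. Qed.

Lemma loc_inv f t0 (h : R) : 0 < h -> (forall t, `|t - t0| < h -> C1at f t) ->
  f^`() t0 != 0 -> exists (r : R) (tau : R -> R), [/\ 0 < r,
    forall x : R, `|x - f t0| < r -> [/\ C1at tau x, f (tau x) = x & `|tau x - t0| < h] &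
    exists2 k : R, 0 < k & forall t, `|t - t0| < k -> `|f t - f t0| < r /\ tau (f t) = t].
Proof.
move=> h0 hC; rewrite neq_lt => /orP[df|df]; last exact: (loc_inv_pos h0 hC df).
have dN : 0 < (fun t => - f t)^`() t0.
  have C0 : C1at f t0 by apply: hC; rewrite subrr normr0.
  rewrite (is_derive1E (is_deriveN (C1at_is C0))) oppr_gt0 //.
have [|r [tau [r0 h1 [k k0 hk]]]] := loc_inv_pos (f := fun t => - f t) h0 _ dN.
  by move=> t /hC; exact: C1at_N.
have eN (x y : R) : `|- x - - y| = `|x - y| by rewrite -opprD normrN.
exists r, (fun x => tau (- x)); split=> //.
  move=> x; rewrite -eN => /h1[c1 c2 c3]; split=> //; last exact: oppr_inj.
  by apply: (C1at_comp (f := tau)) => //; apply: C1at_N; exact: C1at_id.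
by exists k => // t /hk; rewrite eN.
Qed.

End LocalInverse.

(** * The two charts and maps preserving smooth curves *)

Section Eucl.
Variable R : realType.
Notation C := (Cplx R).
Implicit Types (z w c : C) (S : set (sphere R)).

Lemma chord_le_eucl z w : chord (Some z) (Some w) <= 2 * nrm (z - w).
Proof.
rewrite /chord; have n0 := nrm_ge0 (z - w).
set q := Num.sqrt _; have q1 : 1 <= q.
  rewrite /q -[X in X <= _]sqrtr1 ler_sqrt; last by rewrite mulr_ge0 // addr_ge0 ?sqr_ge0.
  have := sqr_ge0 (nrm z); have := sqr_ge0 (nrm w); nra.
rewrite ler_pdivrMr ?(lt_le_trans ltr01) // ler_peMr ?mulr_ge0 //.
Qed.

Lemma sqrt_le1D (x : R) : 0 <= x -> Num.sqrt (1 + x ^+ 2) <= 1 + x.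
Proof.
move=> x0; rewrite -(@ler_pXn2r _ 2) ?nnegrE ?sqrtr_ge0 ?addr_ge0 // sqr_sqrtr; last first.
  by rewrite addr_ge0 ?sqr_ge0.
by rewrite sqrrD expr1n; lra.
Qed.

Lemma eucl_le_chord z (e : R) : 0 < e -> exists2 d : R, 0 < d & forall w : sphere R,
  chord (Some z) w < d -> exists2 w' : C, w = Some w' & nrm (w' - z) < e.
Proof.
move=> e0; set M := 1 + nrm z; have M1 : 1 <= M by rewrite lerDl nrm_ge0.
have M0 : 0 < M by lra.
have M2 : 0 < M ^+ 2 by rewrite exprn_gt0.
(* The first bound excludes infinity and forces |w - z| < M; the second then gives |w - z| < e. *)
exists (Num.min M^-1 (e / M ^+ 2)); first by rewrite lt_min invr_gt0 M0 divr_gt0.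
have sz := sqrt_le1D (nrm_ge0 z); rewrite -/M in sz.
have p (x : R) : 0 < Num.sqrt (1 + x ^+ 2).
  by rewrite sqrtr_gt0 ltr_pwDl ?sqr_ge0.
case=> [w|]; rewrite lt_min => /andP[]; last first.
  rewrite /chord ltr_pdivrMr ?p // => h _; exfalso.
  have : M^-1 * Num.sqrt (1 + nrm z ^+ 2) <= 1 by rewrite mulrC ler_pdivrMr // mul1r.
  lra.
rewrite /chord sqrtrM ?addr_ge0 ?sqr_ge0 // => h1 h2; exists w => //.
have sw := sqrt_le1D (nrm_ge0 w).
have hw : nrm w <= nrm z + nrm (w - z) by have := nrmBl w z; lra.
rewrite nrmBC in h1 h2 *; set x := nrm (w - z) in h1 h2 hw *.
have x0 : 0 <= x by exact: nrm_ge0.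
move: h1 h2; rewrite !ltr_pdivrMr ?mulr_gt0 ?p // => h1 h2.
set q := Num.sqrt _ * _ in h1 h2.
have qM : q <= M * (M + x).
  by apply: ler_pM; rewrite ?sqrtr_ge0 //; rewrite /M; lra.
have k1 : M^-1 * q <= M + x by rewrite mulrC ler_pdivrMr // mulrC.
have k2 : e / M ^+ 2 * q <= e / M * (M + x).
  have -> : e / M * (M + x) = e / M ^+ 2 * (M * (M + x)) by field; lra.
  by rewrite ler_pM2l // divr_gt0.
have xM : x < M by lra.
have k3 : e / M * (M + x) <= 2 * e.
  have -> : e / M * (M + x) = e * ((M + x) / M) by field; lra.
  have : (M + x) / M <= 2 by rewrite ler_pdivrMr //; lra.
  nra.
lra.
Qed.

Lemma inv_sphK : involutive (@inv_sph R).
Proof.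
case=> [a|] /=; last by rewrite eqxx.
by case: eqVneq => [->|a0] //=; rewrite invr_eq0 (negbTE a0) invrK.
Qed.

Lemma inv_sph_pt (v : vect R) : nzv v -> inv_sph (pt v) = pt (v.2, v.1).
Proof.
case: v => a b; rewrite /nzv xpair_eqE /pt /=; case: (eqVneq b 0) => [->|b0] /=.
  by rewrite andbT => a0; rewrite (negbTE a0) mul0r.
move=> _; rewrite mulf_eq0 invr_eq0 (negbTE b0) orbF.
by case: eqVneq => // a0; rewrite invf_div.
Qed.

Lemma chord_inv_sph (x y : sphere R) : chord (inv_sph x) (inv_sph y) = chord x y.
Proof.
rewrite -(uvK x) -(uvK y) !inv_sph_pt ?uv_nz //.
have sw (v : vect R) : nzv v -> nzv (v.2, v.1) /\ hn (v.2, v.1) = hn v.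
  by case: v => a b; rewrite /nzv !xpair_eqE andbC /hn /= addrC.
have [n1 e1] := sw _ (uv_nz x); have [n2 e2] := sw _ (uv_nz y).
rewrite !chord_pt ?uv_nz // e1 e2; congr (_ * _ / _).
by rewrite -nrmN; congr nrm; rewrite /wdg /=; ring.
Qed.

(* Stands in for the plane C^1 diffeomorphisms, for which only the effect on curves matters. *)
Definition smop (A : C -> C) := forall (z : R -> C) t, C1c z t ->
  C1c (fun s => A (z s)) t /\ (dc z t = 0 -> dc (fun s => A (z s)) t = 0).

(** The map is read as A in the finite chart and as B in the chart 1 / z, which are the two
    alternatives offered by [smooth_piece]. *)
Definition charted (Phi : sphere R -> sphere R) (A B : C -> C) :=
  (forall z, Phi (Some z) = Some (A z)) /\
  (forall w, Phi (inv_sph (Some w)) = inv_sph (Some (B w))).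

Lemma C1fun_curve (x y : R -> R) : C1fun x -> C1fun y ->
  forall t, C1c (fun s => (x s +i* y s)%C : C) t.
Proof. by move=> /C1funP hx /C1funP hy t; split. Qed.

Lemma smop_piece A A' (x y : R -> R) (a b : R) : smop A -> smop A' -> cancel A A' ->
  C1fun x -> C1fun y -> (forall t, a <= t <= b -> derive1 x t != 0 \/ derive1 y t != 0) ->
  [/\ C1fun (fun t => complex.Re (A (x t +i* y t)%C)), C1fun (fun t => complex.Im (A (x t +i* y t)%C)) &
    forall t, a <= t <= b -> derive1 (fun t => complex.Re (A (x t +i* y t)%C)) t != 0 \/
      derive1 (fun t => complex.Im (A (x t +i* y t)%C)) t != 0].
Proof.
move=> sA sA' AK hx hy hd; have cz := C1fun_curve hx hy.
set z := fun s => _ in cz.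
split.
- by apply/C1funP => t; have [[h _] _] := sA z t (cz t).
- by apply/C1funP => t; have [[_ h] _] := sA z t (cz t).
move=> t /hd h; apply/orP; apply: contraT; rewrite negb_or !negbK => /andP[/eqP e1 /eqP e2].
have [cA _] := sA z t (cz t).
have dA : dc (fun s => A (z s)) t = 0 by rewrite /dc e1 e2.
have [_ /(_ dA)] := sA' _ t cA.
have -> : (fun s => A' (A (z s))) = z by apply/funext => s; rewrite AK.
by rewrite /dc /= => -[e3 e4]; case: h; rewrite ?e3 ?e4 eqxx.
Qed.

Lemma charted_good (Phi Psi : sphere R -> sphere R) A B A' B' : cancel Phi Psi -> cancel Psi Phi ->
  scont Phi -> scont Psi -> charted Phi A B -> smop A -> smop B -> smop A' -> smop B' ->
  cancel A A' -> cancel B B' -> goodmap Phi.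
Proof.
move=> PK KP cP cK [hA hB] sA sB sA' sB' AK BK; split; first by exists Psi.
move=> S [g [cg pg ig eS [m [tt [t0 t1 tmon hp]]]]].
exists (Phi \o g); split.
- move=> t e e0; have [d d0 hd] := cP (g t) e e0; have [d' d'0 hd'] := cg t d d0.
  by exists d' => // s /hd' /hd.
- by move=> t /=; rewrite pg.
- by move=> s t hs ht /= /(can_inj PK); exact: ig.
- rewrite eS; apply/seteqP; split=> z.
    by move=> [_ [t _ <-] <-]; exists t.
  by move=> [t _ <-]; exists (g t) => //; exists t.
exists m, tt; split=> // i im; have [x [y [hx hy hd [h|h]]]] := hp i im.
  have [h1 h2 h3] := smop_piece sA sA' AK hx hy hd.
  eexists; eexists; split; [exact: h1 | exact: h2 | exact: h3 | left=> t /h /= ->].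
  by rewrite hA; congr Some; case: (A _).
have [h1 h2 h3] := smop_piece sB sB' BK hx hy hd.
eexists; eexists; split; [exact: h1 | exact: h2 | exact: h3 | right=> t /h /= e].
by rewrite [g t]e; have /= -> := hB (x t +i* y t)%C; case: (B _).
Qed.

Lemma charted_inv Phi A B : charted Phi A B -> charted (fun z : sphere R => inv_sph (Phi (inv_sph z))) B A.
Proof.
move=> [hA hB]; split=> z; first by rewrite hB inv_sphK.
by rewrite inv_sphK hA.
Qed.

End Eucl.

(** * Twists about a point *)

Section Twist.
Variable R : realType.
Notation C := (Cplx R).
Implicit Types (z w c : C) (U : R -> C).

(** For a unimodular profile U, each circle about c is rotated, by the value of U at its squared
    radius. *)
Definition tw c U z := c + (z - c) * U (nrm (z - c) ^+ 2).

Definition tws c U (z : sphere R) : sphere R := if z is Some x then Some (tw c U x) else None.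

(** The twist read in the chart 1 / z. *)
Definition twinf c U w : C := if w == 0 then 0 else (tw c U w^-1)^-1.

(** Besides fixing a neighbourhood of infinity, the twist fixes 0, so that in the chart 1 / z it
    again maps the plane to itself. *)
Definition twistable c U := [/\ forall s, C1c U s, forall s, nrm (U s) = 1,
  exists L : R, forall s, L <= s -> U s = 1 & tw c U 0 = 0].

Lemma tw_nrm c U z : (forall s, nrm (U s) = 1) -> nrm (tw c U z - c) = nrm (z - c).
Proof. by move=> u1; rewrite /tw addrC addKr nrmM u1 mulr1. Qed.

Lemma twK c U : (forall s, nrm (U s) = 1) -> cancel (tw c U) (tw c (fun s => (U s)^-1)).
Proof.
move=> u1 z; rewrite {1}/tw tw_nrm // /tw.
have u0 : U (nrm (z - c) ^+ 2) != 0 by rewrite -nrm_gt0 u1.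
by rewrite (addrAC c) subrr add0r mulfK // addrC subrK.
Qed.

Lemma twistableV c U : twistable c U -> twistable c (fun s => (U s)^-1).
Proof.
move=> [h1 h2 [L hL] h4]; split.
- by move=> s; apply: C1c_V (h1 s); rewrite -nrm_gt0 h2.
- by move=> s; rewrite nrmV h2 invr1.
- by exists L => s /hL ->; rewrite invr1.
- by have := twK c h2 0; rewrite h4.
Qed.

Lemma smop_tw c U : twistable c U -> smop (tw c U).
Proof.
move=> [h1 _ _ _] z t hz.
have zc : C1c (fun s => z s - c) t by apply: C1c_D => //; exact: C1c_cst.
have cU : C1c (fun s => U (nrm (z s - c) ^+ 2)) t.
  have := C1c_comp (C1at_nsq zc) (h1 _); apply: C1c_near.
  by near=> s; rewrite nsqE.
split; first by apply: C1c_D; [exact: C1c_cst | exact: C1c_M].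
move=> d0; apply: is_dcE.
have dz : is_dc (fun s => z s - c) t 0.
  by rewrite -[0]addr0; apply: is_dc_D; [rewrite -d0; exact: C1c_dc | exact: is_dc_cst].
have dU : is_dc (fun s => U (nrm (z s - c) ^+ 2)) t 0.
  apply: (is_dc_near (z := fun s => U (nsq (fun s => z s - c) s))); first by near=> s; rewrite nsqE.
  have := is_dc_comp (is_derive_nsq dz) (C1c_dc (h1 _)).
  by rewrite /= !mul0r addr0 mulr0 mul0r.
have := is_dc_D (is_dc_cst c t) (is_dc_M dz dU).
by rewrite !(mul0r, mulr0, addr0).
Unshelve. all: by end_near. Qed.

Lemma near_none (M : R) : exists2 d : R, 0 < d & forall w : sphere R, chord None w < d ->
  w = None \/ exists2 b : C, w = Some b & M < nrm b.
Proof.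
pose N := Num.max 1 M; have N1 : 1 <= N by rewrite le_max lexx.
have N0 : 0 < N by lra.
have [|d d0 hd] := @eucl_le_chord R 0 N^-1; first by rewrite invr_gt0.
exists d => // -[b|]; [rewrite -(chord_inv_sph None) => /hd[w' /= e h]; right; exists b => // | by left].
move: e h; case: eqVneq => // b0 [<-]; rewrite subr0 nrmV ltf_pV2 ?posrE ?nrm_gt0 //.
by apply: le_lt_trans; rewrite le_max lexx orbT.
Qed.

Lemma tw_far c U : twistable c U -> exists L : R, forall z, L < nrm z -> tw c U z = z.
Proof.
move=> [_ _ [L hL] _]; exists (nrm c + (1 + `|L|)) => z hz.
have h : 1 + `|L| < nrm (z - c) by have := nrmBl z c; lra.
rewrite /tw hL ?mulr1 ?(addrC c) ?subrK //.
have := normr_ge0 L; have := ler_norm L; nra.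
Qed.

Lemma nrm_diff z w c : `|nrm (z - c) - nrm (w - c)| <= nrm (z - w).
Proof.
have h1 := nrmD (z - w) (w - c); have h2 := nrmD (w - z) (z - c).
rewrite !addrA !subrK in h1 h2; rewrite (nrmBC w z) in h2.
by rewrite ler_norml; apply/andP; split; lra.
Qed.

Lemma scont_tws c U : twistable c U -> scont (tws c U).
Proof.
move=> hU; have [h1 h2 _ _] := hU; have [L hL] := tw_far hU.
case=> [z|] e e0; last first.
  have [d d0 hd] := near_none L; exists (Num.min d e); first by rewrite lt_min d0.
  move=> w; rewrite lt_min => /andP[/hd[->|[b -> hb]] h //].
  by rewrite /= hL.
set r := nrm (z - c); have r0 : 0 <= r by exact: nrm_ge0.
have e1 : 0 < e / (4 * (r + 1)) by rewrite divr_gt0 // mulr_gt0 //; lra.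
have cr : C1c (fun s : R => U (s ^+ 2)) r.
  apply: (C1c_comp (f := fun s : R => s ^+ 2)) => //.
  by have := C1at_M (C1at_id r) (C1at_id r); apply: C1at_near; near=> s; rewrite expr2.
have [d d0 hd] := near_dist (C1c_cont cr e1).
have [|d' d'0 hd'] := @eucl_le_chord R z (Num.min (e / 8) d).
  by rewrite lt_min d0 divr_gt0.
exists d' => // _ /hd'[w -> hw]; rewrite /=.
apply: le_lt_trans (chord_le_eucl _ _) _.
move: hw; rewrite lt_min => /andP[w1 w2].
have /hd u : `|nrm (w - c) - r| < d by apply: le_lt_trans w2; rewrite nrm_diff.
have -> : tw c U z - tw c U w = (z - c) * (U (r ^+ 2) - U (nrm (w - c) ^+ 2))
   + (z - w) * U (nrm (w - c) ^+ 2) by rewrite /tw -/r; ring.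
apply: (@le_lt_trans _ _ (2 * (r * nrm (U (r ^+ 2) - U (nrm (w - c) ^+ 2)) + nrm (z - w)))).
  rewrite ler_pM2l //; apply: le_trans (nrmD _ _) _.
  by rewrite !nrmM h2 mulr1.
rewrite nrmBC in u; rewrite nrmBC in w1; set x := nrm (U _ - _) in u *.
have x0 : 0 <= x by exact: nrm_ge0.
have : r * x <= e / 4.
  have -> : e / 4 = (r + 1) * (e / (4 * (r + 1))) by field; lra.
  by apply: ler_pM => //; [lra | exact: ltW].
lra.
Unshelve. all: by end_near. Qed.

Lemma tw_neq0 c U z : twistable c U -> z != 0 -> tw c U z != 0.
Proof.
move=> [h1 h2 _ h4] z0; apply: contraNneq z0 => e.
by rewrite -(can_eq (twK c h2)) e h4.
Qed.

Lemma twinfK c U : twistable c U -> cancel (twinf c U) (twinf c (fun s => (U s)^-1)).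
Proof.
move=> hU w; rewrite /twinf; case: (eqVneq w 0) => [->|w0]; first by rewrite eqxx.
have n0 : tw c U w^-1 != 0 by apply: tw_neq0; rewrite ?invr_eq0.
by rewrite invr_eq0 (negbTE n0) invrK twK ?invrK //; case: hU.
Qed.

Lemma tws_charted c U : twistable c U -> charted (tws c U) (tw c U) (twinf c U).
Proof.
move=> hU; split=> // w; rewrite /twinf; have [->|w0] := eqVneq w 0; first by rewrite /= eqxx.
have n0 : tw c U w^-1 != 0 by apply: tw_neq0; rewrite ?invr_eq0.
by rewrite /= (negbTE w0) invr_eq0 (negbTE n0) invrK.
Qed.

Lemma C1c_near0 (z : R -> C) t (e : R) : C1c z t -> z t = 0 -> 0 < e ->
  \forall s \near t, nrm (z s) < e.
Proof. by move=> hz z0 e0; have := C1c_cont hz e0; apply: filterS => s; rewrite z0 subr0. Qed.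

Lemma C1c_near_neq0 (z : R -> C) t : C1c z t -> z t != 0 -> \forall s \near t, z s != 0.
Proof.
move=> hz z0; have zp : 0 < nrm (z t) by rewrite nrm_gt0.
have := C1c_cont hz zp; apply: filterS => s.
by apply: contraTneq => ->; rewrite sub0r nrmN ltxx.
Qed.

(** Where z vanishes the twist is locally the identity in this chart, being so near infinity;
    elsewhere it is a twist between two inversions. *)
Lemma smop_twinf c U : twistable c U -> smop (twinf c U).
Proof.
move=> hU z t hz; have [z0|z0] := eqVneq (z t) 0.
  have [L hL] := tw_far hU.
  have e : \forall s \near t, z s = twinf c U (z s).
    have L1 : 0 < (1 + `|L|)^-1 by rewrite invr_gt0; have := normr_ge0 L; lra.
    have := C1c_near0 hz z0 L1; apply: filterS => s hs; rewrite /twinf.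
    case: eqVneq => // s0; rewrite hL ?invrK // nrmV.
    apply: (@lt_trans _ _ (1 + `|L|)); first by have := ler_norm L; lra.
    by rewrite -[X in X < _]invrK ltf_pV2 ?posrE ?nrm_gt0.
  split; first exact: C1c_near hz.
  by move=> d0; apply: is_dcE; apply: (is_dc_near e); rewrite -d0; exact: C1c_dc.
have e : \forall s \near t, (tw c U (z s)^-1)^-1 = twinf c U (z s).
  by have := C1c_near_neq0 hz z0; apply: filterS => s hs; rewrite /twinf (negbTE hs).
have zV := C1c_V z0 hz; have [h1 h2] := smop_tw hU zV.
have n0 : tw c U (z t)^-1 != 0 by apply: tw_neq0; rewrite ?invr_eq0.
have h3 := C1c_V n0 h1; split; first exact: C1c_near h3.
move=> d0; apply: is_dcE; apply: (is_dc_near e).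
have -> : 0 = dc (fun s => (tw c U (z s)^-1)^-1) t; last exact: C1c_dc.
by rewrite (dc_V n0 h1) h2 ?mulr0 // (dc_V z0 hz) d0 mulr0.
Qed.

Lemma twsK c U : twistable c U -> cancel (tws c U) (tws c (fun s => (U s)^-1)).
Proof. by move=> [_ h _ _] [z|] //=; rewrite twK. Qed.

Lemma twsVK c U : twistable c U -> cancel (tws c (fun s => (U s)^-1)) (tws c U).
Proof.
move=> hU; have := twsK (twistableV hU).
by have -> : (fun s => ((U s)^-1)^-1) = U by apply/funext => s; rewrite invrK.
Qed.

Lemma tws_good c U : twistable c U -> goodmap (tws c U).
Proof.
move=> hU; have hV := twistableV hU; have h2 := let: And4 _ h2 _ _ := hU in h2.
apply: (charted_good (twsK hU) (twsVK hU) (scont_tws hU) (scont_tws hV) (tws_charted hU)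
  (smop_tw hU) (smop_twinf hU) (smop_tw hV) (smop_twinf hV) (twK c h2) (twinfK hU)).
Qed.

Lemma tws_good_inv c U : twistable c U -> goodmap (fun z : sphere R => inv_sph (tws c U (inv_sph z))).
Proof.
move=> hU; have hV := twistableV hU; have h2 := let: And4 _ h2 _ _ := hU in h2.
have K1 := twsK hU; have K2 := twsVK hU.
pose Psi := fun z : sphere R => inv_sph (tws c (fun s => (U s)^-1) (inv_sph z)).
have cj V : twistable c V -> scont (fun z : sphere R => inv_sph (tws c V (inv_sph z))).
  move=> sV z e e0; have [d d0 hd] := scont_tws sV (inv_sph z) e0.
  by exists d => // w; rewrite chord_inv_sph -(chord_inv_sph z) => /hd.
apply: (@charted_good R _ Psi _ _ _ _ _ _ _ _ (charted_inv (tws_charted hU)) (smop_twinf hU) (smop_tw hU) (smop_twinf hV) (smop_tw hV) (twinfK hU) (twK c h2)).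
- by move=> z; rewrite /Psi inv_sphK K1 inv_sphK.
- by move=> z; rewrite /Psi inv_sphK K2 inv_sphK.
- exact: cj.
- exact: cj.
Qed.

Lemma tws_off c U (r : R) (z : sphere R) : (forall s, r ^+ 2 <= s -> U s = 1) ->
  (forall x, z = Some x -> 0 <= r -> r <= nrm (x - c)) -> 0 <= r -> tws c U z = z.
Proof.
move=> hU hz r0; case: z hz => //= x /(_ x erefl r0) hx; rewrite /tw hU.
  by rewrite mulr1 addrC subrK.
by rewrite lerXn2r // nnegrE ?nrm_ge0.
Qed.

(** Only points within r of c move, by at most 2 r, and the chordal distance is at most twice the
    Euclidean one. *)
Lemma tws_disp c U (r : R) (z : sphere R) : (forall s, nrm (U s) = 1) ->
  (forall s, r ^+ 2 <= s -> U s = 1) -> 0 <= r -> chord z (tws c U z) <= 4 * r.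
Proof.
move=> u1 hU r0; case: z => [x|]; last by rewrite /=; lra.
have [h|h] := lerP r (nrm (x - c)).
  by rewrite (tws_off hU) ?chordzz; [lra | move=> ? [<-] | ].
apply: le_trans (chord_le_eucl _ _) _.
have -> : x - tw c U x = (x - c) * (1 - U (nrm (x - c) ^+ 2)) by rewrite /tw; ring.
rewrite nrmM; have : nrm (1 - U (nrm (x - c) ^+ 2)) <= 2.
  by apply: le_trans (nrmB _ _) _; rewrite u1 nrm1; lra.
have := nrm_ge0 (x - c); have := nrm_ge0 (1 - U (nrm (x - c) ^+ 2)); nra.
Qed.

End Twist.

(** * Bringing the boundary to a given point *)

Section ArcTwist.
Variable R : realType.
Notation C := (Cplx R).
Implicit Types (c : C) (U : R -> C).

(* A unimodular number other than -1 is (1 + i x) / (1 - i x) for a real x. *)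
Lemma unimodular_curve_neqN1 (u : C) (a b : R) : nrm u = 1 -> u != -1 -> a < b ->
  exists U, [/\ forall s, C1c U s, forall s, nrm (U s) = 1, U a = u & forall s, b <= s -> U s = 1].
Proof.
move=> u1 uN ab; have ba0 : b - a != 0 by rewrite subr_eq0 gt_eqF.
have E : complex.Re u ^+ 2 + complex.Im u ^+ 2 = 1 by rewrite -nrmE u1 expr1n.
have x1 : 1 + complex.Re u != 0.
  apply: contraNneq uN => h; have rx : complex.Re u = -1 by lra.
  have : complex.Im u ^+ 2 = 0 by move: E; rewrite rx sqrrN expr1n; lra.
  move/eqP; rewrite sqrf_eq0 => /eqP iy; apply/eqP/ReIm; first by rewrite rx.
  by rewrite iy /= oppr0.
pose xi := complex.Im u / (1 + complex.Re u).
pose chi s : R := step ((s - b) * (a - b)^-1).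
have cchi s : C1at chi s.
  apply: C1at_comp; last exact: C1at_step.
  by apply: C1at_M (C1at_cst _ _); apply: C1at_D (C1at_cst _ _); exact: C1at_id.
pose N s : C := (1 +i* (xi * chi s))%C; pose D s : C := (1 +i* (- (xi * chi s)))%C.
have D0 s : D s != 0.
  by apply: contraTneq isT => /(congr1 (@complex.Re R)) /= /eqP; rewrite oner_eq0.
have nND s : nrm (N s) = nrm (D s).
  by apply/eqP; rewrite -(@eqrXn2 _ 2) ?nrm_ge0 // !nrmE /= sqrrN.
have cN s : C1c N s.
  by split; [exact: C1at_cst | apply: C1at_M => //; exact: C1at_cst].
have cD s : C1c D s.
  by split; [exact: C1at_cst | apply: C1at_N; apply: C1at_M => //; exact: C1at_cst].
exists (fun s => N s * (D s)^-1); split.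
- by move=> s; apply: C1c_M => //; exact: C1c_V.
- by move=> s; rewrite nrmM nrmV nND mulfV // nrm_eq0.
- have -> : N a = u * D a.
    have ca : chi a = 1 by rewrite /chi mulfV ?step1 // -opprB oppr_eq0.
    apply: ReIm; rewrite ?(cReM u) ?(cImM u) /N /D /= ca /xi.
      apply: (mulIf x1); rewrite mul1r -{1}E.
      by set x := complex.Re u in x1 *; set y := complex.Im u; field.
    by set x := complex.Re u in x1 *; set y := complex.Im u; field.
  by rewrite mulfK.
- move=> s bs; have -> : N s = D s; last by rewrite mulfV.
  rewrite /N /D /chi step0 ?mulr0 ?oppr0 //.
  rewrite mulr_ge0_le0 ?subr_ge0 // invr_le0; lra.
Qed.

(** The exceptional value -1 is the square of i, so the curve for i is squared. *)
Lemma unimodular_curve (u : C) (a b : R) : nrm u = 1 -> a < b ->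
  exists U, [/\ forall s, C1c U s, forall s, nrm (U s) = 1, U a = u & forall s, b <= s -> U s = 1].
Proof.
move=> u1 ab; have [->|uN] := eqVneq u (-1); last exact: unimodular_curve_neqN1.
pose i : C := (0 +i* 1)%C.
have i1 : nrm i = 1.
  by apply/eqP; rewrite -(@eqrXn2 _ 2) ?nrm_ge0 // nrmE /= expr0n add0r.
have iN : i != -1.
  by apply: contraTneq isT => /(congr1 (@complex.Im R)) /= /eqP; rewrite oppr0 oner_eq0.
have [U [h1 h2 h3 h4]] := unimodular_curve_neqN1 i1 iN ab.
exists (fun s => U s * U s); split.
- by move=> s; exact: C1c_M.
- by move=> s; rewrite nrmM h2 mulr1.
- by rewrite h3; apply: ReIm; rewrite ?cReM ?cImM /=; ring.
- by move=> s /h4 ->; rewrite mulr1.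
Qed.

(** The distance to c is capped at 1 so that it extends continuously to infinity. *)
Definition eucd c (z : sphere R) : R := if z is Some x then Num.min 1 (nrm (x - c)) else 1.

Lemma eucd_ge0 c z : 0 <= eucd c z.
Proof. by case: z => //= x; rewrite le_min ler01 nrm_ge0. Qed.

Lemma eucd_eq0 c z : eucd c z = 0 -> z = Some c.
Proof.
case: z => [x|] /=; last by move/eqP; rewrite oner_eq0.
by case: lerP => [h /eqP|_ /eqP]; rewrite ?oner_eq0 // nrm_eq0 subr_eq0 => /eqP ->.
Qed.

Lemma eucd_lt1 c z (r : R) : eucd c z < r -> r <= 1 ->
  exists2 x, z = Some x & nrm (x - c) = eucd c z.
Proof.
case: z => [x|] /=; last by move=> h1 h2; have := lt_le_trans h1 h2; rewrite ltxx.
move=> h h1; exists x => //; apply/esym/min_idPr; rewrite leNgt; apply/negP => h2.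
by move: h; rewrite (min_idPl (ltW h2)) ltNge h1.
Qed.

Lemma eucd_cont c (z : sphere R) (e : R) : 0 < e -> exists2 d : R, 0 < d &
  forall w : sphere R, chord z w < d -> `|eucd c z - eucd c w| < e.
Proof.
move=> e0; case: z => [x|].
  have [d d0 hd] := eucl_le_chord x e0; exists d => // _ /hd[w -> hw] /=.
  apply: le_lt_trans hw; rewrite (nrmBC w x); have := nrm_diff x w c.
  rewrite !ler_norml => /andP[h1 h2].
  by case: (lerP 1 (nrm (x - c))); case: (lerP 1 (nrm (w - c))) => ? ?; apply/andP; split; lra.
have [d d0 hd] := near_none (1 + nrm c); exists d => // w /hd[->|[b -> hb]] /=.
  by rewrite subrr normr0.
have h : 1 <= nrm (b - c) by have := nrmBl b c; lra.
by rewrite (min_idPl h) subrr normr0.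
Qed.

Lemma ivt_any (f : R -> R) (s t v : R) : continuous f -> f s < v < f t -> exists u, f u = v.
Proof.
move=> cf /andP[h1 h2]; have [st|ts] := leP s t.
  have [||u _ <-] := @IVT _ f s t v st; last by exists u.
    exact: continuous_subspaceT.
  by rewrite ge_min le_max (ltW h1) (ltW h2) orbT.
have [||u _ <-] := @IVT _ f t s v (ltW ts); last by exists u.
  exact: continuous_subspaceT.
by rewrite ge_min le_max (ltW h1) (ltW h2) orbT.
Qed.

(** Isometric coordinate changes, in practice the identity or z -> 1 / z, that reduce twisting about
    infinity to twisting about a finite point. *)
Definition isochart (io : sphere R -> sphere R) := [/\ involutive io,
  forall x y, chord (io x) (io y) = chord x y &
  forall c U, twistable c U -> goodmap (fun z => io (tws c U (io z)))].

Lemma isochart_exists (p : sphere R) : exists2 io, isochart io & exists c, io p = Some c.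
Proof.
case: p => [c|].
  exists id; last by exists c.
  by split=> // c' U /tws_good.
exists (@inv_sph R); last by exists 0.
by split; [exact: inv_sphK | exact: chord_inv_sph | exact: tws_good_inv].
Qed.

Variable K : nat.

(* Twisting about [p] moves the intersection of the boundary with the circle of radius |y - p| to [y]. *)
Lemma point_twist (F : pmt R K) p (e : R) q : is_pmt F -> Bset F p -> 0 < e ->
  exists D : set (sphere R), [/\ exists2 d : R, 0 < d & sball p d `<=` D, q = p \/ ~ D q &
    forall y, D y -> y <> p -> exists phi, [/\ goodmap phi, forall z, chord z (phi z) < e,
      phi p = p, forall z, ~ D z -> phi z = z & exists2 b, Bset F b & phi b = y]].
Proof.
move=> hF [k Bp] e0; have [io [ioK ioC ioG] [c hc]] := isochart_exists p.
have [m [S [hS eS]]] := reg_psscc hF k.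
move: (Bp); rewrite eS => -[i Sp]; have [g [cg pg ig eg _]] := hS i.
have [tp _ gp] : range g p by rewrite -eg.
have gB t : Bset F (g t) by exists k; rewrite eS; exists i; rewrite eg; exists t.
have [t1 gt1] : exists t1, g t1 <> p.
  have [e1|e1] := pselect (g 0 = p); last by exists 0.
  exists 2^-1 => e2; have h2 : 0 < (2^-1 : R) < 1 by apply/andP; split; lra.
  have := ig 0 2^-1; rewrite lexx ltr01 e1 e2 (ltW (proj1 (andP h2))) (proj2 (andP h2)) => /(_ isT isT erefl).
  lra.
pose f t := eucd c (io (g t)).
have cf : continuous f.
  move=> t; apply/cvgrPdist_lt => e' e'0; have [d d0 hd] := eucd_cont c (io (g t)) e'0.
  have [d' d'0 hd'] := cg t d d0; apply/nbhs_ballP; exists d' => // s /= hs.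
  by apply: hd; rewrite ioC; apply: hd'.
have io_eq z : io z = Some c -> z = p by rewrite -hc => /(can_inj ioK).
have pos z : z <> p -> 0 < eucd c (io z).
  by move=> h; rewrite lt_neqAle eucd_ge0 andbT eq_sym; apply/eqP => /eucd_eq0 /io_eq.
have ftp : f tp = 0 by rewrite /f gp hc /= subrr nrm0; apply/min_idPr; exact: ler01.
pose a1 : R := if c == 0 then 1 else nrm c.
pose a2 : R := if q == p then 1 else eucd c (io q).
have a10 : 0 < a1 by rewrite /a1; case: eqVneq => // c0; rewrite nrm_gt0.
have a20 : 0 < a2 by rewrite /a2; case: eqVneq => // /eqP; exact: pos.
(* The radius is at most 1 to make [eucd] a true distance, e / 8 to bound the displacement 4 dl, a1
   to keep 0 fixed, a2 to leave q outside, and f t1 to make the boundary curve meet every smaller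
   circle. *)
pose dl : R := Num.min 1 (Num.min (e / 8) (Num.min a1 (Num.min a2 (f t1)))).
have dl0 : 0 < dl by rewrite !lt_min ltr01 a10 a20 pos // divr_gt0.
have [dl1 dle dla1 dla2 dlf] : [/\ dl <= 1, dl <= e / 8, dl <= a1, dl <= a2 & dl <= f t1].
  by rewrite /dl; split; rewrite !ge_min lexx ?orbT.
exists [set z | eucd c (io z) < dl]; split.
- have [d d0 hd] := eucd_cont c (io p) dl0; exists d => // z /= hz.
  have := hd (io z); rewrite ioC => /(_ hz); rewrite {1}hc /= subrr nrm0 (min_idPr ler01) sub0r normrN.
  by rewrite ger0_norm // eucd_ge0.
- case: (eqVneq q p) => [->|qp]; [by left | right=> /=; apply/negP; rewrite -leNgt].
  by move: dla2; rewrite /a2 (negbTE qp).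
move=> y /= yD yp; set r := eucd c (io y) in yD.
have r0 : 0 < r by exact: pos.
have [y0 iy ny] := eucd_lt1 yD dl1; rewrite -/r in ny.
have [t ft] : exists t, f t = r by apply: (@ivt_any f tp t1) => //; rewrite ftp r0 (lt_le_trans yD).
have [|x0 ix nx] := @eucd_lt1 c (io (g t)) dl _ dl1; first by rewrite -/(f t) ft.
rewrite -/(f t) ft in nx.
have x0c : x0 - c != 0 by rewrite -nrm_gt0 nx.
(* On the circle of radius r the twist turns the boundary point x0 into y0; it dies out at radius
   dl. *)
have [||U [U1 U2 U3 U4]] := @unimodular_curve ((y0 - c) / (x0 - c)) (r ^+ 2) (dl ^+ 2).
- by rewrite nrmM nrmV ny nx mulfV // gt_eqF.
- by rewrite ltr_pXn2r // nnegrE ltW.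
have hU : twistable c U.
  split=> //; first by exists (dl ^+ 2).
  rewrite /tw sub0r nrmN; case: (eqVneq c 0) => [->|c0]; first by rewrite oppr0 mul0r addr0.
  rewrite U4 ?mulr1 ?subrr // ler_pXn2r ?nnegrE ?nrm_ge0 ?(ltW dl0) //.
  by move: dla1; rewrite /a1 (negbTE c0).
exists (fun z => io (tws c U (io z))); split.
- exact: ioG.
- move=> z; rewrite -ioC ioK; apply: le_lt_trans (tws_disp c (io z) U2 U4 (ltW dl0)) _; lra.
- by rewrite hc /= /tw subrr mul0r addr0 -hc ioK.
- move=> z /negP; rewrite -leNgt => hz; rewrite (tws_off U4) ?ioK ?ltW // => x ex _.
  by move: hz; rewrite ex /= le_min => /andP[].
exists (g t) => //; rewrite ix /= /tw nx U3 mulrC divfK // addrC subrK -iy ioK //.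
Qed.

End ArcTwist.

(** * Matching two smooth arcs by a twist *)

Section ArcTwist2.
Variable R : realType.
Notation C := (Cplx R).
Implicit Types (c : C) (al be : R -> C).

Definition cdot (x y : C) : R := complex.Re x * complex.Re y + complex.Im x * complex.Im y.

Lemma cdotDr x y z : cdot x (y + z) = cdot x y + cdot x z.
Proof. by rewrite /cdot cReD cImD; ring. Qed.

Lemma cdotC x y : cdot x y = cdot y x.
Proof. by rewrite /cdot; ring. Qed.

Lemma cdotxx x : cdot x x = nrm x ^+ 2.
Proof. by rewrite nrmE /cdot !expr2. Qed.

Lemma cdotrZ (r : R) x y : cdot x (r%:C%C * y) = r * cdot x y.
Proof. by rewrite /cdot cReM cImM /=; ring. Qed.

Lemma common_direction (a b : C) : a != 0 -> b != 0 ->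
  exists2 v : C, cdot a v != 0 & cdot b v != 0.
Proof.
move=> a0 b0; have [h|h] := eqVneq (cdot b a) 0; last first.
  by exists a => //; rewrite cdotxx expf_eq0 /= nrm_eq0.
exists (a + b); rewrite cdotDr ?(cdotC a b) h ?addr0 ?add0r cdotxx expf_eq0 /= nrm_eq0 //.
Qed.

Lemma ex_pos_mul_lt (a b : R) : 0 < a -> 0 < b -> exists2 r : R, 0 < r & r * a < b.
Proof.
move=> a0 b0; exists (b / (2 * a)); first by rewrite divr_gt0 // mulr_gt0.
have -> : b / (2 * a) * a = b / 2 by field; lra.
lra.
Qed.

(** A C^1 reparametrisation that is the identity near s0 and constant farther away. Composed with
    it, a profile known only near s0 becomes a profile on the whole line. *)
Lemma cutoff (s0 r : R) : 0 < r -> exists th : R -> R,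
  [/\ forall s, C1at th s, forall s, `|th s - s0| < r, forall s, r <= `|s - s0| -> th s = s0 &
    forall s, `|s - s0| <= r / 2 -> th s = s].
Proof.
(* The value of u is at most 0 when |s - s0| >= r and at least 3/2 when |s - s0| <= r / 2. *)
move=> r0; pose u s := 2 + (-2 / r ^+ 2) * ((s - s0) * (s - s0)).
have r2 : 0 < r ^+ 2 by rewrite exprn_gt0.
exists (fun s => s0 + (s - s0) * step (u s)).
have far s : r <= `|s - s0| -> step (u s) = 0.
  move=> h; apply: step0; rewrite /u.
  have h2 : r ^+ 2 <= (s - s0) * (s - s0).
    by rewrite -expr2 -(real_normK (num_real (s - s0))) ler_pXn2r // nnegrE ltW.
  have : 1 <= (s - s0) * (s - s0) / r ^+ 2 by rewrite ler_pdivlMr // mul1r.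
  have -> : -2 / r ^+ 2 * ((s - s0) * (s - s0)) = - 2 * ((s - s0) * (s - s0) / r ^+ 2) by ring.
  lra.
split.
- move=> s; have cs : C1at (fun s => s - s0) s by apply: C1at_D (C1at_cst _ _); exact: C1at_id.
  apply: C1at_D; first exact: C1at_cst.
  apply: C1at_M => //; apply: C1at_comp; last exact: C1at_step.
  by apply: C1at_D; [exact: C1at_cst | apply: C1at_M; [exact: C1at_cst | exact: C1at_M]].
- move=> s; rewrite addrAC subrr add0r; have [h|h] := lerP r `|s - s0|.
    by rewrite far // mulr0 normr0.
  apply: le_lt_trans h; rewrite normrM ler_piMr // ger0_norm; by have /andP[] := step01 (u s).
- by move=> s h; rewrite far // mulr0 addr0.
move=> s h; rewrite step1 ?mulr1; first by rewrite addrC subrK.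
have h2 : (s - s0) * (s - s0) <= r ^+ 2 / 4.
  rewrite -expr2 -(real_normK (num_real (s - s0))).
  have -> : r ^+ 2 / 4 = (r / 2) ^+ 2 by field.
  by rewrite ler_pXn2r // nnegrE; lra.
have : (s - s0) * (s - s0) / r ^+ 2 <= 4^-1 by rewrite ler_pdivrMr //; lra.
rewrite /u; have -> : -2 / r ^+ 2 * ((s - s0) * (s - s0)) = - 2 * ((s - s0) * (s - s0) / r ^+ 2) by ring.
lra.
Qed.

(* Both arcs are parametrised by the squared distance to a centre c near the common point,
   and the twist rotates each circle about c so as to match them. *)
Lemma arc_twist al be (t0 s0 h e : R) (p : C) : 0 < h -> 0 < e -> p != 0 ->
  (forall t, `|t - t0| < h -> C1c al t) -> (forall s, `|s - s0| < h -> C1c be s) ->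
  al t0 = p -> be s0 = p -> dc al t0 != 0 -> dc be s0 != 0 ->
  exists phi, [/\ goodmap phi, forall z, chord z (phi z) < e,
    forall z : sphere R, e <= chord (Some p) z -> phi z = z &
    exists2 k : R, 0 < k & forall t, `|t - t0| < k ->
      exists2 s, `|s - s0| < h & phi (Some (be s)) = Some (al t)].
Proof.
move=> h0 e0 p0 Ca Cb eal ebe da db.
have [v va vb] := common_direction da db.
have v0 : v != 0 by apply: contraNneq va => ->; rewrite /cdot /= !mulr0 addr0.
have nv : 0 < nrm v by rewrite nrm_gt0.
have np : 0 < nrm p by rewrite nrm_gt0.
(* For the distance d from c to p: d < |p| / 8 keeps 0 outside the twisted disc of radius 2 d, and d
   < e / 16 controls the displacement, which is at most 8 d. *)
have m0 : 0 < Num.min (nrm p / 8) (e / 16) by rewrite lt_min !divr_gt0.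
have [rho rho0 hrho] := ex_pos_mul_lt nv m0.
(* The direction v is perpendicular to neither tangent, so the squared distance to c has nonzero
   derivative along both arcs at p. *)
pose c := p - rho%:C%C * v; have pc : p - c = rho%:C%C * v by rewrite /c opprB addrC subrK.
pose d := rho * nrm v.
have nd : nrm (p - c) = d by rewrite pc nrmM nrm_realC_gt0.
have d0 : 0 < d by rewrite /d mulr_gt0.
have [d8 d16] : d < nrm p / 8 /\ d < e / 16 by apply/andP; rewrite -lt_min.
have side (ga : R -> C) (u0 : R) : (forall t, `|t - u0| < h -> C1c ga t) -> ga u0 = p -> cdot (dc ga u0) v != 0 ->
    exists (r : R) (tau : R -> R), [/\ 0 < r,
      forall x : R, `|x - d ^+ 2| < r -> [/\ C1c (fun x => ga (tau x) - c) x, nrm (ga (tau x) - c) ^+ 2 = x & `|tau x - u0| < h],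
      tau (d ^+ 2) = u0 &
      exists2 k : R, 0 < k & forall t, `|t - u0| < k -> `|nrm (ga t - c) ^+ 2 - d ^+ 2| < r /\ tau (nrm (ga t - c) ^+ 2) = t].
  move=> Cg eg dg; pose f := nsq (fun t => ga t - c).
  have fE t : f t = nrm (ga t - c) ^+ 2 by rewrite /f nsqE.
  have Cgc t : `|t - u0| < h -> C1c (fun t => ga t - c) t.
    by move=> ht; apply: C1c_D; [exact: Cg | exact: C1c_cst].
  have Cf t : `|t - u0| < h -> C1at f t by move=> ht; apply: C1at_nsq; exact: Cgc.
  have hu : `|u0 - u0| < h by rewrite subrr normr0.
  have df : f^`()%classic u0 != 0.
    have dd : is_dc (fun t => ga t - c) u0 (dc ga u0).
      by rewrite -[dc _ _]addr0; apply: is_dc_D; [exact: C1c_dc (Cg _ hu) | exact: is_dc_cst].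
    rewrite (is_derive1E (is_derive_nsq dd)) eg pc -/(cdot (dc ga u0) (rho%:C%C * v)) cdotrZ.
    by rewrite !mulf_neq0 // gt_eqF.
  have [r [tau [r0 h1 [k k0 h2]]]] := loc_inv h0 Cf df.
  have fu : f u0 = d ^+ 2 by rewrite fE eg nd.
  rewrite fu in h1 h2; exists r, tau; split=> //.
  - move=> x /h1[c1 c2 c3]; split=> //; last by rewrite -fE.
    exact: (C1c_comp (z := fun t => ga t - c) c1 (Cgc _ c3)).
  - by have [_] := h2 u0 ltac:(by rewrite subrr normr0); rewrite fu.
  - by exists k => // t /h2; rewrite fE.
have [ra [ta [ra0 Ha ta0 [ka ka0 Ka]]]] := side al t0 Ca eal va.
have [rb [tb [rb0 Hb tb0 _]]] := side be s0 Cb ebe vb.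
have dd0 : 0 < d ^+ 2 by rewrite exprn_gt0.
pose r : R := Num.min ra (Num.min rb (d ^+ 2 / 2)).
have r0 : 0 < r by rewrite !lt_min ra0 rb0 divr_gt0.
have [rra rrb rd] : [/\ r <= ra, r <= rb & r <= d ^+ 2 / 2].
  by rewrite /r; split; rewrite !ge_min lexx ?orbT.
have [th [th1 th2 th3 th4]] := cutoff (d ^+ 2) r0.
(* The rotation taking the point of [be] on the circle of squared radius x to the point of [al] on
   it. *)
pose W x := (al (ta x) - c) * (be (tb x) - c)^-1.
have b0 x : `|x - d ^+ 2| < r -> be (tb x) - c != 0.
  move=> hx; have [_ e2 _] := Hb x (lt_le_trans hx rrb).
  apply/negP => /eqP be0; move: hx; rewrite -e2 be0 nrm0 expr0n sub0r normrN.
  by have := ler_norm (d ^+ 2); lra.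
have W1 x : `|x - d ^+ 2| < r -> C1c W x.
  move=> hx; have [c1 _ _] := Ha x (lt_le_trans hx rra); have [c2 _ _] := Hb x (lt_le_trans hx rrb).
  by apply: C1c_M => //; apply: C1c_V => //; exact: b0.
have W2 x : `|x - d ^+ 2| < r -> nrm (W x) = 1.
  move=> hx; have [_ e1 _] := Ha x (lt_le_trans hx rra); have [_ e2 _] := Hb x (lt_le_trans hx rrb).
  rewrite /W nrmM nrmV; have -> : nrm (al (ta x) - c) = nrm (be (tb x) - c).
    by apply/eqP; rewrite -(@eqrXn2 _ 2) ?nrm_ge0 // e1 e2.
  by rewrite mulfV // nrm_eq0 b0.
have W0 : W (d ^+ 2) = 1.
  rewrite /W ta0 tb0 eal ebe mulfV //; rewrite -nrm_eq0 nd gt_eqF //.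
pose U x := W (th x).
have U4 s : (2 * d) ^+ 2 <= s -> U s = 1.
  move=> hs; rewrite /U th3 ?W0 //; apply: le_trans (ler_norm _).
  have : (2 * d) ^+ 2 = 4 * d ^+ 2 by ring.
  lra.
have hU : twistable c U.
  split.
  - by move=> s; apply: C1c_comp; [exact: th1 | exact: W1].
  - by move=> s; exact: W2.
  - by exists ((2 * d) ^+ 2).
  - rewrite /tw U4 ?mulr1; first by rewrite addrC subrK.
    rewrite sub0r nrmN ler_pXn2r ?nnegrE ?nrm_ge0 //; last by lra.
    have := nrmBl p c; rewrite nd; lra.
have [_ U2 _ _] := hU; have d2 : 0 <= 2 * d by lra.
exists (tws c U); split.
- exact: tws_good.
- by move=> z; apply: le_lt_trans (tws_disp c z U2 U4 d2) _; lra.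
- move=> z hz; apply: (tws_off U4) => // x ex _; rewrite ex in hz.
  have := chord_le_eucl p x; have := nrmD (p - c) (c - x).
  by rewrite addrA subrK nd (nrmBC c x); lra.
pose C1 t := `|nrm (al t - c) ^+ 2 - d ^+ 2| <= r / 2.
have [k1 k10 Hk1] : exists2 k : R, 0 < k & forall t, `|t - t0| < k -> C1 t.
  apply: near_dist.
  have cn : {for t0, continuous (nsq (fun t => al t - c))}.
    apply: C1at_cont; apply: C1at_nsq; apply: C1c_D; last exact: C1c_cst.
    by apply: Ca; rewrite subrr normr0.
  have r2 : 0 < r / 2 by rewrite divr_gt0.
  have /cvgrPdist_lt /(_ _ r2) := cn; apply: filterS => t.
  by rewrite !nsqE eal nd distrC /C1 => /ltW.
exists (Num.min ka k1); first by rewrite lt_min ka0.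
move=> t; rewrite lt_min => /andP[/Ka[_ et] /Hk1 ht]; rewrite /C1 in ht.
set x := nrm (al t - c) ^+ 2 in et ht.
have hx : `|x - d ^+ 2| < r by lra.
have [_ e2 e3] := Hb x (lt_le_trans hx rrb).
exists (tb x) => //; rewrite /= /tw e2 /U th4 // /W et; congr Some.
by rewrite mulrC divfK ?b0 // addrC subrK.
Qed.

End ArcTwist2.

(** * Coincidences *)

Section Baire.
Variable R : realType.
Notation C := (Cplx R).
Notation M2 := 'M[C]_2.
Notation o0 := (ord0 : 'I_2).
Notation o1 := (ord_max : 'I_2).
Implicit Types (S T M : M2) (r : nat -> R).

(** The intervals [u n - r n, u n + r n] are nested, and the supremum of their left ends lies in all
    of them. *)
Lemma real_limit (u : nat -> R) r : (forall n, `|u n.+1 - u n| <= r n / 2) ->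
  (forall n, r n.+1 <= r n / 2) -> exists l, forall n, `|l - u n| <= r n.
Proof.
move=> hu hr; have r0 n : 0 <= r n by have := le_trans (normr_ge0 _) (hu n); lra.
have ha : {homo (fun n => u n - r n) : n m / (n <= m)%N >-> n <= m}.
  apply: homo_leq => [x|y x z|k]; [exact: lexx | exact: le_trans |].
  by have := hu k; rewrite ler_norml => /andP[]; have := hr k; lra.
have hb : {homo (fun n => u n + r n) : n m / (n <= m)%N >-> n >= m}.
  apply: (homo_leq (r := fun x y => y <= x)) => [x|y x z h1 h2|k]; [exact: lexx | exact: le_trans h2 h1 |].
  by have := hu k; rewrite ler_norml => /andP[]; have := hr k; lra.
have hab n m : u n - r n <= u m + r m.
  have := ha _ _ (leq_maxl n m); have := hb _ _ (leq_maxr n m).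
  by have := r0 (maxn n m); lra.
pose A := [set u n - r n | n in [set: nat]].
have sA (m : nat) : has_ubound A by exists (u m + r m) => _ [n _ <-].
have A0 : A !=set0 by exists (u 0%N - r 0%N), 0%N.
exists (sup A) => n; rewrite ler_norml; apply/andP; split.
  have : u n - r n <= sup A by apply: ub_le_sup; [exact: (sA n) | exists n].
  lra.
have : sup A <= u n + r n by apply: ge_sup => // _ [m _ <-].
lra.
Qed.

Lemma nrm_ge_Re (z : C) : `|complex.Re z| <= nrm z.
Proof.
rewrite -(@ler_pXn2r _ 2) ?nnegrE ?nrm_ge0 // nrmE real_normK ?num_real //.
by rewrite lerDl sqr_ge0.
Qed.

Lemma nrm_le_ReIm (z : C) : nrm z <= `|complex.Re z| + `|complex.Im z|.
Proof.
rewrite -(@ler_pXn2r _ 2) ?nnegrE ?nrm_ge0 ?addr_ge0 // nrmE.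
rewrite -(real_normK (num_real (complex.Re z))) -(real_normK (num_real (complex.Im z))).
by have := normr_ge0 (complex.Re z); have := normr_ge0 (complex.Im z); nra.
Qed.

Lemma cReB (x y : C) : complex.Re (x - y) = complex.Re x - complex.Re y.
Proof. by case: x y => a b [c d]. Qed.
Lemma cImB (x y : C) : complex.Im (x - y) = complex.Im x - complex.Im y.
Proof. by case: x y => a b [c d]. Qed.

Lemma complex_limit (u : nat -> C) r : (forall n, nrm (u n.+1 - u n) <= r n / 2) ->
  (forall n, r n.+1 <= r n / 2) -> exists l, forall n, nrm (l - u n) <= 2 * r n.
Proof.
move=> hu hr.
have [|a ha] := @real_limit (fun n => complex.Re (u n)) r _ hr.
  by move=> n; rewrite -cReB; apply: le_trans (nrm_ge_Re _) (hu n).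
have [|b hb] := @real_limit (fun n => complex.Im (u n)) r _ hr.
  by move=> n; rewrite -cImB; apply: le_trans (nrm_ge_Im _) (hu n).
exists (a +i* b)%C => n; apply: le_trans (nrm_le_ReIm _) _; rewrite cReB cImB /=.
by have := ha n; have := hb n; lra.
Qed.

Lemma nrm_mnB S T i j : nrm (S i j - T i j) <= mn (S - T).
Proof. by have := nrm_mn (S - T) i j; rewrite !mxE. Qed.

Lemma mx_limit (S : nat -> M2) r : (forall n, mn (S n.+1 - S n) <= r n / 2) ->
  (forall n, r n.+1 <= r n / 2) -> exists L, forall n, mn (L - S n) <= 8 * r n.
Proof.
move=> hS hr.
have H i j : exists l, forall n, nrm (l - S n i j) <= 2 * r n.
  by apply: complex_limit hr => n; apply: le_trans (nrm_mnB _ _ _ _) (hS n).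
have [a ha] := H o0 o0; have [b hb] := H o0 o1; have [c hc] := H o1 o0; have [d hd] := H o1 o1.
exists (mk2 a b c d) => n; rewrite /mn ![(_ - S n) _ _]mxE ![(- S n) _ _]mxE !mk2E.
by have := ha n; have := hb n; have := hc n; have := hd n; lra.
Qed.

Lemma det_limit L (S : nat -> M2) r : (forall n, \det (S n) = 1) ->
  (forall n, mn (L - S n) <= 8 * r n) -> (forall n, r n.+1 <= r n / 2) -> \det L = 1.
Proof.
move=> dS hL hr; apply/eqP; rewrite -subr_eq0 -nrm_eq0 eq_le nrm_ge0 andbT.
rewrite leNgt; apply/negP; set x := nrm _ => x0.
have rX n : r n <= r 0%N * 2^-1 ^+ n.
  elim: n => [|n IH]; first by rewrite expr0 mulr1.
  by apply: le_trans (hr n) _; rewrite exprS; lra.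
have r0 : 0 <= r 0%N by have := le_trans (mn_ge0 _) (hL 0%N); lra.
have dd n : x <= mn (L - S n) * (2 * mn L + mn (L - S n)).
  rewrite /x -(dS n) !det2; set a := L o0 o0; set b := L o0 o1; set c := L o1 o0; set d := L o1 o1.
  have -> : a * d - b * c - (S n o0 o0 * S n o1 o1 - S n o0 o1 * S n o1 o0) =
    ((a - S n o0 o0) * d + a * (d - S n o1 o1) - (a - S n o0 o0) * (d - S n o1 o1)) -
    ((b - S n o0 o1) * c + b * (c - S n o1 o0) - (b - S n o0 o1) * (c - S n o1 o0)) by ring.
  rewrite /mn ![(L - S n) _ _]mxE ![(- S n) _ _]mxE -/a -/b -/c -/d.
  set a' := a - _; set b' := b - _; set c' := c - _; set d' := d - _.
  apply: le_trans (nrmB _ _) _.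
  apply: le_trans (lerD (nrmB _ _) (nrmB _ _)) _.
  have h1 := nrmD (a' * d) (a * d'); have h2 := nrmD (b' * c) (b * c').
  rewrite !nrmM in h1 h2 *.
  have := nrm_ge0 a; have := nrm_ge0 b; have := nrm_ge0 c; have := nrm_ge0 d.
  have := nrm_ge0 a'; have := nrm_ge0 b'; have := nrm_ge0 c'; have := nrm_ge0 d'.
  nra.
pose c := 8 * r 0%N * (2 * mn L + 8 * r 0%N).
have [N /(_ N (leqnn N)) hN] := @expr_small R 2^-1 c x ltac:(by apply/andP; split; lra) x0.
have := dd N; have h1 := hL N; have h2 := rX N; have := mn_ge0 (L - S N); have := mn_ge0 L.
have h3 : 2^-1 ^+ N <= 1 :> R by apply: exprn_ile1; lra.
have h4 : 0 <= 2^-1 ^+ N :> R by apply: exprn_ge0; lra.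
move=> l0 y0 hx; move: (mn (L - S N)) h1 y0 hx => y h1 y0 hx.
move: (2^-1 ^+ N) h2 h3 h4 hN; rewrite {}/c; move: (mn L) l0 hx => l l0 hx p h2 h3 h4 hN.
have yp : y <= 8 * r 0%N * p by lra.
have y8 : y <= 8 * r 0%N by apply: le_trans yp _; rewrite ler_piMr //; lra.
have : y * (2 * l + y) <= 8 * r 0%N * p * (2 * l + 8 * r 0%N).
  by apply: ler_pM => //; lra.
have -> : 8 * r 0%N * p * (2 * l + 8 * r 0%N) = 8 * r 0%N * (2 * l + 8 * r 0%N) * p by ring.
lra.
Qed.

(* The Baire category theorem in SL2, with neighbourhoods of S written S T for T near 1. *)
Lemma sl2_baire (I : countType) (P : I -> M2 -> Prop) (e : R) :
  (forall i S, \det S = 1 -> P i S -> exists2 d : R, 0 < d & forall T, \det T = 1 ->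
    mn (T - 1%:M) < d -> P i (S *m T)) ->
  (forall i S (d : R), \det S = 1 -> 0 < d -> exists T, [/\ \det T = 1, mn (T - 1%:M) < d & P i (S *m T)]) ->
  0 < e -> exists S, [/\ \det S = 1, mn (S - 1%:M) < e & forall i, P i S].
Proof.
move=> hopen hdense e0.
pose Q n S := if unpickle n is Some i then P i S else True.
pose ok (x : nat * M2 * R) := \det x.1.2 = 1 /\ 0 < x.2.
(* A state is the index of the next condition, a centre and a radius. The condition must hold on the
   whole ball of radius 8 r about the new centre, since 8 r is the error bound of [mx_limit]. *)
pose Rel (x y : nat * M2 * R) := ok x -> [/\ ok y, y.1.1 = x.1.1.+1, y.2 <= x.2 / 2,
   mn (y.1.2 - x.1.2) <= x.2 / 2 & forall L, \det L = 1 -> mn (L - y.1.2) <= 8 * y.2 -> Q x.1.1 L].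
have /choice[g hg] : forall x, exists y, Rel x y.
  move=> [[n S] r]; have [[/= dS r0]|nok] := pselect (ok (n, S, r)); last by exists (n, S, r).
  have mS : 0 <= mn S by exact: mn_ge0.
  have p : 0 < r / 2 / (mn S + 1) by rewrite !divr_gt0 //; lra.
  have [T [dT nT [d d0 hd]]] : exists T, [/\ \det T = 1, mn (T - 1%:M) < r / 2 / (mn S + 1) &
      exists2 d : R, 0 < d & forall T', \det T' = 1 -> mn (T' - 1%:M) < d -> Q n (S *m T *m T')].
    rewrite /Q; case: (unpickle n) => [i|].
      have [T [dT nT PT]] := hdense i S _ dS p; exists T; split=> //.
      by apply: hopen => //; exact: det_mul1.
    by exists 1%:M; rewrite det1 subrr /mn !mxE nrm0 !addr0; split=> //; exists 1.
  have dST : \det (S *m T) = 1 by exact: det_mul1.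
  have mST : 0 <= mn (S *m T) by exact: mn_ge0.
  have q : 0 < d / (16 * (mn (S *m T) + 1)) by rewrite divr_gt0 // mulr_gt0 //; lra.
  exists (n.+1, S *m T, Num.min (r / 2) (d / (16 * (mn (S *m T) + 1)))) => _; split=> //=.
  - by split=> //=; rewrite lt_min q divr_gt0.
  - by rewrite ge_min lexx.
  - have -> : S *m T - S = S *m (T - 1%:M) by rewrite mulmxBr mulmx1.
    apply: le_trans (mnM _ _) _; apply: (@le_trans _ _ ((mn S + 1) * (r / 2 / (mn S + 1)))).
      by apply: ler_pM; rewrite ?mn_ge0 //; [lra | exact: ltW].
    by have -> : (mn S + 1) * (r / 2 / (mn S + 1)) = r / 2 by field; lra.
  move=> L dL hL; have -> : L = S *m T *m (inv2 (S *m T) *m L) by rewrite mulmxA mulmV // mul1mx.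
  apply: hd; first by rewrite det_mul1 // det_inv2.
  have -> : inv2 (S *m T) *m L - 1%:M = inv2 (S *m T) *m (L - S *m T).
    by rewrite mulmxBr mulVm.
  apply: le_lt_trans (mnM _ _) _; rewrite mn_inv2.
  have h1 : mn (L - S *m T) <= 8 * (d / (16 * (mn (S *m T) + 1))).
    by apply: le_trans hL _; rewrite ler_pM2l // ge_min lexx orbT.
  apply: (@le_lt_trans _ _ ((mn (S *m T) + 1) * (8 * (d / (16 * (mn (S *m T) + 1)))))).
    by apply: ler_pM; rewrite ?mn_ge0 //; lra.
  have -> : (mn (S *m T) + 1) * (8 * (d / (16 * (mn (S *m T) + 1)))) = d / 2 by field; lra.
  lra.
pose f n := iter n g (0%N, 1%:M, e / 16).
have okf n : ok (f n).
  by elim: n => [|n IH]; [split; rewrite /= ?det1 //; lra | have [] := hg _ IH].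
have fn n : (f n).1.1 = n.
  by elim: n => //= n IH; have [_ ->] := hg _ (okf n); rewrite -/(f n) IH.
have rf n : (f n.+1).2 <= (f n).2 / 2 by have [] := hg _ (okf n).
have [||L hL] := @mx_limit (fun n => (f n).1.2) (fun n => (f n).2).
- by move=> n; have [] := hg _ (okf n).
- exact: rf.
have dL : \det L = 1 by apply: det_limit hL rf => n; have [] := okf n.
exists L; split=> //; first by apply: le_lt_trans (hL 0%N) _ => /=; lra.
move=> i; have [_ _ _ _ hi] := hg _ (okf (pickle i)).
have := hi L dL (hL (pickle i).+1).
by rewrite fn /Q pickleK.
Qed.

End Baire.

(** * Generic conjugates and coincidences *)

Section GenericConjugate.
Variables (R : realType) (K : nat).
Notation C := (Cplx R).
Notation M2 := 'M[C]_2.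
Notation mats := ('I_K -> M2).
Notation o0 := (ord0 : 'I_2).
Notation o1 := (ord_max : 'I_2).
Implicit Types (F G : pmt R K) (z q x : sphere R) (k : 'I_K) (w v : seq 'I_K) (S T M : M2) (A : mats).

Lemma mob_near1 T x : \det T = 1 -> chord x (mob T x) <= 4 * mn (T - 1%:M).
Proof.
move=> dT; have := @mob_near R 1%:M T x (det1 _ _) dT.
by rewrite mob1 mn1 mnBC; lra.
Qed.

Lemma mn_inv21 T : mn (inv2 T - 1%:M) = mn (T - 1%:M).
Proof.
have -> : (1%:M : M2) = inv2 1%:M by apply: eq_mx2; rewrite !mxE //= oppr0.
rewrite inv2B mn_inv2; congr (mn (_ - _)).
by apply: eq_mx2; rewrite !mxE //= oppr0.
Qed.

Lemma mob_near1V T x : \det T = 1 -> chord x (mob (inv2 T) x) <= 4 * mn (T - 1%:M).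
Proof. by move=> dT; rewrite -mn_inv21 mob_near1 // det_inv2. Qed.

Lemma inv2M S T : inv2 (S *m T) = inv2 T *m inv2 S.
Proof. by apply: eq_mx2; rewrite !mulmx2 !mk2E !mulmx2; ring. Qed.

Lemma cjM S T M : cj (S *m T) M = cj T (cj S M).
Proof. by rewrite /cj inv2M !mulmxA. Qed.

Lemma cj_cont M (e : R) : \det M = 1 -> 0 < e -> exists2 d : R, 0 < d & forall T q,
  \det T = 1 -> mn (T - 1%:M) < d -> chord (mob M q) (mob (cj T M) q) < e.
Proof.
move=> dM e0; have m0 := sqr_ge0 (mn M); set m := mn M ^+ 2 in m0.
have p : 0 < 4 * (m + 1) by lra.
exists (e / (4 * (m + 1))); first by rewrite divr_gt0.
move=> T q dT hT; rewrite mob_cj //.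
apply: le_lt_trans (chord_tri (mob M (mob T q)) _ _) _.
have h1 := chord_mob_le q (mob T q) dM; have h2 := mob_near1 q dT.
have h3 := mob_near1V (mob M (mob T q)) dT.
have h4 : m * chord q (mob T q) <= m * (4 * mn (T - 1%:M)) by rewrite ler_wpM2l.
have h5 : mn (T - 1%:M) * (4 * (m + 1)) < e by rewrite -ltr_pdivlMr.
rewrite -/m in h1; lra.
Qed.

Lemma mn_prod1 S T : mn (S *m T - 1%:M) <= mn S * mn (T - 1%:M) + mn (S - 1%:M).
Proof.
have -> : S *m T - 1%:M = S *m (T - 1%:M) + (S - 1%:M).
  by rewrite mulmxBr mulmx1 addrA subrK.
by apply: le_trans (mnD _ _) _; rewrite lerD2r mnM.
Qed.

Section Dense.
Variable F : pmt R K.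
Hypothesis PF : is_pmt F.

Lemma inv_dense q (d : R) : 0 < d -> exists T,
  [/\ \det T = 1, mn (T - 1%:M) < d & Rset F (mob (inv2 T) q)].
Proof.
move=> d0; have [a aq] := other_pt q; have [|e e0 he] := @tv_small R a q (d / 4) aq; first by rewrite divr_gt0.
have [w Rw cw] := Rset_dense PF q e0.
have [|t [ht et]] := he q w _ cw; first by rewrite chordzz.
exists (tv a (- t)); rewrite det_tv inv2_tv opprK et; split=> //.
by apply: le_lt_trans (mn_tv1 _ _) _; rewrite nrmN; lra.
Qed.

(** If T fixes q, the conjugate sends q to T^-1 (M q), and transvections fixing q move M q in every
    direction. *)
Lemma cj_dense_moved M q (d : R) : \det M = 1 -> mob M q <> q -> 0 < d -> exists T,
  [/\ \det T = 1, mn (T - 1%:M) < d & Rset F (mob (cj T M) q)].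
Proof.
move=> dM /eqP; rewrite eq_sym => nq d0.
have [|e e0 he] := @tv_small R q (mob M q) (d / 4) nq; first by rewrite divr_gt0.
have [w Rw cw] := Rset_dense PF (mob M q) e0.
have [|t [ht et]] := he (mob M q) w _ cw; first by rewrite chordzz.
exists (tv q (- t)); rewrite det_tv mob_cj ?det_tv // inv2_tv opprK mob_tv_fix et; split=> //.
by apply: le_lt_trans (mn_tv1 _ _) _; rewrite nrmN; lra.
Qed.

(** If q is fixed by M, a first conjugation takes q to a nearby point that M moves, and the previous
    case applies. *)
Lemma cj_dense M q (d : R) : \det M = 1 -> (exists z, mob M z <> z) -> 0 < d -> exists T,
  [/\ \det T = 1, mn (T - 1%:M) < d & Rset F (mob (cj T M) q)].
Proof.
move=> dM hM d0; have [fq|] := pselect (mob M q = q); last by move=> h; exact: cj_dense_moved.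
have [L hL] := fix_fin hM; have [a aq] := other_pt q.
have [|e e0 he] := @tv_small R a q (d / 8) aq; first by rewrite divr_gt0.
have [q' q'L cq'] := near_avoid q L e0.
have [|t [ht et]] := he q q' _ cq'; first by rewrite chordzz.
set T0 := tv a t in et; have dT0 : \det T0 = 1 by exact: det_tv.
have n0 : mn (T0 - 1%:M) < d / 2 by apply: le_lt_trans (mn_tv1 _ _) _; lra.
have m0 : 0 <= mn T0 by exact: mn_ge0.
have [|||T1 [dT1 n1 h1]] := @cj_dense_moved (cj T0 M) q (d / 2 / (mn T0 + 1)).
- exact: det_cj.
- rewrite mob_cj // et => e1; move/negP: q'L; apply; apply: hL.
  by rewrite -[LHS](mobVK dT0) e1.
- by rewrite !divr_gt0 //; lra.
exists (T0 *m T1); rewrite det_mul1 // cjM; split=> //.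
apply: le_lt_trans (mn_prod1 _ _) _.
have : mn T0 * mn (T1 - 1%:M) <= d / 2.
  have -> : d / 2 = (mn T0 + 1) * (d / 2 / (mn T0 + 1)) by rewrite [RHS]mulrC divfK // gt_eqF // ltr_wpDl.
  by apply: ler_pM; rewrite ?mn_ge0 //; [lra | exact: ltW].
lra.
Qed.

(** Each pair of a point and a word, and each fixed point of a word, imposes an open dense condition
    on S. Fixed points of the conjugated word are the images under S^-1 of the original ones,
    finitely many for each word. *)
Lemma generic_conj (I : countType) (Q : I -> sphere R) A n (e : R) :
  (forall k, \det (A k) = 1) -> (forall w, size w = n -> exists z, mob (Mw A w) z <> z) -> 0 < e ->
  exists S, [/\ \det S = 1, mn (S - 1%:M) < e,
    forall i w, size w = n -> Rset F (mob (Mw (fun k => cj S (A k)) w) (Q i)) &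
    forall w z, size w = n -> mob (Mw (fun k => cj S (A k)) w) z = z -> Rset F z].
Proof.
move=> dA hA e0.
have /choice[L hL] : forall w, exists L : seq (sphere R), size w = n -> forall z, mob (Mw A w) z = z -> z \in L.
  move=> w; have [/hA/fix_fin[L hL]|] := pselect (size w = n); last by exists [::].
  by exists L.
(* Indices j beyond the list contribute the default point None, a harmless further condition. *)
pose P (i : (I * seq 'I_K) + (seq 'I_K * nat)) S : Prop := match i with
  | inl (i, w) => size w = n -> Rset F (mob (cj S (Mw A w)) (Q i))
  | inr (w, j) => Rset F (mob (inv2 S) (nth None (L w) j)) end.
have dM w : \det (Mw A w) = 1 by exact: det_Mw.
have [||S [dS nS hS]] := @sl2_baire R _ P e _ _ e0.
- move=> [[i w]|[w j]] S dS /=.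
    have [sw|] := pselect (size w = n); last by exists 1.
    move=> /(_ sw) /(Rset_open PF)[r r0 hr].
    have [d d0 hd] := cj_cont (det_cj dS (dM w)) r0.
    by exists d => // T dT nT _; rewrite cjM; apply: hr; exact: hd.
  move=> /(Rset_open PF)[r r0 hr]; exists (r / 4); first by rewrite divr_gt0.
  move=> T dT nT; rewrite inv2M mobM ?det_inv2 //; apply: hr.
  by apply: le_lt_trans (mob_near1V _ dT) _; lra.
- move=> [[i w]|[w j]] S d dS d0 /=.
    have [sw|nw] := pselect (size w = n); last first.
      by exists 1%:M; rewrite det1 subrr /mn !mxE nrm0 !addr0; split.
    have [|T [dT nT hT]] := @cj_dense (cj S (Mw A w)) (Q i) d (det_cj dS (dM w)) _ d0.
      have [z hz] := hA w sw; exists (mob (inv2 S) z); rewrite mob_cj // mobVK //.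
      by move=> /(@mob_inj _ _ _) ez; apply: hz; apply: ez; rewrite det_inv2.
    by exists T; split=> // _; rewrite cjM.
  have [T [dT nT hT]] := inv_dense (mob (inv2 S) (nth None (L w) j)) d0.
  by exists T; split=> //; rewrite inv2M mobM ?det_inv2.
exists S; split=> //.
- by move=> i w sw; rewrite Mw_cj //; exact: (hS (inl (i, w))).
move=> w z sw; rewrite Mw_cj // mob_cj // => hz.
have fz : mob (Mw A w) (mob S z) = mob S z by rewrite -{2}hz mobVK.
have := hS (inr (w, index (mob S z) (L w))); rewrite /= nth_index ?mobK //.
exact: hL.
Qed.

Lemma rat_near (x e : R) : 0 < e -> exists p : rat, `|x - ratr p| < e.
Proof.
move=> e0; have [|p] := @rat_in_itvoo R (x - e) (x + e); first by lra.
by rewrite in_itv /= => /andP[h1 h2]; exists p; rewrite ltr_norml; apply/andP; split; lra.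
Qed.

Definition ratpt (i : option (rat * rat)) : sphere R :=
  if i is Some (a, b) then Some (ratr a +i* ratr b)%C else None.

Lemma ratpt_dense z (e : R) : 0 < e -> exists i, chord z (ratpt i) < e.
Proof.
move=> e0; case: z => [z|]; last by exists None.
have e4 : 0 < e / 4 by rewrite divr_gt0.
have [a ha] := rat_near (complex.Re z) e4; have [b hb] := rat_near (complex.Im z) e4.
exists (Some (a, b)); apply: le_lt_trans (chord_le_eucl _ _) _.
by have := nrm_le_ReIm (z - (ratr a +i* ratr b)%C); rewrite cReB cImB /=; lra.
Qed.

(** For each rational point and radius 1/(m+1) a point of X k within that radius is picked if one
    exists. The index k is part of I, so one countable family serves all the sets. *)
Lemma separable_subsets (X : 'I_K -> set (sphere R)) : exists (I : countType) (Q : I -> sphere R),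
  forall k q (e : R), X k q -> 0 < e -> exists i, X k (Q i) /\ chord q (Q i) < e.
Proof.
pose I : countType := (option (rat * rat) * nat * 'I_K)%type.
pose Q (i : I) := xget None [set y | X i.2 y /\ chord (ratpt i.1.1) y < (i.1.2.+1%:R)^-1].
exists I, Q => k q e Xq e0.
have e2 : 0 < e / 2 by rewrite divr_gt0.
pose m := Num.truncn (e / 2)^-1.
have hm : (m.+1%:R : R)^-1 < e / 2.
  by rewrite invf_plt ?posrE // ?ltr0n //; exact: truncnS_gt.
have [|i hi] := @ratpt_dense q (m.+1%:R)^-1; first by rewrite invr_gt0 ltr0n.
have : [set y | X k y /\ chord (ratpt i) y < (m.+1%:R)^-1] (Q (i, m, k)).
  by apply: xgetPex; exists q; split=> //; rewrite chordC.
move=> [h1 h2]; exists (i, m, k); split=> //.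
move: (Q _) h2 => y h2.
by apply: le_lt_trans (chord_tri (ratpt i) _ _) _; apply: lt_trans (ltrD hi h2) _; rewrite [X in _ < X]splitr; exact: ltrD.
Qed.

End Dense.

(** F is undefined at q, so the branch of an adjacent region starts the orbit. *)
Definition coin F n := exists k q w, [/\ size w = n, sboundary (reg F k) q &
  reach F (Bset F) w (mob (mat F k) q)].

(** A relatively open piece of the boundary of region k consists of coincidences, all after the same
    time n but possibly along different words. *)
Definition intcoin F n := exists k (D : set (sphere R)), [/\ sopen D,
  (D `&` sboundary (reg F k)) !=set0 & forall q, D q -> sboundary (reg F k) q ->
  exists2 w, size w = n & reach F (Bset F) w (mob (mat F k) q)].

Section Conj.
Variables (F G : pmt R K) (h : sphere R -> sphere R) (kap : 'I_K -> 'I_K).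
Hypotheses (PF : is_pmt F) (PG : is_pmt G) (cFG : conjd F G h kap).

Lemma coin_conj n : coin F n -> coin G n.
Proof.
move=> [k [q [w [sw bq rw]]]]; exists (kap k), (h q), (map kap w); rewrite size_map; split=> //.
  exact: conjd_bd PF PG cFG _ _ bq.
have [_ _ _ <-] := cFG; last by have /(bdE PF)[] := bq.
apply: reachS (conjd_reach cFG rw).
by move=> _ [z Bz <-]; exact: conjd_B PF PG cFG _ Bz.
Qed.

Lemma intcoin_conj n : intcoin F n -> intcoin G n.
Proof.
move=> [k [D [oD [q0 [Dq0 bq0]] hD]]].
have [g [kap' [cGF hK gK]]] := conjd_sym PF PG cFG.
have [[h' [hh1 hh2 ch ch']] _ rE mE] := cFG.
have eg : h' = g by apply/funext => y; rewrite -[in LHS](gK y) hh1.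
rewrite {}eg in hh1 hh2 ch'.
exists (kap k), (h @` D); split.
- exact: (sopen_image hh1 hh2 ch').
- by exists (h q0); split; [exists q0 | exact: conjd_bd PF PG cFG _ _ bq0].
move=> _ [q Dq <-] bq.
have bq' : sboundary (reg F k) q.
  have ek : kap' (kap k) = k.
    have [x rx] := reg_ne PF k; have rx' := (rE k x).1 rx.
    have [_ _ /(_ (kap k) (h x)) [rE2 _] _] := cGF.
    by have := rE2 rx'; rewrite hK => /(reg_uniq PF); apply.
  by have := conjd_bd PG PF cGF bq; rewrite hK ek.
have [w sw rw] := hD q Dq bq'; exists (map kap w); first by rewrite size_map.
rewrite -mE; last by have /(bdE PF)[] := bq'.
apply: reachS (conjd_reach cFG rw).
by move=> _ [z Bz <-]; exact: conjd_B PF PG cFG _ Bz.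
Qed.

End Conj.
End GenericConjugate.

(** * Smooth points of the boundary *)

Section SmoothBoundary.
Variable R : realType.
Notation C := (Cplx R).
Notation M2 := 'M[C]_2.
Notation o0 := (ord0 : 'I_2).
Notation o1 := (ord_max : 'I_2).
Implicit Types (z q x p : sphere R) (g : R -> sphere R) (X O D : set (sphere R)).

Lemma rcont_chord g x : rcont g -> continuous (fun t => chord x (g t)).
Proof.
move=> cg t; apply/cvgrPdist_lt => e e0; have [d d0 hd] := cg t e e0.
apply/nbhs_ballP; exists d => // s /= /hd h; apply: le_lt_trans h.
have h1 := chord_tri (g t) x (g s); have h2 := chord_tri (g s) x (g t).
rewrite (chordC (g s)) in h2; rewrite ler_norml; apply/andP; split; lra.
Qed.

Lemma compact_away g x (a b : R) : rcont g -> (forall t, a <= t <= b -> g t <> x) ->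
  exists2 d : R, 0 < d & forall t, a <= t <= b -> d <= chord x (g t).
Proof.
move=> cg hx; have [ab|ba] := lerP a b; last first.
  by exists 1 => // t /andP[h1 h2]; have := le_trans h1 h2; rewrite leNgt ba.
have [|c] := @EVT_min _ (fun t => chord x (g t)) a b ab.
  by apply: continuous_subspaceT; exact: rcont_chord.
rewrite in_itv /= => hc hm; exists (chord x (g c)).
  by rewrite chord_gt0 eq_sym; apply/eqP; exact: hx.
by move=> t ht; apply: hm; rewrite in_itv.
Qed.

Lemma period_nat g t n : (forall t, g (t + 1) = g t) -> g (t + n%:R) = g t.
Proof.
move=> pg; elim: n => [|n IH]; first by rewrite addr0.
by rewrite -natr1 addrA pg.
Qed.

Lemma period_range g t : (forall t, g (t + 1) = g t) -> exists2 s, 0 <= s < 1 & g s = g t.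
Proof.
move=> pg; pose n := Num.truncn `|t|; have hn := truncnS_gt `|t|.
have t0 : 0 <= t + n.+1%:R by have := ler_norm (- t); rewrite normrN -/n in hn *; lra.
pose m := Num.truncn (t + n.+1%:R); have /andP[h1 h2] := truncn_itv t0.
exists (t + n.+1%:R - m%:R).
  by apply/andP; split; [rewrite subr_ge0; exact: h1 | rewrite ltrBlDl natr1; exact: h2].
by rewrite -(period_nat _ m pg) subrK period_nat.
Qed.

Lemma itv_partition (tt : nat -> R) m s : tt 0%N <= s -> s < tt m ->
  exists2 j, (j < m)%N & tt j <= s < tt j.+1.
Proof.
elim: m => [|m IH] h0 hm; first by have := le_lt_trans h0 hm; rewrite ltxx.
have [h|h] := ltP s (tt m); last by exists m => //; rewrite h hm.
by have [j jm hj] := IH h0 h; exists j => //; exact: ltnW.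
Qed.

Definition sclosed X := forall x, ~ X x -> exists2 d : R, 0 < d & sball x d `<=` ~` X.

(** Baire's theorem for finite closed covers: either P i contains X on all of O, or the open set O
    minus P i still meets X and the remaining members cover X there. *)
Lemma finite_union_part (I : eqType) (s : seq I) (P : I -> set (sphere R)) X O :
  (forall i, i \in s -> sclosed (P i)) -> sopen O -> (O `&` X) !=set0 ->
  (forall x, O x -> X x -> exists2 i, i \in s & P i x) ->
  exists i D, [/\ i \in s, sopen D, D `<=` O, (D `&` X) !=set0 & D `&` X `<=` P i].
Proof.
elim: s O => [|i s IH] O cP oO [x [Ox Xx]] cov; first by have [] := cov x Ox Xx.
have [h|/existsNP[y /not_implyP[[Oy Xy] nP]]] := pselect (forall y, (O `&` X) y -> P i y).
  by exists i, O; split=> //; [rewrite inE eqxx | exists x].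
have [||||j [D [js oD DO D0 DP]]] := IH (O `\` P i).
- by move=> j js; apply: cP; rewrite inE js orbT.
- move=> z [Oz nz]; have [d d0 hd] := oO z Oz; have [d' d'0 hd'] := cP i (mem_head _ _) z nz.
  exists (Num.min d d'); first by rewrite lt_min d0.
  by move=> w; rewrite /sball /= lt_min => /andP[h1 h2]; split; [exact: hd | exact: hd'].
- by exists y.
- move=> z [Oz nz] Xz; have [j] := cov z Oz Xz; rewrite inE => /orP[/eqP -> //|js Pz].
  by exists j.
exists j, D; split=> //; first by rewrite inE js orbT.
by move=> z /DO[].
Qed.

Lemma sclosed_arc g (a b : R) : rcont g -> sclosed [set z | exists2 t, a <= t <= b & g t = z].
Proof.
move=> cg x nx; have [|d d0 hd] := @compact_away g x a b cg.
  by move=> t ht e; apply: nx; exists t.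
exists d => // w hw [t ht e]; have := hd t ht; rewrite e leNgt; move/negP; apply; exact: hw.
Qed.

Lemma sclosed_range g : rcont g -> (forall t, g (t + 1) = g t) -> sclosed (range g).
Proof.
move=> cg pg x nx; have [|d d0 hd] := @sclosed_arc g 0 1 cg x.
  by move=> [t _ e]; apply: nx; exists t.
exists d => // w hw [t _ e]; apply: (hd w hw); rewrite -e.
by have [s /andP[s0 /ltW s1] es] := period_range t pg; exists s => //; rewrite s0.
Qed.

Lemma sopen_ball p (e : R) : sopen (sball p e).
Proof.
move=> z; rewrite /sball /= => h; exists (e - chord p z); first by rewrite subr_gt0.
by move=> w /= hw; apply: le_lt_trans (chord_tri z _ _) _; lra.
Qed.

Lemma arc_param g (a b t0 e : R) (L : seq (sphere R)) D : rcont g -> a < b -> a <= t0 <= b ->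
  (forall s t, a < s < b -> a < t < b -> g s = g t -> s = t) -> sopen D -> D (g t0) ->
  exists t, [/\ a < t < b, D (g t) & g t \notin L].
Proof.
move=> cg ab /andP[at0 tb0] ig oD Dt; have [d d0 hd] := oD _ Dt.
have [d' d'0 hd'] := cg t0 d d0.
pose lo := Num.max a (t0 - d'); pose hi := Num.min b (t0 + d').
have lohi : lo < hi by rewrite /lo /hi lt_min !gt_max ab; apply/andP; split; apply/andP; split; lra.
have [|r /andP[r1 r2] hr] := @avoid_fin R 'I_(size L) (fun i r => a < r < b /\ g r = nth None L i) lo hi lohi.
  move=> i; have [[r0 [h1 h2]]|h] := pselect (exists r, a < r < b /\ g r = nth None L i).
    by exists [:: r0] => r [h3 h4]; rewrite inE; apply/eqP/ig => //; rewrite h2 h4.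
  by exists [::] => r hr; case: h; exists r.
move: r1 r2; rewrite /lo /hi gt_max lt_min => /andP[r1 r2] /andP[r3 r4].
exists r; split; first by rewrite r1 r3.
  by apply: hd; apply: hd'; rewrite ltr_norml; apply/andP; split; lra.
apply/negP => rL; have ri : (index (g r) L < size L)%N by rewrite index_mem.
by apply: (hr (Ordinal ri)); rewrite r1 r3 /= nth_index.
Qed.

(** Away from 0 and infinity both charts give a finite nonvanishing regular curve, the second after
    inversion. *)
Lemma piece_param g (a b t : R) : smooth_piece g a b -> a < t < b -> g t != None -> g t != Some 0 ->
  exists (be : R -> C) (h : R), [/\ 0 < h, dc be t != 0, be t != 0 &
    forall s, `|s - t| < h -> [/\ a < s < b, C1c be s & g s = Some (be s)]].
Proof.
move=> [x [y [hx hy hd hg]]] /andP[ta tb] gN g0; have cz := C1fun_curve hx hy.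
pose z s : C := (x s +i* y s)%C.
have tI : a <= t <= b by rewrite !ltW.
have dz : dc z t != 0.
  by apply/eqP => /= -[e1 e2]; have [] := hd t tI; rewrite ?e1 ?e2 eqxx.
have nI : \forall s \near t, a < s < b.
  by near=> s; apply/andP; split; near: s; [exact: near_gtr | exact: near_ltr].
case: hg => hg.
  have [h h0 hh] := near_dist nI; exists z, h; split=> //.
    by apply: contra_neq g0 => e; rewrite (hg t tI) -/(z t) e.
  by move=> s /hh hs; split=> //; apply: hg; move/andP: hs => [s1 s2]; rewrite !ltW.
have zt : z t != 0 by apply: contra_neq gN => e; rewrite (hg t tI) -/(z t) e /= eqxx.
have [h h0 hh] := near_dist (filterI nI (C1c_near_neq0 (cz t) zt)).
exists (fun s => (z s)^-1), h; split=> //.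
- by rewrite (dc_V zt (cz t)) mulf_neq0 // oppr_eq0 expf_neq0 // invr_eq0.
- by rewrite invr_eq0.
move=> s /hh[hs zs]; split=> //; first by apply: C1c_V => //; exact: cz.
rewrite hg -/(z s) /= ?(negbTE zs) //; by move/andP: hs => [s1 s2]; rewrite !ltW.
Unshelve. all: by end_near. Qed.

Variable K : nat.

(* [q] is an interior point of a smooth arc that is the whole boundary near [q]. *)
Definition smoothbd (F : pmt R K) k q := exists (be : R -> C) (t0 h : R),
  [/\ 0 < h, dc be t0 != 0, be t0 != 0 /\ q = Some (be t0),
    forall t, `|t - t0| < h -> C1c be t /\ sboundary (reg F k) (Some (be t)) &
    forall h' : R, 0 < h' -> exists2 d : R, 0 < d & forall x, chord q x < d ->
      sboundary (reg F k) x -> exists2 t, `|t - t0| < h' & x = Some (be t)].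

(** The curves bounding a region may overlap or cross. Two uses of [finite_union_part] isolate an
    open set in which the boundary lies on one curve, then on one smooth piece, and a parameter
    inside that piece is chosen. *)
Lemma smooth_bd_dense (F : pmt R K) k p (e : R) (L : seq (sphere R)) : is_pmt F ->
  sboundary (reg F k) p -> 0 < e -> exists q, [/\ chord p q < e, q \notin L & smoothbd F k q].
Proof.
move=> PF bp e0; have [m [S [hS eS]]] := reg_psscc PF k.
have Xcov x : sboundary (reg F k) x -> exists2 i : 'I_m, i \in enum 'I_m & S i x.
  by rewrite eS => -[i Si]; exists i => //; rewrite mem_enum.
have [|||i [D1 [_ oD1 D1O D10 D1S]]] := @finite_union_part _ (enum 'I_m) S (sboundary (reg F k)) (sball p e) _ (@sopen_ball p e).
- by move=> i _; have [g [cg pg _ -> _]] := hS i; exact: sclosed_range.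
- by exists p; split=> //; rewrite /sball /= chordzz.
- by move=> x _; exact: Xcov.
have [g [cg pg ig eg [n [tt [tt0 ttn ttm hp]]]]] := hS i.
have mono a b : (a <= b)%N -> (b <= n)%N -> tt a <= tt b.
  elim: b => [|b IH]; first by rewrite leqn0 => /eqP ->.
  rewrite leq_eqVlt => /orP[/eqP -> //|]; rewrite ltnS => ab bn.
  by apply: le_trans (IH ab (ltnW bn)) _; apply: ltW; exact: ttm.
pose P j := [set z | exists2 t, tt j <= t <= tt j.+1 & g t = z].
have [|||j [D [jn oD DD1 D0 DP]]] := @finite_union_part _ (iota 0 n) P (sboundary (reg F k)) D1 _ oD1.
- by move=> j _; exact: sclosed_arc.
- by [].
- move=> x Dx bx; have : S i x by apply: D1S.
  rewrite eg => -[t _ <-]; have [s /andP[s0 s1] <-] := period_range t pg.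
  have [||j jn /andP[h1 h2]] := @itv_partition tt n s; rewrite ?tt0 ?ttn //.
  by exists j; [rewrite mem_iota | exists s => //; rewrite h1 ltW].
move: jn; rewrite mem_iota /= add0n => jn.
set a := tt j in P DP *; set b := tt j.+1 in P DP *.
have ab : a < b by exact: ttm.
have a0 : 0 <= a by rewrite -tt0; apply: mono => //; exact: ltnW.
have b1 : b <= 1 by rewrite -ttn; exact: mono.
have D0' := D0; move: D0' => [x [Dx bx]]; have [t1 ht1 et1] := DP x (conj Dx bx).
have inj s t : a < s < b -> a <= t <= b -> g s = g t -> s = t.
  move=> /andP[s1 s2] /andP[h1 h2] e1.
  have s01 : 0 <= s < 1 by rewrite (le_trans a0 (ltW s1)) (lt_le_trans s2).
  have [t_lt1|t_ge1] := ltP t 1; first by apply: ig => //; rewrite (le_trans a0 h1).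
  have t1E : t = 1 by apply/eqP; rewrite eq_le t_ge1 (le_trans h2).
  have : s = 0 by apply: ig => //; rewrite ?lexx ?ltr01 // e1 t1E -[1]add0r pg.
  by move=> s0; have := le_lt_trans a0 s1; rewrite s0 ltxx.
rewrite -et1 in Dx.
(* Infinity and 0 are avoided together with L, as [piece_param] requires. *)
have [|t [ht Dt tL]] := @arc_param g a b t1 e (None :: Some 0 :: L) D cg ab ht1 _ oD Dx.
  by move=> s t hs ht; apply: inj => //; move/andP: ht => [? ?]; rewrite !ltW.
move: tL; rewrite !inE !negb_or => /and3P[tN t0 tL].
have [be [h [h0 dbe be0 hbe]]] := piece_param (hp j jn) ht tN t0.
have gt : g t = Some (be t) by have [] := hbe t ltac:(by rewrite subrr normr0).
exists (g t); split=> //; first exact: (D1O _ (DD1 _ Dt)).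
exists be, t, h; split=> //.
  move=> s /hbe[hs cs <-]; split=> //; rewrite eS; exists i; rewrite eg; by exists s.
move=> h' h'0; pose h2 := Num.min h h'; have h20 : 0 < h2 by rewrite lt_min h0.
have away s : a <= s <= b -> s <> t -> g s <> g t.
  by move=> hs st e1; apply: st; apply/esym/inj.
move/andP: (ht) => [ta tb].
have [|d1 d10 hd1] := @compact_away g (g t) a (t - h2) cg.
  move=> s /andP[s1 s2]; apply: away; last by move=> es; rewrite es in s2; lra.
  by rewrite s1 /=; lra.
have [|d2 d20 hd2] := @compact_away g (g t) (t + h2) b cg.
  move=> s /andP[s1 s2]; apply: away; last by move=> es; rewrite es in s1; lra.
  by rewrite s2 andbT; lra.
have [d3 d30 hd3] := oD _ Dt.
exists (Num.min d3 (Num.min d1 d2)); first by rewrite !lt_min d30 d10.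
move=> y; rewrite !lt_min => /and3P[y3 y1 y2] by'.
have [s /andP[s1 s2] es] := DP y (conj (hd3 _ y3) by').
have hs : `|s - t| < h2.
  rewrite ltr_norml; apply/andP; split.
    rewrite ltNge; apply/negP => hh.
    have k1 : d1 <= chord (g t) y by rewrite -es; apply: hd1; rewrite s1 /=; lra.
    by have := lt_le_trans y1 k1; rewrite ltxx.
  rewrite ltNge; apply/negP => hh.
  have k2 : d2 <= chord (g t) y by rewrite -es; apply: hd2; rewrite s2 andbT; lra.
  by have := lt_le_trans y2 k2; rewrite ltxx.
move: hs; rewrite lt_min => /andP[hs1 hs2]; exists s => //.
by have [_ _ <-] := hbe s hs1.
Qed.

End SmoothBoundary.

(** * Moebius images of smooth curves *)

Section MobCurve.
Variable R : realType.
Notation C := (Cplx R).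
Notation M2 := 'M[C]_2.
Notation o0 := (ord0 : 'I_2).
Notation o1 := (ord_max : 'I_2).

Definition mobc (M : M2) (z : C) : C := (M o0 o0 * z + M o0 o1) / (M o1 o0 * z + M o1 o1).

Lemma mob_mobc (M : M2) (z p : C) : mob M (Some z) = Some p ->
  M o1 o0 * z + M o1 o1 != 0 /\ mobc M z = p.
Proof. by rewrite /mob /mobc; case: eqVneq => // h [<-]. Qed.

Lemma mobc_C1c (M : M2) (al : R -> C) t : M o1 o0 * al t + M o1 o1 != 0 -> C1c al t ->
  C1c (fun s => mobc M (al s)) t /\ (dc al t = 0 -> dc (fun s => mobc M (al s)) t = 0).
Proof.
move=> n0 ca; have aff (a b : C) : C1c (fun s => a * al s + b) t /\
    (dc al t = 0 -> is_dc (fun s => a * al s + b) t 0).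
  split; first by apply: C1c_D (C1c_cst _ _); apply: C1c_M => //; exact: C1c_cst.
  move=> d0; have := is_dc_D (is_dc_M (is_dc_cst a t) (C1c_dc ca)) (is_dc_cst b t).
  by rewrite d0 mulr0 mul0r !addr0.
have [c1 d1] := aff (M o0 o0) (M o0 o1); have [c2 d2] := aff (M o1 o0) (M o1 o1).
have c3 := C1c_V n0 c2; split; first exact: C1c_M.
move=> d0; apply: is_dcE; have h3 := C1c_dc c3.
rewrite (dc_V n0 c2) (is_dcE (d2 d0)) mulr0 in h3.
by have := is_dc_M (d1 d0) h3; rewrite mul0r mulr0 addr0.
Qed.

(** The image keeps a nonzero velocity, because a zero velocity would persist under the inverse map
    and give one for [al]. *)
Lemma mob_curve (M : M2) (al : R -> C) (t0 h : R) (p : C) : \det M = 1 -> 0 < h ->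
  (forall t, `|t - t0| < h -> C1c al t) -> dc al t0 != 0 -> mob M (Some (al t0)) = Some p ->
  exists2 h' : R, 0 < h' <= h & [/\ forall t, `|t - t0| < h' -> C1c (fun s => mobc M (al s)) t /\
     mob M (Some (al t)) = Some (mobc M (al t)), dc (fun s => mobc M (al s)) t0 != 0 & mobc M (al t0) = p].
Proof.
move=> dM h0 ca da /[dup] hp /mob_mobc[n0 ep].
have c0 : C1c al t0 by apply: ca; rewrite subrr normr0.
have cl : C1c (fun s => M o1 o0 * al s + M o1 o1) t0.
  by apply: C1c_D (C1c_cst _ _); apply: C1c_M => //; exact: C1c_cst.
have [h1 h10 hh] := near_dist (C1c_near_neq0 cl n0).
have hm t : `|t - t0| < h1 -> mob M (Some (al t)) = Some (mobc M (al t)).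
  by move=> /hh nt; rewrite /mob (negbTE nt).
exists (Num.min h1 h); first by rewrite lt_min h10 h0 ge_min lexx orbT.
split=> //.
  move=> t; rewrite lt_min => /andP[/[dup] /hh nt /hm et /ca ct]; split=> //.
  by have [] := mobc_C1c nt ct.
apply: contra_neq da => d0.
have inv t : `|t - t0| < h1 -> mob (inv2 M) (Some (mobc M (al t))) = Some (al t).
  by move=> /hm <-; rewrite mobK.
have [n1 _] := mob_mobc (inv t0 ltac:(by rewrite subrr normr0)).
have [cb _] := mobc_C1c n0 c0.
have [cc /(_ d0) dd] := mobc_C1c n1 cb.
apply: is_dcE; rewrite -dd; apply: is_dc_near (C1c_dc cc).
by apply: dist_near h10 _ => t /inv /mob_mobc[].
Qed.

End MobCurve.

(** * Structurally stable maps have no coincidence *)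

Section NoCoincidence.
Variables (R : realType) (K : nat).
Notation C := (Cplx R).
Notation M2 := 'M[C]_2.
Notation mats := ('I_K -> M2).
Notation o0 := (ord0 : 'I_2).
Notation o1 := (ord_max : 'I_2).
Implicit Types (F G : pmt R K) (z q x y p : sphere R) (k : 'I_K) (w v : seq 'I_K) (S T M : M2) (A B : mats).

Lemma lox_moves M : \det M = 1 -> lox M -> exists z, mob M z <> z.
Proof.
move=> dM /(lox_eigd dM)[l [u [v ed]]]; have [a] := notin_ex [:: pt u; pt v].
rewrite !inE => /norP[/eqP au /eqP av]; exists a => fa.
by have [] := lox_fix dM ed fa.
Qed.

(** Making all words of length n + 1 loxodromic ensures that none acts as the identity, as
    [generic_conj] requires. It is then applied to a countable dense set of boundary points. *)
Lemma generic_perturbation F n (e : R) : is_pmt F -> 0 < e -> exists A,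
  [/\ forall k, \det (A k) = 1, forall k, mn (A k - mat F k) < e,
   forall k (D : set (sphere R)), sopen D -> (D `&` sboundary (reg F k)) !=set0 ->
     exists q, [/\ D q, sboundary (reg F k) q & forall w, size w = n -> Rset F (mob (Mw A (k :: w)) q)] &
   forall k w z, size w = n -> mob (Mw A (k :: w)) z = z -> Rset F z].
Proof.
move=> PF e0; have dF := mat_det PF.
have [B [dB nB lB]] := generic_words dF (ltn0Sn n) (divr_gt0 e0 (ltr0n _ 2)).
have [d d0 hd] := cj_near B (divr_gt0 e0 (ltr0n _ 2)).
have [I [Q hQ]] := separable_subsets (fun k => sboundary (reg F k)).
have [|S [dS nS h1 h2]] := generic_conj PF Q dB (n := n.+1) _ d0.
  by move=> w sw; apply: lox_moves; [exact: det_Mw | exact: lB].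
exists (fun k => cj S (B k)); split.
- by move=> k; exact: det_cj.
- move=> k; have := mnD (cj S (B k) - B k) (B k - mat F k); rewrite addrA subrK.
  by have := hd S nS k; have := nB k; lra.
- move=> k D oD [q [Dq bq]]; have [r r0 hr] := oD q Dq.
  have [i [bi ci]] := hQ k q r bq r0; exists (Q i); split=> //; first exact: hr.
  by move=> w' sw'; apply: h1; rewrite /= sw'.
- by move=> k w z sw; apply: h2; rewrite /= sw.
Qed.

Lemma mob_close (A1 A2 : M2) q x (e : R) : \det A1 = 1 -> \det A2 = 1 -> 0 < e ->
  mn (A2 - A1) < e / (8 * (mn A1 + 1)) -> chord q x < e / (4 * (mn A1 ^+ 2 + 1)) ->
  chord (mob A1 q) (mob A2 x) < e.
Proof.
move=> d1 d2 e0; have m0 := mn_ge0 A1; have s0 := sqr_ge0 (mn A1).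
rewrite !ltr_pdivlMr; [|lra|lra] => h1 h2.
apply: le_lt_trans (chord_tri (mob A1 x) _ _) _.
have h3 := chord_mob_le q x d1; have h4 := mob_near x d1 d2; rewrite mnBC in h4.
have := mn_ge0 (A2 - A1); have := chord_ge0 q x.
move: (mn (A2 - A1)) (chord q x) h1 h2 h3 h4 => u v h1 h2 h3 h4 v0 u0.
nra.
Qed.

(** One transvection takes q to q0; a second, fixing q0, takes the image of p to p0. *)
Lemma align q0 p0 (e : R) : q0 != p0 -> 0 < e -> exists2 d : R, 0 < d & forall q p,
  chord q0 q < d -> chord p0 p < d -> exists T, [/\ \det T = 1, mn (T - 1%:M) < e, mob T q = q0 & mob T p = p0].
Proof.
move=> qp e0; have [z0 zq] := other_pt q0.
have e2p : 0 < Num.min 4^-1 (e / 8) by rewrite lt_min divr_gt0 // invr_gt0 ltr0n.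
have [d2 d20 h2] := tv_small qp e2p.
have e1p : 0 < Num.min (d2 / 32) (e / 32) by rewrite lt_min !divr_gt0.
have [d1 d10 h1] := tv_small zq e1p.
exists (Num.min d1 (d2 / 2)); first by rewrite lt_min d10 divr_gt0.
move=> q p; rewrite !lt_min => /andP[q1 _] /andP[_ p1].
have [|t1 [n1 et1]] := h1 q q0 q1; first by rewrite chordzz.
move: n1; rewrite lt_min => /andP[n1 n1'].
have [||t2 [n2 et2]] := h2 (mob (tv z0 t1) p) p0; last 1 first.
- move: n2; rewrite lt_min => /andP[n2 n2'].
  exists (tv q0 t2 *m tv z0 t1); split.
  + by rewrite det_mul1 // det_tv.
  + apply: le_lt_trans (mn_prod1 _ _) _.
    have := mn_tv1 q0 t2; have := mn_tv1 z0 t1.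
    have : mn (tv q0 t2) <= mn (tv q0 t2 - 1%:M) + 2 by rewrite -[X in _ + X](@mn1 R); have := mnD (tv q0 t2 - 1%:M) 1%:M; rewrite subrK.
    have := mn_ge0 (tv z0 t1 - 1%:M).
    move: (mn (tv q0 t2)) (mn (tv q0 t2 - 1%:M)) (mn (tv z0 t1 - 1%:M)) (nrm t1) (nrm t2) n1 n1' n2 n2'.
    move=> a b c d f n1 n1' n2 n2' c0 h3 h4 h5.
    nra.
  + by rewrite mobM ?det_tv // et1 mob_tv_fix.
  + by rewrite mobM ?det_tv.
- apply: le_lt_trans (chord_tri p _ _) _; have := tv_near z0 t1 p; lra.
- by rewrite chordzz.
Qed.

(** The coincidence is first carried to the generic G1, where [intcoin] fails. The open arc of
    coincidences is created in a perturbation G3 of G1 that is still conjugate to F, and is carried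
    back to G1. *)
Lemma no_coin F n : is_pmt F -> struct_stable F -> ~ coin F n.
Proof.
move=> PF sF cF; have [e e0 he] := stable_push PF sF.
have [A1 [dA1 nA1 gen fixR]] := generic_perturbation n PF (divr_gt0 e0 (ltr0n _ 2)).
have [||PG1 [h1 [kap1 cFG1]]] := he id A1 (goodmap_id R) dA1.
- by move=> k; have := nA1 k; lra.
- by move=> z; rewrite chordzz.
set G1 := push F id A1 in PG1 cFG1.
have rG1 k : reg G1 k = reg F k by rewrite /= image_id.
have BG1 : Bset G1 = Bset F.
  by apply/funext => z; apply/propext; split=> -[k hk]; exists k; move: hk; rewrite rG1.
have nint : ~ intcoin G1 n.
  move=> [k [D [oD D0 hD]]]; rewrite rG1 in D0 hD.
  have [q [Dq bq hq]] := gen k D oD D0.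
  have [w sw] := hD q Dq bq; move=> /(reach_iff PG1)[_]; rewrite BG1 => /(BsetE PF); apply.
  by have := hq w sw; rewrite /= mobM ?det_Mw.
have [k [q0 [w [sw bq0 rq0]]]] := coin_conj PF PG1 cFG1 cF.
have [rT] := (reach_iff PG1 _ _ _).1 rq0; rewrite BG1 rG1 in bq0 *.
set M := Mw A1 (k :: w); have dM : \det M = 1 by exact: det_Mw.
rewrite -mobM ?det_Mw // -/M; set p0 := mob M q0 => Bp0.
(* Genericity puts the fixed points of words of length n + 1 in R(F), and q0 lies on the
   boundary. *)
have qp : q0 != p0.
  apply/eqP => ep; have : Rset F q0 by apply: (fixR k w) sw _; exact: esym.
  by move/(RsetNB PF); apply; exists k.
have [e2 e20 he2] := reach_stable PG1 rT.
set m := mn (A1 k) in he2; have m0 : 0 <= mn (A1 k) by exact: mn_ge0.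
have s0 := sqr_ge0 (mn (A1 k)).
pose eta := Num.min (e / 4) (Num.min e2 (e2 / (8 * (mn (A1 k) + 1)))).
have eta0 : 0 < eta by rewrite !lt_min e20 !divr_gt0 // mulr_gt0 //; lra.
have [d2 d20 hd2] := cj_near A1 eta0.
have [d3 d30 hd3] := align qp d20.
pose rq := e2 / (8 * (mn (A1 k) ^+ 2 + 1)).
have rq0' : 0 < rq by rewrite divr_gt0 // mulr_gt0 //; lra.
have [|q [cq _ [be1 [t1 [h1' [h10 db1 [b10 eq1] hb1 loc1]]]]]] := smooth_bd_dense [::] PF bq0 (e := Num.min d3 rq).
  by rewrite lt_min d30.
have [k2 bp0] := Bp0.
have [p [cp pq [be2 [t2 [h2' [h20 db2 [b20 ep2] hb2 _]]]]]] := smooth_bd_dense [:: q] PF bp0 d30.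
move: pq; rewrite inE => pq; move: cq; rewrite lt_min => /andP[cq cq'].
(* Conjugating by T replaces the coincidence from q0 to p0 by one from q to p, both smooth boundary
   points. *)
have [T [dT nT Tq Tp]] := hd3 q p cq cp.
pose A2 k := cj T (A1 k).
have dA2 j : \det (A2 j) = 1 by exact: det_cj.
have nA2 j : mn (A2 j - A1 j) < eta by exact: hd2.
have nA2F j : mn (A2 j - mat F j) < e.
  have := mnD (A2 j - A1 j) (A1 j - mat F j); rewrite addrA subrK.
  have : eta <= e / 4 by rewrite ge_min lexx.
  by have := nA2 j; have := nA1 j; lra.
have eM2 : Mw A2 (k :: w) = cj T M by rewrite Mw_cj.
have M2q : mob (cj T M) q = p by rewrite mob_cj // Tq -/p0 -Tp mobK.
rewrite eq1 ep2 in M2q.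
have [h3 /andP[h30 h3h] [hal dal al0]] := mob_curve (det_cj dT dM) h10 (fun t ht => (hb1 t ht).1) db1 M2q.
have pq0 : 0 < chord p q by rewrite chord_gt0.
pose e3 := Num.min e (Num.min e2 (chord p q / 2)).
have e30 : 0 < e3 by rewrite !lt_min e0 e20 divr_gt0.
have h40 : 0 < Num.min h3 h2' by rewrite lt_min h30.
(* The twist about a centre near p lays the boundary arc at p onto the image of the arc at q. Its
   support is too small to reach q, so the arc at q stays where it is. *)
have [||phi [gphi dphi offphi [k0 k00 hphi]]] := @arc_twist R (fun s => mobc (cj T M) (be1 s)) be2 t1 t2 (Num.min h3 h2') e3 (be2 t2) h40 e30 b20 _ _ al0 erefl dal db2.
- by move=> t; rewrite lt_min => /andP[/hal[]].
- by move=> t; rewrite lt_min => /andP[_ /hb2[]].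
have [e3e e3e2 e3c] : [/\ e3 <= e, e3 <= e2 & e3 <= chord p q / 2].
  by rewrite /e3; split; rewrite !ge_min lexx ?orbT.
have [|PG3 [h4 [kap4 cFG3]]] := he phi A2 gphi dA2 nA2F.
  by move=> z; apply: lt_le_trans (dphi z) e3e.
set G3 := push F phi A2 in PG3 cFG3.
have [[psi [K1 K2 cphi cpsi]] _] := gphi.
have bG3 j : sboundary (reg G3 j) = phi @` sboundary (reg F j) by rewrite /= (boundary_image K1 K2 cphi cpsi).
apply: nint; have [h5 [kap5 [cGF _ _]]] := conjd_sym PF PG3 cFG3.
apply: (intcoin_conj PF PG1 cFG1); apply: (intcoin_conj PG3 PF cGF).
have k30 : 0 < Num.min k0 h3 by rewrite lt_min k00.
have [d4 d40 hd4] := loc1 _ k30.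
pose rD := Num.min d4 (Num.min (chord p q / 2) rq).
have rD0 : 0 < rD by rewrite !lt_min d40 rq0' divr_gt0.
have fixphi x : chord q x < rD -> phi x = x.
  rewrite !lt_min => /and3P[_ hx _]; apply: offphi; rewrite -ep2.
  by have := chord_tri x p q; rewrite (chordC x); lra.
exists k, (sball q rD); split; first exact: sopen_ball.
  exists q; split; first by rewrite /sball /= chordzz.
  rewrite bG3; exists q; last by apply: fixphi; rewrite chordzz.
  by rewrite eq1; have [] := hb1 t1 ltac:(by rewrite subrr normr0).
move=> x; rewrite /sball /= => hx; rewrite bG3 => -[y by' ey].
have {ey} xy : y = x by apply: (can_inj K1); rewrite ey fixphi.
rewrite {}xy in by'; move: (hx); rewrite !lt_min => /and3P[x4 _ xr].
have [t] := hd4 x x4 by'; rewrite lt_min => /andP[tk0 th3] ex.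
exists w => //; apply/(reach_iff PG3); split.
  apply: he2 => //.
  - by move=> j; apply: lt_le_trans (nA2 j) _; rewrite !ge_min lexx !orbT.
  - have rn : rnear F G3 e2.
      by apply: rnear_push; [exists psi | move=> z; apply: lt_le_trans (dphi z) e3e2].
    by move=> j z hz; apply: rn => z' /hz; rewrite rG1.
  apply: mob_close => //.
    by apply: lt_le_trans (nA2 k) _; rewrite !ge_min lexx !orbT.
  apply: le_lt_trans (chord_tri q _ _) _.
  apply: lt_le_trans (ltrD cq' xr) _; rewrite /rq.
  by rewrite le_eqVlt; apply/orP; left; apply/eqP; field; lra.
rewrite -mobM ?det_Mw //.
have -> : Mw (mat G3) w *m mat G3 k = cj T M by exact: eM2.
rewrite ex; have [_ ->] := hal t th3.
have [s hs <-] := hphi t tk0; exists k2; rewrite bG3; exists (Some (be2 s)) => //.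
by move: hs; rewrite lt_min => /andP[_ /hb2[]].
Qed.

End NoCoincidence.

(** * Existence of regular points *)

Section RegularPoint.
Variables (R : realType) (K : nat).
Notation C := (Cplx R).
Notation M2 := 'M[C]_2.
Notation mats := ('I_K -> M2).
Notation o0 := (ord0 : 'I_2).
Notation o1 := (ord_max : 'I_2).
Implicit Types (F G : pmt R K) (z q x y p : sphere R) (k : 'I_K) (w v : seq 'I_K) (S T M N : M2) (A B : mats).

(* By invariance of the cross-ratio. *)
Lemma mob_lipschitz N q c c' (d r : R) x : \det N = 1 -> 0 < d -> 0 < r -> r <= chord c c' ->
  (forall y, chord q y < d -> mob N y <> c /\ mob N y <> c') -> chord q x < d / 2 ->
  chord (mob N x) (mob N q) <= 16 / (r * d ^+ 2) * chord x q.
Proof.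
move=> dN d0 r0 rc hN hx; pose u := mob (inv2 N) c; pose v := mob (inv2 N) c'.
have Nu : mob N u = c by rewrite mobVK.
have Nv : mob N v = c' by rewrite mobVK.
have qu : d <= chord q u by rewrite leNgt; apply/negP => /hN[].
have qv : d <= chord q v by rewrite leNgt; apply/negP => /hN[_]; rewrite Nv.
have xu : d / 2 <= chord x u by have := chord_tri x q u; lra.
clearbody u v.
have E : chord (mob N x) (mob N q) * chord c c' * (chord x u * chord q v) =
    chord x q * chord u v * (chord (mob N x) c * chord (mob N q) c').
  rewrite -Nu -Nv !chord_mob //.
  have [hx0 _] := hn_apm_ge x dN; have [hq0 _] := hn_apm_ge q dN.
  have [hu0 _] := hn_apm_ge u dN; have [hv0 _] := hn_apm_ge v dN.
  by field; rewrite !gt_eqF.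
have c1 := chord_ge0 (mob N x) (mob N q); have c2 := chord_ge0 x q.
have c3 := chord_le2 u v; have c3' := chord_ge0 u v.
have c4 := chord_le2 (mob N x) c; have c4' := chord_ge0 (mob N x) c.
have c5 := chord_le2 (mob N q) c'; have c5' := chord_ge0 (mob N q) c'.
have rd : 0 < r * d ^+ 2 by rewrite mulr_gt0 // exprn_gt0.
have -> : 16 / (r * d ^+ 2) * chord x q = 16 * chord x q / (r * d ^+ 2) by rewrite mulrAC.
rewrite ler_pdivlMr //.
have h1 : chord (mob N x) (mob N q) * r * (d / 2 * d) <= chord (mob N x) (mob N q) * chord c c' * (chord x u * chord q v).
  apply: ler_pM.
  - by rewrite mulr_ge0 // ltW.
  - by rewrite mulr_ge0 //; lra.
  - by rewrite ler_wpM2l.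
  - by apply: ler_pM => //; lra.
have h2 : chord x q * chord u v * (chord (mob N x) c * chord (mob N q) c') <= chord x q * 2 * (2 * 2).
  apply: ler_pM.
  - by rewrite mulr_ge0.
  - by rewrite mulr_ge0.
  - by rewrite ler_wpM2l.
  - by apply: ler_pM.
rewrite E in h1; move: (le_trans h1 h2).
by rewrite expr2; lra.
Qed.

(** Small perturbations are conjugate to F, so the absence of coincidences holds on a whole
    neighbourhood. *)
Lemma no_coin_push F : is_pmt F -> struct_stable F -> exists2 e : R, 0 < e &
  forall f A, goodmap f -> (forall k, \det (A k) = 1) -> (forall k, mn (A k - mat F k) < e) ->
    (forall z, chord z (f z) < e) -> is_pmt (push F f A) /\ forall n, ~ coin (push F f A) n.
Proof.
move=> PF sF; have [e e0 he] := stable_push PF sF; exists e => // f A gf dA nA df.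
have [PG [h [kap cFG]]] := he f A gf dA nA df; split=> // n cG.
have [g [kap' [cGF _ _]]] := conjd_sym PF PG cFG.
by apply: (@no_coin R K F n PF sF); exact: (coin_conj PG PF cGF cG).
Qed.

Lemma coin_free F k q w : is_pmt F -> (forall n, ~ coin F n) -> sboundary (reg F k) q ->
  reach F setT w (mob (mat F k) q) -> Rset F (mob (Mw (mat F) (k :: w)) q).
Proof.
move=> PF nc bq rw; apply/(RsetNB PF) => Bw; apply: (nc (size w)); exists k, q, w; split=> //.
by apply/(reach_iff PF); split=> //; rewrite -mobM ?det_Mw //; exact: mat_det.
Qed.

Lemma reach_push_fixed F f A w x : (forall k, A k = mat F k) -> reach F setT w x ->
  (forall v u, w = v ++ u -> u != [::] -> f (mob (Mw (mat F) v) x) = mob (Mw (mat F) v) x) ->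
  (forall k, \det (mat F k) = 1) -> reach (push F f A) setT w x.
Proof.
move=> eA + + dF; elim: w x => //= k w IH x [rk rw] hf; split.
  by exists x => //; have := hf [::] (k :: w) erefl isT; rewrite /= mob1.
rewrite eA; apply: IH => // v u ew nu.
by have := hf (k :: v) u; rewrite /= ew mobM ?det_Mw //; exact.
Qed.

Section Orbit.
Variables (F : pmt R K) (k0 : 'I_K) (q : sphere R).
Hypotheses (PF : is_pmt F) (sF : struct_stable F) (bq : sboundary (reg F k0) q).
Let dF := mat_det PF.
Let nc n : ~ coin F n := @no_coin R K F n PF sF.
Let q1 := mob (mat F k0) q.
Let orb w := mob (Mw (mat F) w) q1.

Let orbE w : orb w = mob (Mw (mat F) (k0 :: w)) q.
Proof. by rewrite /orb /q1 /= mobM ?det_Mw. Qed.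

(* Otherwise the first orbit point very close to [p] can be put on the boundary by a twist about [p]. *)
Lemma orbit_away p : Bset F p -> exists2 d : R, 0 < d & forall w, reach F setT w q1 -> d <= chord p (orb w).
Proof.
move=> Bp; have [e e0 he] := no_coin_push PF sF.
have [D [[d d0 hd] qD hD]] := point_twist q PF Bp e0.
have [hw|nw] := pselect (exists w, reach F setT w q1 /\ D (orb w)); last first.
  exists d => // w rw; rewrite leNgt; apply/negP => h; apply: nw; exists w; split=> //; exact: hd.
exfalso.
have ex : exists n, `[< exists w, [/\ size w = n, reach F setT w q1 & D (orb w)] >].
  by have [w [rw Dw]] := hw; exists (size w); apply/asboolP; exists w.
(* At the first entry into D the earlier orbit points lie outside D, so a twist supported in D
   leaves the orbit up to that time unchanged. *)
have [n /asboolP[w [sw rw Dw]] nmin] := ex_minnP ex.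
have RD : Rset F (orb w) by rewrite orbE; exact: coin_free.
have op : orb w <> p by move=> ep; move/(RsetNB PF): RD; rewrite ep.
have [phi [gphi dphi phip off [b Bb eb]]] := hD _ Dw op.
have [||PG ncG] := he phi (mat F) gphi dF.
- by move=> k; rewrite subrr /mn !mxE nrm0 !addr0.
- exact: dphi.
have phiq : phi q = q by case: qD => [->|/off].
have [[psi [K1 K2 cphi cpsi]] _] := gphi.
set G := push F phi (mat F) in PG ncG.
have bG j : sboundary (reg G j) = phi @` sboundary (reg F j) by rewrite /= (boundary_image K1 K2 cphi cpsi).
apply: (ncG n); exists k0, q, w; split=> //; first by rewrite bG; exists q.
apply/(reach_iff PG); split; last first.
  by have [j bj] := Bb; exists j; rewrite bG; exists b.
apply: reach_push_fixed => // v u ew nu; apply: off => Dv.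
have rv : reach F setT v q1 by apply: (reach_take (s := u)) (_ : reach F setT (v ++ u) q1); rewrite -ew.
have := nmin (size v); rewrite -sw ew size_cat => /(_ ltac:(by apply/asboolP; exists v)).
by rewrite -[X in (_ <= X)%N]addn0 leq_add2l leqn0 size_eq0 (negbTE nu).
Qed.

(** The distance f to the orbit is 1-Lipschitz and positive on B(F) by [orbit_away]. It attains its
    minimum on each of the finitely many closed curves forming B(F). *)
Lemma orbit_away_unif : exists2 d : R, 0 < d & forall w, reach F setT w q1 ->
  forall b, Bset F b -> d <= chord (orb w) b.
Proof.
pose f x : R := inf [set chord x (orb w) | w in [set w | reach F setT w q1]].
have lb x w : reach F setT w q1 -> f x <= chord x (orb w).
  move=> rw; apply: ge_inf; last by exists w.
  by exists 0 => _ [v _ <-]; exact: chord_ge0.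
have ne x : [set chord x (orb w) | w in [set w | reach F setT w q1]] !=set0.
  by exists (chord x (orb [::])), [::].
have glb x (d : R) : (forall w, reach F setT w q1 -> d <= chord x (orb w)) -> d <= f x.
  by move=> h; apply: lb_le_inf => // _ [w rw <-]; exact: h.
have lip x y : f x <= f y + chord x y.
  rewrite -lerBlDr; apply: glb => w rw; rewrite lerBlDr.
  by apply: le_trans (lb x w rw) _; rewrite addrC; exact: chord_tri.
suff [d d0 hd] : exists2 d : R, 0 < d & forall k b, sboundary (reg F k) b -> d <= f b.
  exists d => // w rw b [k bk]; rewrite chordC; exact: le_trans (hd k b bk) (lb b w rw).
apply: (fin_pos (P := fun k (d : R) => forall b, sboundary (reg F k) b -> d <= f b)).
  by move=> k e e' h e'0 ee b /h; exact: le_trans.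
move=> k; have [m [S [hS eS]]] := reg_psscc PF k.
suff [d d0 hd] : exists2 d : R, 0 < d & forall i b, S i b -> d <= f b.
  by exists d => // b; rewrite eS => -[j]; exact: hd.
apply: (fin_pos (P := fun i (d : R) => forall b, S i b -> d <= f b)).
  by move=> i e e' h e'0 ee b /h; exact: le_trans.
move=> i; have [g [cg pg _ eg _]] := hS i.
have cf : continuous (f \o g).
  move=> t; apply/cvgrPdist_lt => e e0; have [d d0 hd] := cg t e e0.
  apply/nbhs_ballP; exists d => // s /= /hd h; apply: le_lt_trans h.
  have h1 := lip (g t) (g s); have h2 := lip (g s) (g t).
  by rewrite (chordC (g s)) in h2; rewrite ler_norml; apply/andP; split; lra.
have [|c _ hc] := @EVT_min _ (f \o g) 0 1 ler01; first exact: continuous_subspaceT.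
exists (f (g c)).
  have [|d d0 hd] := @orbit_away (g c); last by apply: lt_le_trans d0 _; exact: glb.
  by exists k; rewrite eS; exists i; rewrite eg; exists c.
move=> b; rewrite eg => -[t _ <-]; have [s /andP[s0 s1] <-] := period_range t pg.
by apply: hc; rewrite in_itv /= s0 ltW.
Qed.

Lemma orbit_forever n : exists2 w, size w = n & reach F setT w q1.
Proof.
elim: n => [|n [w sw rw]]; first by exists [::].
have : Rset F (orb w) by rewrite orbE; exact: coin_free.
by move=> [k rk]; exists (rcons w k); [rewrite size_rcons sw | exact: reach_rcons].
Qed.

(* The itinerary of [q] could only change along the path [tv a (s t)], 0 <= s <= 1, at a coincidence. *)
Lemma itin_path a (t : C) : (forall s : R, 0 <= s <= 1 ->
    let G := push F id (fun k => cj (tv a (s%:C%C * t)) (mat F k)) in is_pmt G /\ forall n, ~ coin G n) ->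
  forall w, reach F setT w q1 -> forall k, reg F k (orb w) ->
  reg F k (mob (inv2 (tv a t)) (mob (Mw (mat F) (k0 :: w)) (mob (tv a t) q))).
Proof.
move=> hG; pose T (s : R) := tv a (s%:C%C * t); pose G s := push F id (fun k => cj (T s) (mat F k)).
have dT s : \det (T s) = 1 by exact: det_tv.
pose y w s := mob (cj (T s) (Mw (mat F) (k0 :: w))) q.
have rG s k : reg (G s) k = reg F k by rewrite /= image_id.
have MG s w : Mw (mat (G s)) (k0 :: w) = cj (T s) (Mw (mat F) (k0 :: w)) by rewrite Mw_cj.
have cy w : rcont (y w).
  apply: (@rcont_mob _ (fun s => cj (T s) (Mw (mat F) (k0 :: w)))); last first.
    by move=> s; apply: det_cj => //; exact: det_Mw.
  rewrite /cj; apply: mcontM; last exact: mcont_tv.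
  apply: mcontM; last exact: mcont_cst.
  have -> : (fun s => inv2 (T s)) = (fun s : R => tv a (s%:C%C * - t)).
    by apply/funext => s; rewrite inv2_tv mulrN.
  exact: mcont_tv.
have y0 w : y w 0 = orb w.
  rewrite orbE /y /T mul0r tv0 /cj mulmx1.
  by rewrite -(mul1mx (inv2 1%:M)) mulmV ?det1 // mul1mx.
have step w : (forall s, 0 <= s <= 1 -> reach (G s) setT w (mob (mat (G s) k0) q)) ->
    forall k, reg F k (orb w) -> forall s, 0 <= s <= 1 -> reg F k (y w s).
  move=> hr k rk; apply: (path_reg PF) => //; last by rewrite y0.
  move=> s hs; have [PG ncG] := hG s hs.
  have bqG : sboundary (reg (G s) k0) q by rewrite rG.
  have [k' rk'] := coin_free PG ncG bqG (hr s hs); exists k'.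
  by rewrite -(rG s) /y -MG.
have all_reach w : reach F setT w q1 -> forall s, 0 <= s <= 1 -> reach (G s) setT w (mob (mat (G s) k0) q).
  elim/last_ind: w => [//|w k IH]; rewrite -{1}cats1 => /(reach_split PF)[rw [rk _]] s hs; have [PG ncG] := hG s hs.
  apply: reach_rcons => //; first exact: IH.
  rewrite rG; have := step w (IH rw) k rk s hs; rewrite /y -MG.
  have dG k' : \det (mat (G s) k') = 1 by exact: (mat_det PG).
  by rewrite -mobM //; exact: det_Mw.
move=> w rw k rk; have := step w (all_reach w rw) k rk 1; rewrite lexx ler01 => /(_ isT).
by rewrite /y /T mul1r mob_cj ?det_tv ?det_Mw.
Qed.

(** Two candidates for omitted values in each region. The balls around them absorb the small
    transvection that [itin_path] leaves in front of the orbit point. *)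
Lemma test_points : exists2 r : R, 0 < r & forall k, exists c c', [/\ r <= chord c c',
  sball c r `<=` reg F k & sball c' r `<=` reg F k].
Proof.
apply: (fin_pos (P := fun k (r : R) => exists c c', [/\ r <= chord c c',
  sball c r `<=` reg F k & sball c' r `<=` reg F k])).
  move=> k e e' [c [c' [h1 h2 h3]]] e'0 ee; exists c, c'; split; first exact: le_trans h1.
    by move=> z hz; apply: h2; exact: lt_le_trans hz ee.
  by move=> z hz; apply: h3; exact: lt_le_trans hz ee.
move=> k; have [c rc] := reg_ne PF k; have [e e0 he] := reg_open PF rc.
have [c' cc he'] := near_neq c e0; have rc' : reg F k c' by exact: he.
have [e' e'0 he2] := reg_open PF rc'.
have cp : 0 < chord c c' by rewrite chord_gt0 eq_sym.
exists (Num.min (chord c c') (Num.min e e')); first by rewrite !lt_min cp e0.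
exists c, c'; split; first by rewrite ge_min lexx.
  by move=> z; rewrite /sball /= !lt_min => /and3P[_ hz _]; exact: he.
by move=> z; rewrite /sball /= !lt_min => /and3P[_ _ hz]; exact: he2.
Qed.

(** With a single region F would agree with one Moebius map near q, against minimality. *)
Lemma other_reg k : exists j, j != k.
Proof.
apply: contrapT => h; apply: (pmt_min PF); exists q, 1, (mat F k); split=> //; first by exists k0.
by move=> j w _ _; have -> // : j = k by apply/eqP; apply: contrapT => /negP jk; apply: h; exists j.
Qed.

(** A point x near q is [mob (tv a t) q]. By [itin_path] its image along w lies, up to a small
    transvection, in the region k of the orbit point, so it misses the test points of another region
    j. The Lipschitz constant of [mob_lipschitz] depends only on r and d, not on w. *)
Lemma equicontinuous : exists d L : R, [/\ 0 < d, 0 <= L & forall w, reach F setT w q1 -> forall x, chord q x < d ->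
  chord (mob (Mw (mat F) (k0 :: w)) x) (orb w) <= L * chord x q].
Proof.
have [e e0 he] := no_coin_push PF sF; have [d1 d10 hd1] := cj_near (mat F) e0.
have [r r0 hr] := test_points; have [a aq] := other_pt q.
have [|d d0 hd] := @tv_small R a q (Num.min (d1 / 4) (r / 16)) aq; first by rewrite lt_min !divr_gt0.
have omit w : reach F setT w q1 -> exists c c', r <= chord c c' /\ forall x, chord q x < d ->
    mob (Mw (mat F) (k0 :: w)) x <> c /\ mob (Mw (mat F) (k0 :: w)) x <> c'.
  move=> rw; have [k rk] : Rset F (orb w) by rewrite orbE; exact: coin_free.
  have [j jk] := other_reg k; have [c [c' [cc hc hc']]] := hr j.
  exists c, c'; split=> // x hx; have [|t [ht et]] := hd q x _ hx; first by rewrite chordzz.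
  move: ht; rewrite lt_min => /andP[t1 t2].
  have := itin_path (a := a) (t := t) _ rw rk; rewrite et => /(_ _) h.
  have {}h : reg F k (mob (inv2 (tv a t)) (mob (Mw (mat F) (k0 :: w)) x)).
    apply: h => s /andP[s0 s1]; apply: he; first exact: goodmap_id.
    - by move=> i; apply: det_cj; [exact: det_tv | exact: dF].
    - apply: hd1; apply: le_lt_trans (mn_tv1 _ _) _; rewrite nrmM.
      have : nrm (s%:C%C : C) * nrm t <= nrm t.
        by rewrite ler_piMl ?nrm_ge0 // nrm_real ger0_norm.
      lra.
    - by move=> z; rewrite chordzz.
  have out c1 : sball c1 r `<=` reg F j -> mob (Mw (mat F) (k0 :: w)) x <> c1.
    move=> hc1 e1; rewrite e1 in h; have : reg F j (mob (inv2 (tv a t)) c1).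
      apply: hc1; rewrite /sball /= inv2_tv; apply: le_lt_trans (tv_near _ _ _) _.
      by rewrite nrmN; lra.
    by move=> h'; have := reg_uniq PF h' h; apply/eqP.
  by split; exact: out.
have rd : 0 < r * d ^+ 2 by rewrite mulr_gt0 // exprn_gt0.
exists (d / 2), (16 / (r * d ^+ 2)); split; [by rewrite divr_gt0 | by rewrite divr_ge0 // ltW |].
move=> w rw x hx; have [c [c' [cc hcc]]] := omit w rw; rewrite orbE.
by apply: (mob_lipschitz (c := c) (c' := c')) => //; exact: det_Mw.
Qed.

(** Equicontinuity keeps the images of a neighbourhood of q closer to the orbit than B(F) ever is,
    so all its points follow the itinerary of q forever. *)
Lemma boundary_image_regular : Rcal F q1.
Proof.
have [dl dl0 hdl] := orbit_away_unif; have [d [L [d0 L0 hL]]] := equicontinuous.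
pose eta := Num.min d (dl / (L + 1)).
have eta0 : 0 < eta by rewrite lt_min d0 divr_gt0 //; lra.
have close w x : reach F setT w q1 -> chord q x < eta -> chord (orb w) (mob (Mw (mat F) (k0 :: w)) x) < dl.
  move=> rw; rewrite lt_min => /andP[h1]; rewrite ltr_pdivlMr; last lra.
  by move=> h2; rewrite chordC; apply: le_lt_trans (hL w rw x h1) _; rewrite chordC; have := chord_ge0 q x; lra.
have [a aq] := other_pt q.
have [|d2 d20 hd2] := @tv_small R a q (eta / 16) aq; first by rewrite divr_gt0.
have same w k x : reach F setT w q1 -> reg F k (orb w) -> chord q x < d2 -> reg F k (mob (Mw (mat F) (k0 :: w)) x).
  move=> rw rk hx; have [|t [ht <-]] := hd2 q x _ hx; first by rewrite chordzz.
  pose g (s : R) := mob (Mw (mat F) (k0 :: w) *m tv a (s%:C%C * t)) q.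
  have dM : \det (Mw (mat F) (k0 :: w)) = 1 by exact: det_Mw.
  have gE s : g s = mob (Mw (mat F) (k0 :: w)) (mob (tv a (s%:C%C * t)) q).
    by rewrite /g mobM ?det_tv.
  have -> : mob (Mw (mat F) (k0 :: w)) (mob (tv a t) q) = g 1 by rewrite gE mul1r.
  apply: (path_reg PF (g := g)); rewrite ?lexx ?ler01 //.
  - apply: (@rcont_mob _ (fun s : R => Mw (mat F) (k0 :: w) *m tv a (s%:C%C * t))).
      by apply: mcontM; [exact: mcont_cst | exact: mcont_tv].
    by move=> s; rewrite det_mul1 // det_tv.
  - move=> s /andP[s0 s1]; apply/(RsetNB PF) => Bs.
    have : chord q (mob (tv a (s%:C%C * t)) q) < eta.
      apply: le_lt_trans (tv_near _ _ _) _; rewrite nrmM.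
      have : nrm (s%:C%C : C) * nrm t <= nrm t.
        by rewrite ler_piMl ?nrm_ge0 // nrm_real ger0_norm.
      lra.
    by move/(close w _ rw); rewrite -gE ltNge hdl.
  by rewrite gE mul0r tv0 mob1 -orbE.
have reachx w x : reach F setT w q1 -> chord q x < d2 -> reach F setT w (mob (mat F k0) x).
  elim/last_ind: w => [//|w k IH]; rewrite -cats1 => /(reach_split PF)[rw [rk _]] hx.
  rewrite cats1; apply: reach_rcons => //; first exact: IH.
  by rewrite -mobM ?det_Mw //; exact: same rw rk hx.
have m0 := sqr_ge0 (mn (mat F k0)).
apply: (ball_Rcal PF (r := d2 / (mn (mat F k0) ^+ 2 + 1))).
  by rewrite divr_gt0 //; lra.
move=> y hy n; have [w sw rw] := orbit_forever n; exists w => //.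
rewrite -(mobVK (dF k0) y); apply: reachx => //.
rewrite -{1}(mobK (dF k0) q) -/q1.
have dV : \det (inv2 (mat F k0)) = 1 by rewrite det_inv2.
apply: le_lt_trans (chord_mob_le _ _ dV) _; rewrite mn_inv2.
move: hy; rewrite ltr_pdivlMr; last lra.
by have := chord_ge0 q1 y; lra.
Qed.

End Orbit.

Lemma stable_Rcal F : is_pmt F -> struct_stable F -> Rcal F !=set0.
Proof.
move=> PF sF; have [[q [k bq]]|nB] := pselect (Bset F !=set0).
  by exists (mob (mat F k) q); exact: boundary_image_regular.
(* If B(F) is empty, no orbit ever leaves R(F). *)
exists None; apply: (ball_Rcal PF ltr01) => y _ n; apply: (Fn_reach PF) => j _.
by apply/(RsetNB PF) => Bj; apply: nB; exists (Fn F j y).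
Qed.

End RegularPoint.

Theorem theorem6p1 (R : realType) (K : nat) (F : pmt R K) :
  is_pmt F -> struct_stable F -> ~ (exists U, wandering F U) -> hyperbolic F.
Proof. by move=> PF sF nW; apply: stable_hyperbolic => //; exact: stable_Rcal. Qed.
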